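(* Let $r\geqslant 2$, let $M$ be a smooth manifold with a closed differential form $\alpha\in\Omega^r(M)$, and let $G$ be a group of symmetries of $(M,\alpha)$ with Lie algebra $\mathfrak g$. Suppose $b_1(M)=0$. Then there exists a multi-moment map $\nu\colon M\to\mathcal P_{\mathfrak g}^*$ for the action of $G$ if either (i) $G$ is compact, or (ii) $M$ is compact and orientable, and $G$ preserves a volume form on $M$.
   Context: A group of symmetries of $(M,\alpha)$ is a connected Lie group $G$ acting smoothly on $M$ and preserving $\alpha$. For $X\in\mathfrak g$ we also write $X$ for the vector field on $M$ generated by $X$, $X_x=\frac{d}{dt}\big|_{t=0}\exp(tX)\cdot x$; extending linearly and multiplicatively, each $\mathsf p\in\Lambda^s\mathfrak g$ gives a multi-vector field $p\in\Gamma(\Lambda^sTM)$, where $\mathsf X_1\wedge\dots\wedge \mathsf X_s$ gives $X_1\wedge\dots\wedge X_s$. Contraction is $(X_1\wedge\dots\wedge X_s)\lrcorner\,\beta=\beta(X_1,\dots,X_s,\cdot,\dots,\cdot)$. Let $L\colon\Lambda^k\mathfrak g\to\Lambda^{k-1}\mathfrak g$ be the linear map $L(X_1\wedge\dots\wedge X_k)=\sum_{i<j}(-1)^{i+j}[X_i,X_j]\wedge X_1\wedge\dots\wedge\widehat{X_i}\wedge\dots\wedge\widehat{X_j}\wedge\dots\wedge X_k$. The $k$th Lie kernel of $\mathfrak g$ is the $G$-module $\mathcal P_{\mathfrak g,k}=\ker(L\colon\Lambda^k\mathfrak g\to\Lambda^{k-1}\mathfrak g)$. For a closed form of degree $r$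 put $\mathcal P_{\mathfrak g}=\mathcal P_{\mathfrak g,r-1}$; $G$ acts on it via the adjoint action, and on $\mathcal P_{\mathfrak g}^*$ via the dual action. A multi-moment map for the action of $G$ on $(M,\alpha)$ is a smooth $G$-equivariant map $\nu\colon M\to\mathcal P_{\mathfrak g}^*$ satisfying $d\langle\nu,\mathsf p\rangle=p\lrcorner\,\alpha$ for all $\mathsf p\in\mathcal P_{\mathfrak g}$. $b_1(M)$ is the first Betti number of $M$, the dimension of the first de Rham cohomology. *)

(* Defs.v *)
From HB Require Import structures.
From mathcomp Require Import all_boot all_order all_algebra.
From mathcomp Require Import all_classical all_reals all_analysis.

Set Implicit Arguments.
Unset Strict Implicit.
Unset Printing Implicit Defensive.

Import Order.TTheory GRing.Theory Num.Theory.
Import numFieldNormedType.Exports.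

Local Open Scope classical_set_scope.
Local Open Scope ring_scope.

(* To be used with [U] open and [V] finite-dimensional; it then suffices that
   all directional derivatives of the given order are continuous. *)
Fixpoint Ck (R : realType) (V W : normedModType R) (k : nat)
    (U : set V) (f : V -> W) : Prop :=
  match k with
  | 0 => forall x, U x -> {for x, continuous f}
  | j.+1 => (forall x, U x -> differentiable f x) /\
            (forall v, Ck j U (fun x => 'd f x v))
  end.

Definition smooth_on (R : realType) (V W : normedModType R)
    (U : set V) (f : V -> W) : Prop := forall k, Ck k U f.

(* Only the values of [cmap] on [cdom] and of [cinv] on the image matter. *)
Record chart (R : realType) (T : topologicalType) (n : nat) := Chart {
  cdom : set T;
  cmap :> T -> 'rV[R]_n;
  cinv : 'rV[R]_n -> T;
  cdom_open : open cdom;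
  ccod_open : open (cmap @` cdom);
  cmapK : {in cdom, cancel cmap cinv};
  cmap_continuous : {in cdom, continuous cmap};
  cinv_continuous : {in cmap @` cdom, continuous cinv}
}.

Definition ccod (R : realType) (T : topologicalType) (n : nat)
  (c : chart R T n) : set 'rV[R]_n := c @` cdom c.

Definition smooth_transition (R : realType) (T : topologicalType) (n : nat)
    (c c' : chart R T n) : Prop :=
  smooth_on (c @` (cdom c `&` cdom c')) (c' \o cinv c).

(* The smooth structure is given by the atlas [{chart_at x}_x], which has a
   distinguished chart around each point.  Every atlas can be put in this form
   without changing the maximal atlas it generates.  The distinguished chart
   serves as coordinates on the tangent space: throughout, the tangent space at
   [x] is ['rV[R]_n], a vector being given by its components in [chart_at x]. *)
HB.mixin Record isManifold (R : realType) (n : nat) M of Topological M := {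
  chart_at : M -> chart R M n;
  chart_atP : forall x, cdom (chart_at x) x;
  chart_at_smooth : forall x y, smooth_transition (chart_at x) (chart_at y);
  manifold_hausdorff : hausdorff_space M;
  manifold_second_countable : @second_countable M
}.

#[short(type="manifoldType")]
HB.structure Definition Manifold (R : realType) (n : nat) :=
  {M of Topological M & isManifold R n M}.

Notation tangent R n := ('rV[R]_n) (only parsing).

Section Manifolds.
Context {R : realType}.

Definition smooth_into (V : normedModType R) (n : nat) (N : manifoldType R n)
    (U : set V) (f : V -> N) : Prop :=
  (forall y, U y -> {for y, continuous f}) /\
  (forall z : N,
     smooth_on (U `&` f @^-1` cdom (chart_at z)) (chart_at z \o f)).

Definition smooth_map (m n : nat) (M : manifoldType R m) (N : manifoldType R n)
    (f : M -> N) : Prop :=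
  forall x : M, smooth_into (ccod (chart_at x)) (f \o cinv (chart_at x)).

(* Smoothness of a map out of the product manifold [M1 * M2], whose atlas
   consists of the products of charts. *)
Definition smooth_map2 (m1 m2 n : nat) (M1 : manifoldType R m1)
    (M2 : manifoldType R m2) (N : manifoldType R n)
    (f : M1 -> M2 -> N) : Prop :=
  forall (x : M1) (y : M2),
    smooth_into (ccod (chart_at x) `*` ccod (chart_at y))
      (fun z : 'rV[R]_m1 * 'rV[R]_m2 =>
         f (cinv (chart_at x) z.1) (cinv (chart_at y) z.2)).

Definition smooth_fun (n : nat) (M : manifoldType R n) (f : M -> R) : Prop :=
  forall x : M,
    smooth_on (ccod (chart_at x)) (f \o cinv (chart_at x) : _ -> R^o).

(* The differential T_x M -> T_(f x) N. *)
Definition mdiff (m n : nat) (M : manifoldType R m) (N : manifoldType R n)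
    (f : M -> N) (x : M) (v : tangent R m) : tangent R n :=
  'd (chart_at (f x) \o f \o cinv (chart_at x)) (chart_at x x) v.

Definition dfun (n : nat) (M : manifoldType R n) (f : M -> R)
    (x : M) (v : tangent R n) : R :=
  'd (f \o cinv (chart_at x) : _ -> R^o) (chart_at x x) v.

(* The tangent vector at [x := cinv c y] whose components in the chart [c]
   are [v], and conversely the components in [c] of [v] tangent at [x]. *)
Definition tvec (n : nat) (M : manifoldType R n) (c : chart R M n)
    (y v : 'rV[R]_n) : tangent R n :=
  'd (chart_at (cinv c y) \o cinv c) y v.

Definition tcoord (n : nat) (M : manifoldType R n) (c : chart R M n)
    (x : M) (v : tangent R n) : 'rV[R]_n :=
  'd (c \o cinv (chart_at x)) (chart_at x x) v.

(* [V,W]_x = D_V W - D_W V in the coordinates of [chart_at x]. *)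
Definition vf_bracket (n : nat) (M : manifoldType R n)
    (V W : M -> tangent R n) (x : M) : tangent R n :=
  let c := chart_at x in
  let loc (Z : M -> tangent R n) y := tcoord c (cinv c y) (Z (cinv c y)) in
  'd (loc W) (c x) (V x) - 'd (loc V) (c x) (W x).

End Manifolds.

Section Forms.
Context {R : realType} {n : nat} (M : manifoldType R n).

Definition upd (r : nat) (v : 'I_r -> 'rV[R]_n) (i : 'I_r) (u : 'rV[R]_n) :
  'I_r -> 'rV[R]_n := fun j => if j == i then u else v j.

(* [form_loc w c y v] is (cinv c)^* w at the point [y] evaluated on [v]. *)
Definition form_loc (r : nat) (w : M -> ('I_r -> tangent R n) -> R)
    (c : chart R M n) (y : 'rV[R]_n) (v : 'I_r -> 'rV[R]_n) : R :=
  w (cinv c y) (fun i => tvec c y (v i)).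

Record diff_form (r : nat) := DiffForm {
  form_val :> M -> ('I_r -> tangent R n) -> R;
  form_multilinear : forall x v i a u u',
    form_val x (upd v i (a *: u + u')) =
    a * form_val x (upd v i u) + form_val x (upd v i u');
  form_alternating : forall x v i j,
    i != j -> v i = v j -> form_val x v = 0;
  form_smooth : forall (z : M) (v : 'I_r -> 'rV[R]_n),
    smooth_on (ccod (chart_at z))
      (fun y => form_loc form_val (chart_at z) y v : R^o)
}.

(* (dw)_x(v_0,...,v_r) = \sum_i (-1)^i D_(v_i) w(v_0,...,^v_i,...,v_r),
   computed in the coordinates of [chart_at x]. *)
Definition ext_d (r : nat) (w : diff_form r) (x : M)
    (v : 'I_r.+1 -> tangent R n) : R :=
  \sum_(i < r.+1) (-1) ^+ i *
    'd (fun y => form_loc w (chart_at x) y (fun j => v (lift i j)) : R^o)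
       (chart_at x x) (v i).

Definition closed_form (r : nat) (w : diff_form r) : Prop :=
  forall x v, ext_d w x v = 0.

(* [betti1 b]: there are closed 1-forms w_0,...,w_(b-1) whose classes form a
   basis of the first de Rham cohomology, i.e. dim H^1_dR(M) = b. *)
Definition betti1 (b : nat) : Prop :=
  exists w : 'I_b -> diff_form 1,
    (forall i, closed_form (w i)) /\
    (forall eta : diff_form 1, closed_form eta ->
       exists! a : 'rV[R]_b, exists f : M -> R, smooth_fun f /\
         forall x v, eta x v - \sum_(i < b) a 0 i * w i x v = dfun f x (v ord0)).

Definition volume_form (w : diff_form n) : Prop :=
  forall x, exists v, w x v != 0.

Definition orientable : Prop :=
  exists A : set (chart R M n),
    [/\ forall c, A c -> forall x : M, smooth_transition c (chart_at x) /\
                                       smooth_transition (chart_at x) c,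
        forall x : M, exists2 c, A c & cdom c x
      & forall c c' x, A c -> A c' -> cdom c x -> cdom c' x ->
          0 < \det (lin1_mx ('d (c' \o cinv c) (c x)))].

Definition preserves_form (r : nat) (phi : M -> M) (w : diff_form r) : Prop :=
  forall x v, w (phi x) (fun i => mdiff phi x (v i)) = w x v.

End Forms.

Section Exterior.
Context {R : realType}.

Definition increasing_tuple (k m : nat) :=
  {f : {ffun 'I_k -> 'I_m} | [forall i : 'I_k, forall j : 'I_k, (i < j)%N ==> (f i < f j)%N]}.

(* The k-th exterior power of R^m, in the basis e_(f 0) /\ ... /\ e_(f (k-1))
   indexed by the increasing maps f. *)
Definition Lambda (k m : nat) := {ffun increasing_tuple k m -> R^o}.

Definition basis_vec (m : nat) (i : 'I_m) : 'rV[R]_m := delta_mx 0 i.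

(* X_0 /\ ... /\ X_(k-1), for a list [X] of length [k]: its components are
   the maximal minors. *)
Definition wedge (k m : nat) (X : seq 'rV[R]_m) : Lambda k m :=
  [ffun f : increasing_tuple k m =>
     \det (\matrix_(a < k, b < k) nth 0 X a 0 (val f b))].

(* Lambda^k A, for A linear. *)
Definition Lambda_map (k m n : nat) (A : 'rV[R]_m -> 'rV[R]_n)
    (p : Lambda k m) : Lambda k n :=
  \sum_f p f *: wedge k [seq A (basis_vec (val f a)) | a : 'I_k].

(* q _| b, where (X_0 /\ ... /\ X_(s-1)) _| b = b(X_0,...,X_(s-1),...). *)
Definition contract (s r n : nat) (q : Lambda s n)
    (b : ('I_r -> 'rV[R]_n) -> R) (w : 'I_(r - s) -> 'rV[R]_n) : R :=
  \sum_f q f *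
    b (fun i => nth 0 ([seq basis_vec (val f a) | a : 'I_s] ++ codom w) i).

End Exterior.
Arguments Lambda : clear implicits.

HB.mixin Record isLieGroup (R : realType) (m : nat) G
    of Manifold R m G & Group G := {
  mulg_smooth : smooth_map2 (fun x y : G => (x * y)%g);
  invg_smooth : smooth_map (fun x : G => x^-1%g)
}.

#[short(type="lieGroupType")]
HB.structure Definition LieGroup (R : realType) (m : nat) :=
  {G of Manifold R m G & Group G & isLieGroup R m G}.

Section LieGroups.
Context {R : realType} {m : nat} (G : lieGroupType R m).

(* The Lie algebra of [G] is the tangent space at [1], with the bracket of
   left-invariant vector fields. *)
Definition left_invariant (X : tangent R m) (g : G) : tangent R m :=
  mdiff (fun h : G => (g * h)%g) 1%g X.

Definition lie_bracket (X Y : tangent R m) : tangent R m :=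
  vf_bracket (left_invariant X) (left_invariant Y) 1%g.

Definition Ad (g : G) (X : tangent R m) : tangent R m :=
  mdiff (fun h : G => (g * h * g^-1)%g) 1%g X.

Definition one_parameter_subgroup (X : tangent R m) (gamma : R -> G) : Prop :=
  [/\ forall s t, gamma (s + t) = (gamma s * gamma t)%g,
      smooth_into [set: R^o] gamma
    & derive1 (fun t => chart_at (1%g : G) (gamma t)) 0 = X].

(* t |-> exp(tX) is the one-parameter subgroup with initial velocity X; it
   exists and is unique, so the default value is immaterial. *)
Definition exp_curve (X : tangent R m) : R -> G :=
  xget (fun=> 1%g) (one_parameter_subgroup X).

(* L on X_0 /\ ... /\ X_(k-1), for a list [X] of length [k].  Indexing from 0
   instead of 1 does not affect the sign (-1)^(i+j). *)
Definition lieL_wedge (k : nat) (X : seq 'rV[R]_m) : Lambda R k.-1 m :=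
  \sum_(i < k) \sum_(j < k | (i < j)%N)
    (-1) ^+ (i + j) *:
      wedge k.-1 (lie_bracket X`_i X`_j ::
        [seq X`_l | l <- iota 0 k & (l != i :> nat) && (l != j :> nat)]).

(* [lieL_wedge] is multilinear and alternating in [X]; its linear extension is
   determined by the values on the basis. *)
Definition lieL (k : nat) (p : Lambda R k m) : Lambda R k.-1 m :=
  \sum_f p f *: lieL_wedge k [seq basis_vec (val f a) | a : 'I_k].

Definition lie_kernel (k : nat) : {vspace Lambda R k m} :=
  lker (linfun (@lieL k)).

(* The adjoint action on the Lie kernel.  As [Ad g] preserves brackets,
   [Lambda_map (Ad g)] maps the kernel to itself, so that [vsproj] just repacks
   the result as an element of the subspace. *)
Definition Ad_kernel (k : nat) (g : G) (p : subvs_of (lie_kernel k)) :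
    subvs_of (lie_kernel k) :=
  vsproj (lie_kernel k) (Lambda_map (Ad g) (vsval p)).

Definition lie_kernel_dual (k : nat) :=
  'Hom(subvs_of (lie_kernel k), R^o).

End LieGroups.

Section MultiMoment.
Context {R : realType} {m n : nat} (G : lieGroupType R m) (M : manifoldType R n).

Record smooth_action (act : G -> M -> M) : Prop := SmoothAction {
  act_one : forall x, act 1%g x = x;
  act_mul : forall g h x, act (g * h)%g x = act g (act h x);
  act_smooth : smooth_map2 act
}.

Record group_of_symmetries (r : nat) (alpha : diff_form M r)
    (act : G -> M -> M) : Prop := GroupOfSymmetries {
  symm_connected : connected [set: G];
  symm_action : smooth_action act;
  symm_preserves : forall g, preserves_form (act g) alpha
}.

Definition fundamental (act : G -> M -> M) (X : tangent R m) (x : M) :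
    tangent R n :=
  derive1 (fun t : R => chart_at x (act (exp_curve G X t) x)) 0.

(* The value at [x] of the multi-vector field generated by [p]. *)
Definition multivector (act : G -> M -> M) (k : nat) (p : Lambda R k m)
    (x : M) : Lambda R k n :=
  Lambda_map (fun X => fundamental act X x) p.

(* A map to the finite-dimensional space P_g^* is smooth iff its components,
   i.e. its pairings with the elements of P_g, are.  The dual action is
   <g . xi, p> = <xi, Ad_(g^-1) p>, whence the form of equivariance. *)
Record multi_moment_map (r : nat) (alpha : diff_form M r) (act : G -> M -> M)
    (nu : M -> lie_kernel_dual G r.-1) : Prop := MultiMomentMap {
  mmm_smooth : forall p, smooth_fun (fun x => nu x p : R);
  mmm_equivariant : forall g x p,
    nu (act g x) p = nu x (Ad_kernel g^-1%g p);
  mmm_d : forall p x (v : tangent R n),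
    dfun (fun y => nu y p : R) x v =
    contract (multivector act (vsval p) x) (alpha x)
      (fun _ : 'I_(r - r.-1) => v)
}.

End MultiMoment.

(* Main.v *)
Require Import Defs.
From mathcomp Require Import fingroup perm.
From HB Require Import structures.
From mathcomp Require Import all_boot all_order all_algebra.
From mathcomp Require Import all_classical all_reals all_analysis.
From mathcomp Require Import ring lra zify.

(* Let [f_p] be a primitive of the closed 1-form [p _| alpha], chosen linearly
   in [p]; together they form a map [F : M -> P_g^*].  The defect
   [tau_g x = F (g x) - g . F x] has zero differential in [x], hence is locally
   constant, and, [G] being connected, constant along orbits.  So along the
   orbit of [x] the points [F (g x)] are permuted by the affine maps
   [w |-> g . w + tau_g x].  As [G] or [M] is compact, these points form a bounded
   set, and a group of affine maps with a bounded orbit has a fixed point [xi], namely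
   the unique minimum of [w |-> sup_g |g . w + tau_g x|^2] on the span of the
   orbit.  Choosing [xi] as a function of [tau x] only, it is locally constant
   in [x], and [F - xi] is the multi-moment map. *)

Set Implicit Arguments.
Unset Strict Implicit.
Unset Printing Implicit Defensive.
Import Order.TTheory GRing.Theory Num.Theory.
Import numFieldNormedType.Exports.

Local Open Scope classical_set_scope.
Local Open Scope ring_scope.

(** * Differentials and maps of class C^k *)

(** The 1-form [p _| alpha] is closed because its exterior derivative is, up to sign, the
    contraction of [alpha] with [L p]: when [d alpha = 0] is expanded on fundamental fields,
    invariance of [alpha] turns each derivative along such a field into derivatives of the other
    fields, and these pair up into brackets. Two things shape the work. The curve [exp(tX)] is a
    choice with a default value, so its existence has to be proved, by solving an ordinary
    differential equation and extending the local solution with the group law. And the fixed point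
    is found without invariant integration: a bounded orbit is what the two compactness assumptions
    have in common. The linear action of [G] on [P_g^*] need not be bounded, but it is bounded on
    the span of the orbit, and this is why the minimum is taken there. *)

Section Differentials.
Context {R : realType}.
Implicit Types V W Z : normedModType R.

Lemma is_diff_eps V W (f : V -> W) (x : V) (L : {linear V -> W}) :
  continuous L ->
  (forall e, 0 < e -> \forall h \near 0, `|f (h + x) - f x - L h| <= e * `|h|) ->
  is_diff x f L.
Proof.
move=> Lc fL.
have H : f \o shift x = cst (f x) + L +o_ 0 id.
  apply/eqaddoP => e e0; near=> h => /=.
  rewrite [X in `|X|](_ : _ = f (h + x) - f x - L h); last first.
    by rewrite /= opprD addrA.
  by near: h; exact: fL.
have dL : 'd f x = L :> (V -> W) by apply: diff_unique.
by apply: DiffDef => //; apply/diff_locallyP; rewrite dL.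
Unshelve. all: by end_near. Qed.

Lemma diff_eps V W (f : V -> W) (x : V) : differentiable f x ->
  forall e, 0 < e ->
  \forall h \near 0, `|f (h + x) - f x - 'd f x h| <= e * `|h|.
Proof.
move=> /diff_locally /eqaddoP H e e0; near=> h.
rewrite [X in `|X|](_ : _ = (f \o shift x - (cst (f x) + 'd f x)) h); last first.
  by rewrite /= opprD addrA.
by near: h; exact: H.
Unshelve. all: by end_near. Qed.

Lemma near_is_diff V W (f g : V -> W) (x : V) (df : V -> W) :
  (\forall y \near x, f y = g y) -> is_diff x f df -> is_diff x g df.
Proof.
move=> fg [fx <-].
apply: is_diff_eps; first exact: diff_continuous.
move=> e e0.
have fg0 : \forall h \near 0, f (h + x) = g (h + x).
  have H : (fun h => h + x) @ 0 --> x.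
    by rewrite -[X in _ --> X]add0r; apply: cvgD; [exact: cvg_id|exact: cvg_cst].
  exact: (H _ fg).
have <- : f x = g x by apply: nbhs_singleton fg.
by apply: filterS2 fg0 (diff_eps fx e0) => h <-.
Qed.

Lemma near_diff V W (f g : V -> W) (x : V) :
  (\forall y \near x, f y = g y) -> differentiable f x ->
  differentiable g x /\ 'd g x = 'd f x :> (V -> W).
Proof.
move=> fg df; have H : is_diff x f ('d f x) by apply: DiffDef.
by have [? ?] := near_is_diff fg H.
Qed.

Lemma is_diffP V W (f : V -> W) (x : V) :
  differentiable f x -> is_diff x f ('d f x).
Proof. by move=> df; apply: DiffDef. Qed.

Lemma is_diff_comp' V W Z (f df : V -> W) (g dg : W -> Z) x :
  is_diff x f df -> is_diff (f x) g dg -> is_diff x (g \o f) (dg \o df).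
Proof. by move=> ? ?; apply: is_diff_comp. Qed.

Lemma is_diff_linear V W (L : V -> W) (x : V) :
  linear L -> continuous L -> is_diff x L L.
Proof.
move=> Ll Lc; pose LM := GRing.isLinear.Build _ _ _ _ _ Ll.
pose L' : {linear V -> W} := HB.pack L LM.
by apply: (@is_diff_eps _ _ L x L') => // e e0; near=> h;
  rewrite [L (h + x)](linearD L')/= addrK subrr normr0 mulr_ge0// ltW.
Unshelve. all: by end_near. Qed.

Lemma is_diff_ex V W (f df : V -> W) (x : V) :
  is_diff x f df -> differentiable f x.
Proof. by case. Qed.

Lemma is_diff_val V W (f df : V -> W) (x v : V) :
  is_diff x f df -> 'd f x v = df v.
Proof. by case=> _ <-. Qed.

Lemma scale_bilinear W :
  bilinear_for
    (GRing.Scale.Law.clone _ _ *:%R _) (GRing.Scale.Law.clone _ _ *:%R _)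
    (fun (a : R^o) (w : W) => a *: w).
Proof.
split=> [u'|u] a x y /=.
- by rewrite scalerDl scalerA.
- by rewrite scalerDr !scalerA mulrC.
Qed.

Lemma is_diff_scale V W (k dk : V -> R^o) (f df : V -> W) x :
  is_diff x k dk -> is_diff x f df ->
  is_diff x (fun y => k y *: f y) (fun v => dk v *: f x + k x *: df v).
Proof.
move=> dkx dfx.
pose M := bilinear_isBilinear.Build R R^o W W _ _ _ (scale_bilinear W).
pose B : {bilinear R^o -> W -> W} := HB.pack (fun (a : R^o) (w : W) => a *: w) M.
have Bc : continuous (fun p : R^o * W => B p.1 p.2).
  by move=> p; apply: scale_continuous.
have -> : (fun y => k y *: f y) = (fun p => B p.1 p.2) \o (fun y => (k y, f y)).
  by [].
have H : is_diff (k x, f x) (fun p => B p.1 p.2)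
    (fun q => B (k x) q.2 + B q.1 (f x)).
  by apply: DiffDef; [exact: differentiable_bilin|rewrite diff_bilin].
apply: (@is_diff_eq _ _ _ _ _ _ _ (is_diff_comp' (is_diff_pair _ _) H)).
by apply/funext => v /=; rewrite addrC.
Qed.

Lemma is_diff_add V W (f df g dg : V -> W) x :
  is_diff x f df -> is_diff x g dg ->
  is_diff x (fun y => f y + g y) (fun v => df v + dg v).
Proof. by move=> ? ?; apply: is_diffD. Qed.

Lemma is_diff_sub V W (f df g dg : V -> W) x :
  is_diff x f df -> is_diff x g dg ->
  is_diff x (fun y => f y - g y) (fun v => df v - dg v).
Proof. by move=> ? ?; apply: is_diffB. Qed.

Lemma is_diff_const V W (a : W) (x : V) : is_diff x (fun=> a) (fun=> 0).
Proof. exact: is_diff_cst. Qed.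

Lemma is_diff_sum V W (I : Type) (s : seq I) (P : pred I) (f df : I -> V -> W) x :
  (forall i, P i -> is_diff x (f i) (df i)) ->
  is_diff x (fun y => \sum_(i <- s | P i) f i y)
            (fun v => \sum_(i <- s | P i) df i v).
Proof.
move=> H; elim: s => [|i s IH].
  rewrite (_ : (fun y => _) = fun=> 0); last by apply/funext => y; rewrite big_nil.
  rewrite (_ : (fun v => _) = fun=> 0); last by apply/funext => y; rewrite big_nil.
  exact: is_diff_const.
have E (g : I -> V -> W) : (fun y => \sum_(j <- i :: s | P j) g j y) =
    if P i then fun y => g i y + \sum_(j <- s | P j) g j y
    else fun y => \sum_(j <- s | P j) g j y.
  by case: ifP => Pi; apply/funext => y; rewrite big_cons Pi.
by rewrite !E; case: ifP => Pi //; apply: is_diff_add => //; apply: H.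
Qed.


(** Finite dimension as the calculus needs it: finitely many vectors [b i] with continuous linear
    coefficients. [Ck] only differentiates in fixed directions, so a direction that varies with the
    point has to be written as a combination of fixed ones. *)
Definition finite_span V : Prop :=
  exists (I : finType) (b : I -> V) (l : I -> V -> R^o),
    [/\ forall i, linear (l i), forall i, continuous (l i)
      & forall v, v = \sum_i l i v *: b i].

Lemma finite_span_R : finite_span R^o.
Proof.
exists 'I_1, (fun=> 1), (fun=> id); split=> //.
  by move=> _ x; exact: cvg_id.
by move=> v; rewrite big_ord1 /= [RHS]mulr1.
Qed.

Lemma finite_span_rV n : finite_span 'rV[R]_n.
Proof.
exists 'I_n, (fun i => delta_mx 0 i), (fun i (v : 'rV[R]_n) => v 0 i : R^o); split.
- by move=> i a u v; rewrite !mxE.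
- by move=> i; exact: coord_continuous.
- by move=> v; rewrite [LHS]row_sum_delta.
Qed.

Lemma finite_span_pair V W :
  finite_span V -> finite_span W -> finite_span (V * W)%type.
Proof.
move=> [I [b [l [l1 l2 l3]]]] [J [c [m [m1 m2 m3]]]].
exists (I + J)%type,
  (fun s => match s with inl i => (b i, 0) | inr j => (0, c j) end),
  (fun s z => match s with inl i => l i z.1 | inr j => m j z.2 end); split.
- by case=> [i|j] a u v /=; rewrite ?l1 ?m1.
- case=> [i|j] z.
  + by apply: (@continuous_comp _ _ _ fst (l i)); [exact: cvg_fst|exact: l2].
  + by apply: (@continuous_comp _ _ _ snd (m j)); [exact: cvg_snd|exact: m2].
- case=> v w; rewrite big_sumType/=.
  apply: injective_projections => /=; rewrite !raddf_sum/= [LHS](l3, m3).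
    by rewrite [X in _ + X]big1 ?addr0// => j _; rewrite scaler0.
  by rewrite [X in X + _]big1 ?add0r// => j _; rewrite scaler0.
Qed.

Lemma CkW V W k (U U' : set V) (f : V -> W) :
  U' `<=` U -> Ck k U f -> Ck k U' f.
Proof.
move=> UU; elim: k f => [|k IH] f /=; first by move=> H x /UU/H.
by move=> [H1 H2]; split=> [x /UU/H1//|v]; apply: IH.
Qed.

Lemma CkS V W k (U : set V) (f : V -> W) : Ck k.+1 U f -> Ck k U f.
Proof.
elim: k f => [|k IH] f.
  by move=> [H _] x /H /differentiable_continuous.
by move=> [H1 H2]; split=> // v; apply: IH; exact: H2.
Qed.

Lemma near_open V (U : set V) (x : V) (P : set V) :
  open U -> U x -> (forall y, U y -> P y) -> \forall y \near x, P y.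
Proof.
by move=> Uo Ux H; apply: (filterS (P := U)) => //; exact: open_nbhs_nbhs.
Qed.

Lemma Ck_ext V W k (U : set V) (f g : V -> W) :
  open U -> (forall y, U y -> f y = g y) -> Ck k U f -> Ck k U g.
Proof.
move=> Uo; elim: k f g => [|k IH] f g fg.
  move=> H x Ux; have := H x Ux; rewrite /prop_for /continuous_at -(fg x)//.
  move=> Hx; apply: cvg_trans Hx; apply: near_eq_cvg.
  by apply: (near_open Uo Ux) => y /fg.
have E x : U x -> \forall y \near x, f y = g y by move=> Ux; exact: (near_open Uo Ux).
move=> [H1 H2]; split.
  by move=> x Ux; have [] := near_diff (E x Ux) (H1 x Ux).
move=> v; apply: IH (H2 v) => x Ux.
by have [_ ->] := near_diff (E x Ux) (H1 x Ux).
Qed.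

Lemma Ck_local V W k (U : set V) (f : V -> W) :
  (forall x, U x -> exists2 U' : set V, U' x & Ck k U' f) -> Ck k U f.
Proof.
elim: k f => [|k IH] f H; first by move=> x /H[U' U'x H']; exact: H'.
split.
  by move=> x /H[U' U'x] [H1 _]; exact: H1.
by move=> v; apply: IH => x /H[U' U'x] [_ H']; exists U' => //; exact: H'.
Qed.

Lemma Ck_cst V W k (U : set V) (a : W) : Ck k U (fun _ : V => a).
Proof.
elim: k a => [|k IH] a; first by move=> x _; exact: cvg_cst.
split; first by move=> x _; exact: differentiable_cst.
move=> v; rewrite (_ : (fun x => _) = (fun=> 0)); first exact: IH.
by apply/funext => x; rewrite diff_cst.
Qed.

Lemma Ck_linear V W Z k (U : set V) (L : W -> Z) (f : V -> W) :
  open U -> linear L -> continuous L -> Ck k U f -> Ck k U (fun x => L (f x)).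
Proof.
move=> Uo Ll Lc; elim: k f => [|k IH] f.
  by move=> H x Ux; apply: (@continuous_comp _ _ _ f L); [exact: H|exact: Lc].
move=> [H1 H2].
have D x : U x -> is_diff x (L \o f) (L \o 'd f x).
  by move=> Ux; apply: is_diff_comp'; [exact/is_diffP/H1|exact: is_diff_linear].
split=> [x /D[]//|v].
by apply: (Ck_ext Uo _ (IH _ (H2 v))) => x Ux; rewrite (is_diff_val v (D x Ux)).
Qed.

Lemma Ck_add V W k (U : set V) (f g : V -> W) :
  open U -> Ck k U f -> Ck k U g -> Ck k U (fun x => f x + g x).
Proof.
move=> Uo; elim: k f g => [|k IH] f g.
  by move=> H H' x Ux; apply: cvgD; [exact: H|exact: H'].
move=> [H1 H2] [G1 G2].
have D x : U x -> is_diff x (fun x => f x + g x) (fun v => 'd f x v + 'd g x v).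
  by move=> Ux; apply: is_diff_add; [exact/is_diffP/H1|exact/is_diffP/G1].
split=> [x /D[]//|v].
by apply: (Ck_ext Uo _ (IH _ _ (H2 v) (G2 v))) => x Ux; rewrite (is_diff_val v (D x Ux)).
Qed.

Lemma Ck_sum V W k (U : set V) (I : Type) (s : seq I) (P : pred I)
    (f : I -> V -> W) :
  open U -> (forall i, P i -> Ck k U (f i)) ->
  Ck k U (fun x => \sum_(i <- s | P i) f i x).
Proof.
move=> Uo H; elim: s => [|i s IH].
  rewrite (_ : (fun x => _) = (fun=> 0)); first exact: Ck_cst.
  by apply/funext => x; rewrite big_nil.
rewrite (_ : (fun x => _) = if P i then
  fun x => f i x + \sum_(j <- s | P j) f j x else
  fun x => \sum_(j <- s | P j) f j x).
  by case: ifP => // Pi; apply: Ck_add => //; exact: H.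
by case: ifP => Pi; apply/funext => x; rewrite big_cons Pi.
Qed.

Lemma Ck_scale V W k (U : set V) (a : V -> R^o) (f : V -> W) :
  open U -> Ck k U a -> Ck k U f -> Ck k U (fun x => a x *: f x).
Proof.
move=> Uo; elim: k a f => [|k IH] a f.
  by move=> H H' x Ux; apply: cvgZ; [exact: H|exact: H'].
move=> Ha Hf; have [H1 H2] := Ha; have [G1 G2] := Hf.
have D x : U x ->
    is_diff x (fun x => a x *: f x) (fun v => 'd a x v *: f x + a x *: 'd f x v).
  by move=> Ux; apply: is_diff_scale; [exact/is_diffP/H1|exact/is_diffP/G1].
split=> [x /D[]//|v].
apply: (@Ck_ext _ _ _ _ (fun x => 'd a x v *: f x + a x *: 'd f x v) _ Uo).
  by move=> x Ux; rewrite (is_diff_val v (D x Ux)).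
apply: (Ck_add Uo); apply: IH; [exact: H2|exact: CkS Hf|exact: CkS Ha|exact: G2].
Qed.

Lemma Ck_comp V W Z k (U : set V) (U' : set W) (f : V -> W) (g : W -> Z) :
  finite_span W -> open U -> open U' -> (forall x, U x -> U' (f x)) ->
  Ck k U f -> Ck k U' g -> Ck k U (g \o f).
Proof.
move=> [I [b [l [ll lc lb]]]] Uo U'o UU; elim: k g => [|k IH] g.
  by move=> H H' x Ux; apply: continuous_comp; [exact: H|exact/H'/UU].
move=> Hf Hg; have [H1 H2] := Hf; have [G1 G2] := Hg.
have D x : U x -> is_diff x (g \o f) ('d g (f x) \o 'd f x).
  by move=> Ux; apply: is_diff_comp'; apply/is_diffP; [exact: H1|exact/G1/UU].
split=> [x /D[]//|v].
(* The direction ['d f x v] moves with [x]. Expanding it in the [b i] leaves derivatives of [g] in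
   fixed directions, to which the induction hypothesis applies. *)
apply: (@Ck_ext _ _ _ _
  (fun x => \sum_i l i ('d f x v) *: ((fun y => 'd g y (b i)) \o f) x) _ Uo).
  move=> x Ux; rewrite (is_diff_val v (D x Ux)) /=; rewrite [in RHS](lb ('d f x v)) linear_sum.
  by apply: eq_bigr => i _; rewrite linearZ.
apply: (Ck_sum _ Uo) => i _; apply: (Ck_scale Uo).
  exact: (Ck_linear Uo (ll i) (lc i) (H2 v)).
exact: IH (CkS Hf) (G2 _).
Qed.

Lemma Ck_pair V W Z k (U : set V) (f : V -> W) (g : V -> Z) :
  open U -> Ck k U f -> Ck k U g -> Ck k U (fun x => (f x, g x)).
Proof.
move=> Uo; elim: k f g => [|k IH] f g.
  by move=> H H' x Ux; apply: cvg_pair; [exact: H|exact: H'].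
move=> [H1 H2] [G1 G2].
have D x : U x -> is_diff x (fun x => (f x, g x)) (fun v => ('d f x v, 'd g x v)).
  by move=> Ux; apply: is_diff_pair; [exact/is_diffP/H1|exact/is_diffP/G1].
split=> [x /D[]//|v].
by apply: (Ck_ext Uo _ (IH _ _ (H2 v) (G2 v))) => x Ux; rewrite (is_diff_val v (D x Ux)).
Qed.

Lemma Ck_lin V W k (U : set V) (L : V -> W) :
  open U -> linear L -> continuous L -> Ck k U L.
Proof.
move=> Uo Ll Lc; case: k => [|k]; first by move=> x _; exact: Lc.
have D x : is_diff x L L by exact: is_diff_linear.
split=> [x _|v]; first by case: (D x).
by apply: (Ck_ext Uo _ (@Ck_cst _ _ k U (L v))) => x _; rewrite (is_diff_val v (D x)).
Qed.

End Differentials.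

(** * Symmetry of second derivatives *)

Section SecondOrder.
Context {R : realType}.
Implicit Types V W Z : normedModType R.

Lemma is_diff_line V (z u : V) (t : R^o) :
  is_diff t (fun s : R^o => z + s *: u) (fun s => s *: u).
Proof.
have -> : (fun s : R^o => s *: u) = (fun s => 0 + s *: u).
  by apply/funext => s; rewrite add0r.
have sl : linear (fun s : R^o => s *: u).
  by move=> a b c; rewrite scalerDl scalerA.
exact: (is_diff_add (is_diff_const z t) (is_diff_linear t sl (@scalel_continuous _ _ u))).
Qed.

Lemma MVT_line V (f : V -> R^o) (z u : V) (h : R) : 0 < h ->
  (forall t : R, 0 <= t <= h -> differentiable f (z + t *: u)) ->
  exists2 c : R, 0 < c < h & f (z + h *: u) - f z = h * 'd f (z + c *: u) u.
Proof.
move=> h0 df; pose g (t : R) : R := f (z + t *: u).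
have dg t : 0 <= t <= h -> is_diff (t : R^o) (g : R^o -> R^o)
    ('d f (z + t *: u) \o (fun s : R^o => s *: u)).
  move=> th; apply: (@is_diff_comp' _ _ _ _ (fun s : R^o => z + s *: u)).
    exact: is_diff_line.
  exact/is_diffP/df.
have [||c] := @MVT R g (fun t => 'd f (z + t *: u) u) 0 h h0.
- move=> t; rewrite in_itv/= => /andP[t0 th].
  have t01 : 0 <= t <= h by rewrite !ltW.
  have [d1 d2] := dg t t01; apply: DeriveDef; first exact: diff_derivable.
  by rewrite deriveE// d2 /= scale1r.
- apply: derivable_within_continuous => t; rewrite in_itv/= => t01.
  by have [d1 d2] := dg t t01; exact: diff_derivable.
by rewrite in_itv/= /g subr0 scale0r addr0 => c01 E; exists c => //; rewrite E mulrC.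
Qed.

(** Base point and direction both move. Differentiability is given for fixed directions only, so the
    direction is expanded in a spanning family and the product rule is applied to each term. *)
Lemma is_diff_diff V W Z (F : W -> Z) (z dz u du : V -> W) (x : V) :
  finite_span W ->
  (forall w, differentiable (fun y => 'd F y w) (z x)) ->
  is_diff x z dz -> is_diff x u du ->
  is_diff x (fun y => 'd F (z y) (u y))
    (fun v => 'd (fun y => 'd F y (u x)) (z x) (dz v) + 'd F (z x) (du v)).
Proof.
move=> [I [b [l [ll lc lb]]]] dF dzx dux.
have E y w : 'd F y w = \sum_i l i w *: 'd F y (b i).
  by rewrite {1}(lb w) linear_sum; apply: eq_bigr => i _; rewrite linearZ.
have E2 w v : 'd (fun y => 'd F y w) (z x) v =
    \sum_i l i w *: 'd (fun y => 'd F y (b i)) (z x) v.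
  have : is_diff (z x) (fun y => \sum_i l i w *: 'd F y (b i))
      (fun v => \sum_i l i w *: 'd (fun y => 'd F y (b i)) (z x) v).
    apply: is_diff_sum => i _.
    exact: (@is_diffZ _ _ _ _ _ (l i w) _ (is_diffP (dF (b i)))).
  have -> : (fun y => \sum_i l i w *: 'd F y (b i)) = (fun y => 'd F y w).
    by apply/funext => y; rewrite -E.
  exact: is_diff_val.
rewrite (_ : (fun y => _) = (fun y => \sum_i l i (u y) *: 'd F (z y) (b i))); last first.
  by apply/funext => y; rewrite -E.
have H : is_diff x (fun y => \sum_i l i (u y) *: 'd F (z y) (b i))
   (fun v => \sum_i (l i (du v) *: 'd F (z x) (b i) +
    l i (u x) *: 'd (fun y => 'd F y (b i)) (z x) (dz v))).
  apply: is_diff_sum => i _.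
  exact: (is_diff_scale (is_diff_comp' dux (is_diff_linear (u x) (ll i) (lc i)))
    (is_diff_comp' dzx (is_diffP (dF (b i))))).
apply: (is_diff_eq H); apply/funext => v.
by rewrite big_split/= -E -E2 addrC.
Qed.

(** The mean value theorem in the direction [v], applied to [psi y = f (y + h w) - f y], leaves a
    difference of two values of [g = 'd f _ v]. Both are compared with [g x], so [g] has to be
    differentiable at [x] alone. *)
Lemma second_difference V (f : V -> R^o) (x v w : V) :
  (\forall y \near x, differentiable f y) ->
  differentiable (fun y => 'd f y v) x ->
  forall e, 0 < e -> \forall h \near 0^'+,
    `|f (x + h *: v + h *: w) - f (x + h *: v) - (f (x + h *: w) - f x)
      - h ^+ 2 * 'd (fun y => 'd f y v) x w| <= e * h ^+ 2.
Proof.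
move=> /nbhs_ballP[d1 /= d10 df] dfv e e0; set g := fun y => 'd f y v.
(* [h * C] bounds every displacement [t v + s w] with [t], [s] in [[0, h]]; the summand 1 keeps [C]
   positive. The accuracy [e / (2 * C)] lets the two comparison errors add up to [e * h]. *)
pose C := 2 * `|v| + `|w| + 1.
have C0 : 0 < C by rewrite ltr_wpDl// addr_ge0// mulr_ge0.
have eC0 : 0 < e / (2 * C) by rewrite divr_gt0// mulr_gt0.
have /nbhs_ballP[d2 /= d20 dg] := diff_eps dfv eC0.
near=> h.
have h0 : 0 < h by near: h; exact: nbhs_right_gt.
have hC : h * C < Num.min d1 d2.
  rewrite -ltr_pdivlMr//; near: h; apply: nbhs_right_lt.
  by rewrite divr_gt0// lt_min d10.
have B t s : 0 <= t <= h -> 0 <= s <= h -> `|t *: v + s *: w| <= h * C.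
  move=> /andP[t0 th] /andP[s0 sh].
  rewrite (le_trans (ler_normD _ _))// !normrZ !ger0_norm//.
  have tv : t * `|v| <= h * `|v| by rewrite ler_wpM2r.
  have sw : s * `|w| <= h * `|w| by rewrite ler_wpM2r.
  have hv : 0 <= h * `|v| by rewrite mulr_ge0// ltW.
  by rewrite /C; lra.
have hh : 0 <= h <= h by rewrite lexx ltW.
have h00 : 0 <= (0 : R) <= h by rewrite lexx ltW.
have df' t s : 0 <= t <= h -> 0 <= s <= h ->
    differentiable f (x + t *: v + s *: w).
  move=> th sh; apply: df; rewrite -ball_normE/= -addrA opprD addNKr normrN.
  by rewrite (le_lt_trans (B _ _ th sh))// (lt_le_trans hC)// ge_min lexx.
pose psi y : R^o := f (y + h *: w) - f y.
have dpsi t : 0 <= t <= h -> is_diff (x + t *: v) psi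
    (fun u => 'd f (x + t *: v + h *: w) u - 'd f (x + t *: v) u).
  move=> th; apply: is_diff_sub; last first.
    apply: is_diffP; have := df' t 0 th h00.
    by rewrite scale0r addr0.
  have dsh : is_diff (x + t *: v) (fun y => y + h *: w) id.
    rewrite (_ : id = fun u => id u + 0); last by apply/funext => u; rewrite addr0.
    exact: (is_diff_add (is_diff_id _) (is_diff_const _ _)).
  exact: (is_diff_comp' dsh (is_diffP (df' _ _ th hh))).
have [|c /andP[c0 ch]] := @MVT_line _ psi x v h h0.
  by move=> t /dpsi[].
rewrite {1}/psi => ->.
have ch' : 0 <= c <= h by rewrite !ltW.
rewrite (is_diff_val _ (dpsi c ch')).
set D := 'd f _ _ - _; set Q := 'd _ x w.
suff : `|D - h * Q| <= e * h.
  rewrite (_ : h * D - _ = h * (D - h * Q)); last by ring.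
  rewrite (_ : e * h ^+ 2 = h * (e * h)); last by ring.
  by rewrite normrM gtr0_norm// ler_pM2l.
have G t s : 0 <= t <= h -> 0 <= s <= h ->
    `|g (x + t *: v + s *: w) - g x - 'd g x (t *: v + s *: w)|
      <= e / 2 * h.
  move=> th sh; have Bts := B t s th sh.
  apply: (@le_trans _ _ (e / (2 * C) * `|t *: v + s *: w|)).
    rewrite (_ : x + t *: v + s *: w = (t *: v + s *: w) + x); last first.
      by rewrite -addrA addrC.
    apply: dg.
    rewrite -ball_normE/= sub0r normrN.
    by rewrite (le_lt_trans Bts)// (lt_le_trans hC)// ge_min lexx orbT.
  apply: (le_trans (ler_wpM2l (ltW eC0) Bts)).
  by rewrite le_eqVlt; apply/orP; left; apply/eqP; field; rewrite gt_eqF.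
have := G c h ch' hh; have := G c 0 ch' h00; rewrite scale0r !addr0.
rewrite /g => G1 G2.
have EQ : h * Q = 'd g x (c *: v + h *: w) - 'd g x (c *: v).
  by rewrite -linearB addrAC subrr add0r linearZ.
have aux (a b p q r : R) : a - b - (q - r) = (a - p - q) - (b - p - r) by ring.
rewrite EQ (aux _ _ ('d f x v)).
rewrite (le_trans (ler_normB _ _))// (le_trans (lerD G2 G1))//.
by rewrite -mulrDl -splitr.
Unshelve. all: by end_near. Qed.

(** The second difference over the parallelogram spanned by [h v] and [h w] is symmetric in [v] and
    [w]; divided by [h ^+ 2], it tends to either side. *)
Lemma diff_sym V (f : V -> R^o) (x v w : V) :
  (\forall y \near x, differentiable f y) ->
  differentiable (fun y => 'd f y v) x ->
  differentiable (fun y => 'd f y w) x ->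
  'd (fun y => 'd f y v) x w = 'd (fun y => 'd f y w) x v.
Proof.
move=> df dv dw; apply/eqP; rewrite -subr_eq0 -normr_le0.
apply/ler_addgt0Pr => e e0; rewrite add0r.
have e20 : 0 < e / 2 by rewrite divr_gt0.
near (0 : R)^'+ => h.
have h0 : 0 < h by near: h; exact: nbhs_right_gt.
have h20 : 0 < h ^+ 2 by rewrite exprn_gt0.
have : `|f (x + h *: v + h *: w) - f (x + h *: v) - (f (x + h *: w) - f x)
      - h ^+ 2 * 'd (fun y => 'd f y v) x w| <= e / 2 * h ^+ 2.
  by near: h; exact: second_difference.
have : `|f (x + h *: w + h *: v) - f (x + h *: w) - (f (x + h *: v) - f x)
      - h ^+ 2 * 'd (fun y => 'd f y w) x v| <= e / 2 * h ^+ 2.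
  by near: h; exact: second_difference.
rewrite (_ : x + h *: w + h *: v = x + h *: v + h *: w); last by rewrite addrAC.
set A := f _; set B := f _; set C := f _; set D := f _.
move: ('d _ x v : R) ('d _ x w : R) A B C D => P Q A B C D H1 H2.
rewrite -(ler_pM2r h20) -[X in _ * X](gtr0_norm h20) -normrM.
rewrite (_ : _ * _ = (A - B - (C - D) - h ^+ 2 * P) - (A - C - (B - D) - h ^+ 2 * Q)).
  by rewrite (le_trans (ler_normB _ _))// (le_trans (lerD H1 H2))// -mulrDl -splitr.
by ring.
Unshelve. all: by end_near. Qed.

Lemma diff_sym_span V W (f : V -> W) (x v w : V) :
  finite_span W ->
  (\forall y \near x, differentiable f y) ->
  differentiable (fun y => 'd f y v) x ->
  differentiable (fun y => 'd f y w) x ->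
  'd (fun y => 'd f y v) x w = 'd (fun y => 'd f y w) x v.
Proof.
move=> [I [b [l [ll lc lb]]]] df dv dw.
rewrite [LHS]lb [RHS]lb; apply: eq_bigr => i _; congr (_ *: _).
have lin y := is_diff_linear y (ll i) (lc i).
have N u : \forall y \near x, l i ('d f y u) = 'd (l i \o f) y u.
  apply: filterS df => y dy.
  by rewrite (is_diff_val u (is_diff_comp' (is_diffP dy) (lin (f y)))).
have D u : differentiable (fun y => 'd f y u) x ->
    is_diff x (fun y => 'd (l i \o f) y u) (l i \o 'd (fun y => 'd f y u) x).
  move=> du; apply: near_is_diff (is_diff_comp' (is_diffP du) (lin _)).
  exact: N.
have -> : l i ('d (fun y => 'd f y v) x w) = 'd (fun y => 'd (l i \o f) y v) x w.
  by rewrite (is_diff_val w (D v dv)).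
have -> : l i ('d (fun y => 'd f y w) x v) = 'd (fun y => 'd (l i \o f) y w) x v.
  by rewrite (is_diff_val v (D w dw)).
apply: diff_sym; [|by case: (D v dv)|by case: (D w dw)].
by apply: filterS df => y dy; case: (is_diff_comp' (is_diffP dy) (lin (f y))).
Qed.

End SecondOrder.

(** * Calculus of multilinear maps with moving arguments *)

Section Multilinear.
Context {R : realType}.

Definition multilinear (n r : nat) (T : ('I_r -> 'rV[R]_n) -> R) : Prop :=
  forall v i a u u', T (upd v i (a *: u + u')) = a * T (upd v i u) + T (upd v i u').

Section Upd.
Context {n r : nat}.
Implicit Types (v : 'I_r -> 'rV[R]_n) (T : ('I_r -> 'rV[R]_n) -> R).

Lemma upd_id v i : upd v i (v i) = v.
Proof. by apply/funext => j; rewrite /upd; case: eqVneq => [->|]. Qed.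

Lemma upd_upd v i u u' : upd (upd v i u) i u' = upd v i u'.
Proof. by apply/funext => j; rewrite /upd; case: eqVneq. Qed.

Lemma updC v i j u u' : i != j ->
  upd (upd v i u) j u' = upd (upd v j u') i u.
Proof.
move=> ij; apply/funext => k; rewrite /upd; case: eqVneq => [->|//].
by rewrite eq_sym (negbTE ij).
Qed.

Lemma multilinear0 T v i : multilinear T -> T (upd v i 0) = 0.
Proof.
move=> Tm; have := Tm v i (-1) 0 0; rewrite scaler0 addr0 mulN1r addNr.
by [].
Qed.

Lemma multilinearD T v i u u' : multilinear T ->
  T (upd v i (u + u')) = T (upd v i u) + T (upd v i u').
Proof. by move=> Tm; rewrite -[u]scale1r Tm mul1r scale1r. Qed.

Lemma multilinearZ T v i a u : multilinear T ->
  T (upd v i (a *: u)) = a * T (upd v i u).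
Proof. by move=> Tm; rewrite -[a *: u]addr0 Tm multilinear0// addr0. Qed.

Lemma multilinear_sum T v i (I : Type) (s : seq I) (P : pred I) (u : I -> 'rV[R]_n) :
  multilinear T ->
  T (upd v i (\sum_(l <- s | P l) u l)) = \sum_(l <- s | P l) T (upd v i (u l)).
Proof.
move=> Tm; elim: s => [|l s IH]; first by rewrite !big_nil multilinear0.
by rewrite !big_cons; case: ifP => // _; rewrite multilinearD// IH.
Qed.

Lemma multilinear_delta T v i u : multilinear T ->
  T (upd v i u) = \sum_l u 0 l * T (upd v i (delta_mx 0 l)).
Proof.
move=> Tm; rewrite {1}[u]row_sum_delta multilinear_sum//.
by apply: eq_bigr => l _; rewrite multilinearZ.
Qed.

End Upd.

Section Mix.
Context {V : normedModType R} {n r : nat}.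
Variables (T : V -> ('I_r -> 'rV[R]_n) -> R) (w : 'I_r -> V -> 'rV[R]_n).
Hypothesis Tm : forall y, multilinear (T y).

(** The slots below [k] hold the moving vectors, the others the fixed ones of [z]. Induction on [k]
    sets one more slot in motion at a time and expands its vector in the standard basis, since [T]
    is controlled only at fixed arguments. *)
Let mix k (z : 'I_r -> 'rV[R]_n) (y : V) : 'I_r -> 'rV[R]_n :=
  fun j => if (j < k)%N then w j y else z j.

Let mixr z y : mix r z y = w^~ y.
Proof. by apply/funext => j; rewrite /mix ltn_ord. Qed.

Let mixS k (kr : (k < r)%N) z y (i := Ordinal kr) :
  mix k.+1 z y = upd (mix k z y) i (w i y).
Proof.
apply/funext => j; rewrite /mix /upd -val_eqE /= ltnS leq_eqVlt.
by case: eqVneq => //= E; congr (w _ y); apply: val_inj.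
Qed.

Let mix_upd k (kr : (k < r)%N) z y u (i := Ordinal kr) :
  upd (mix k z y) i u = mix k (upd z i u) y.
Proof.
apply/funext => j; rewrite /mix /upd -val_eqE /=.
by case: eqVneq => [->|//]; rewrite ltnn.
Qed.

Let T_mixS k (kr : (k < r)%N) z y (i := Ordinal kr) :
  T y (mix k.+1 z y) = \sum_l w i y 0 l * T y (mix k (upd z i (delta_mx 0 l)) y).
Proof.
rewrite (mixS kr) multilinear_delta//; apply: eq_bigr => l _.
by rewrite (mix_upd kr).
Qed.

Lemma Ck_multilinear d (U : set V) : open U ->
  (forall j, Ck d U (w j)) -> (forall u, Ck d U (fun y => T y u : R^o)) ->
  Ck d U (fun y => T y (w^~ y) : R^o).
Proof.
move=> Uo Hw HT.
suff H k z : (k <= r)%N -> Ck d U (fun y => T y (mix k z y) : R^o).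
  by have := H r (fun=> 0) (leqnn r); under eq_fun do rewrite mixr.
elim: k z => [|k IH] z kr; first exact: (HT z).
rewrite (_ : (fun y => _) = fun y => \sum_l
  (w (Ordinal kr) y 0 l : R^o) *: (T y (mix k (upd z (Ordinal kr) (delta_mx 0 l)) y) : R^o)).
  apply: (Ck_sum _ Uo) => l _; apply: (Ck_scale Uo); last exact: IH (ltnW kr).
  apply: (@Ck_linear _ _ _ R^o _ _ (fun u : 'rV[R]_n => u 0 l)) (Hw _) => //.
    by move=> a u v; rewrite !mxE.
  exact: coord_continuous.
by apply/funext => y; rewrite (T_mixS kr).
Qed.

Variables (x : V) (dw : 'I_r -> V -> 'rV[R]_n).
Hypothesis Hw : forall j, is_diff x (w j) (dw j).
Hypothesis HT : forall u, differentiable (fun y => T y u : R^o) x.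

Lemma multilinear_diff v : multilinear (fun u => 'd (fun y => T y u : R^o) x v).
Proof.
move=> m i a u u'.
have -> : (fun y => T y (upd m i (a *: u + u')) : R^o) =
    (fun y => a *: (T y (upd m i u) : R^o) + (T y (upd m i u') : R^o)).
  by apply/funext => y; rewrite Tm.
have H := is_diff_add (@is_diffZ _ _ _ _ _ a x (is_diffP (HT (upd m i u))))
  (is_diffP (HT (upd m i u'))).
by rewrite (is_diff_val v H).
Qed.

Lemma is_diff_multilinear :
  is_diff x (fun y => T y (w^~ y) : R^o)
    (fun v => 'd (fun y => T y (w^~ x) : R^o) x v +
              \sum_j T x (upd (w^~ x) j (dw j v))).
Proof.
suff H k z : (k <= r)%N -> is_diff x (fun y => T y (mix k z y) : R^o)
    (fun v => 'd (fun y => T y (mix k z x) : R^o) x v +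
              \sum_(j : 'I_r | (j < k)%N) T x (upd (mix k z x) j (dw j v))).
  have := H r (fun=> 0) (leqnn r); rewrite mixr.
  rewrite (_ : (fun y => T y (mix r (fun=> 0) y) : R^o) = (fun y => T y (w^~ y))).
    by congr is_diff_def; apply/funext => v; congr (_ + _);
       apply: eq_bigl => j; rewrite ltn_ord.
  by apply/funext => y; rewrite mixr.
elim: k z => [|k IH] z kr.
  have := is_diffP (HT z); congr is_diff_def; apply/funext => v.
  by rewrite big_pred0_eq addr0.
pose i := Ordinal kr.
rewrite (_ : (fun y => T y _ : R^o) = fun y => \sum_l
  (w i y 0 l : R^o) *: (T y (mix k (upd z i (delta_mx 0 l)) y) : R^o)); last first.
  by apply/funext => y; rewrite (T_mixS kr).
have cl l : is_diff x (fun y => w i y 0 l : R^o) (fun v => dw i v 0 l).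
  have L : linear (fun u : 'rV[R]_n => u 0 l : R^o) by move=> a u v; rewrite !mxE.
  exact: (is_diff_comp' (Hw i) (is_diff_linear (w i x) L (@coord_continuous _ _ _ _ _))).
have H := @is_diff_sum _ _ _ _ (index_enum 'I_n) xpredT _ _ x
  (fun l _ => is_diff_scale (cl l) (IH (upd z i (delta_mx 0 l)) (ltnW kr))).
apply: (is_diff_eq H); apply/funext => v; rewrite big_split/=.
rewrite (bigD1 i)//= addrCA; congr (_ + _).
  rewrite (mixS kr) upd_upd (multilinear_delta _ _ (dw i v))//.
  by apply: eq_bigr => l _; rewrite -(mix_upd kr).
under eq_bigr do rewrite scalerDr scaler_sumr -(mix_upd kr).
rewrite big_split/= (mixS kr); congr (_ + _).
  by rewrite (multilinear_delta _ _ (w i x) (multilinear_diff v)).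
rewrite exchange_big/= [RHS](eq_bigl (fun j : 'I_r => (j < k)%N)); last first.
  by move=> j; rewrite [RHS]ltn_neqAle andbC.
apply: eq_bigr => j jk; rewrite updC; last by rewrite -val_eqE/= gtn_eqF.
rewrite (multilinear_delta _ _ (w i x))//; apply: eq_bigr => l _.
by rewrite updC// -val_eqE/= gtn_eqF.
Qed.

End Mix.

Lemma diff0_const (V : normedModType R) (f : V -> R^o) (x y : V) (e : R) :
  (forall z, ball x e z -> differentiable f z /\ 'd f z =1 fun=> 0) ->
  ball x e y -> f y = f x.
Proof.
move=> H; rewrite -ball_normE/= => xy.
have B (t : R) : 0 <= t <= 1 -> ball x e (x + t *: (y - x)).
  move=> /andP[t0 t1]; rewrite -ball_normE/= opprD addNKr normrN normrZ ger0_norm//.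
  by rewrite (le_lt_trans _ xy)// distrC ler_piMl.
have [t /B/H[]//|c /andP[c0 c1]] := @MVT_line _ _ f x (y - x) 1 ltr01.
have /B/H[_ ->] : 0 <= c <= 1 by rewrite !ltW.
by rewrite mulr0 scale1r subrKC => /eqP; rewrite subr_eq0 => /eqP.
Qed.

End Multilinear.

(** * Ordinary differential equations *)

Section ODE.
Context {R : realType}.

Lemma is_diff_coord (V : normedModType R) n (f df : V -> 'rV[R]_n) (x : V) (i : 'I_n) :
  is_diff x f df -> is_diff x (fun y => f y 0 i : R^o) (fun v => df v 0 i).
Proof.
move=> H.
have L : linear (fun u : 'rV[R]_n => u 0 i : R^o) by move=> a u v; rewrite !mxE.
exact: (is_diff_comp' H (is_diff_linear (f x) L (@coord_continuous _ _ _ _ _))).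
Qed.

Lemma rV_norm_le n (u : 'rV[R]_n) (C : R) :
  0 <= C -> (forall i, `|u 0 i| <= C) -> `|u| <= C.
Proof.
move=> C0 H; rewrite [leLHS]/Num.Def.normr/= mx_normrE.
by apply: bigmax_le => // -[i j] _ /=; rewrite ord1.
Qed.

Lemma rV_coord_le n (u : 'rV[R]_n) i : `|u 0 i| <= `|u|.
Proof.
rewrite [leRHS]/Num.Def.normr/= mx_normrE.
exact: (@le_bigmax _ _ _ 0 (fun j : 'I_1 * 'I_n => `|u j.1 j.2|) (0, i)).
Qed.

Lemma MVT_diff (g dg : R -> R) (s t : R) : s < t ->
  (forall x, s <= x <= t -> is_diff (x : R^o) (g : R^o -> R^o) (fun y : R^o => y * dg x)) ->
  exists2 c, s <= c <= t & g t - g s = dg c * (t - s).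
Proof.
move=> st H; have [||c] := @MVT R g dg s t st.
- move=> x; rewrite in_itv/= => /andP[sx xt].
  have [|d1 d2] := H x; first by rewrite !ltW.
  apply: DeriveDef; first exact: diff_derivable.
  by rewrite deriveE// d2 mul1r.
- apply: derivable_within_continuous => x; rewrite in_itv/= => sxt.
  by have [d1 d2] := H x sxt; exact: diff_derivable.
by rewrite in_itv/= => /andP[sc ct] E; exists c => //; rewrite !ltW.
Qed.

(** The norm of a row is the largest modulus of its coordinates, so the scalar mean value theorem
    for each coordinate, with its own intermediate point, gives the bound without loss. *)
Lemma curve_lipschitz n (f df : R -> 'rV[R]_n) (B s t : R) : 0 <= B ->
  (forall x : R, Num.min s t <= x <= Num.max s t ->
     is_diff (x : R^o) (f : R^o -> _) (fun y : R^o => y *: df x) /\ `|df x| <= B) ->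
  `|f t - f s| <= B * `|t - s|.
Proof.
move=> B0; wlog st : s t / s <= t => [W H|].
  have [/W|/ltW/W] := leP s t; first exact.
  by rewrite minC maxC distrC [X in _ * X]distrC; exact.
rewrite min_l// max_r// => H; move: st; rewrite le_eqVlt => /predU1P[<-|st].
  by rewrite !subrr normr0 mulr_ge0.
apply: rV_norm_le => [|i]; first by rewrite mulr_ge0.
have [x /H[D _]|c /H[_ dB] E] := @MVT_diff (fun x => f x 0 i) (fun x => df x 0 i) s t st.
  by apply: (is_diff_eq (is_diff_coord i D)); apply/funext => y; rewrite mxE.
rewrite mxE [X in _ + X]mxE E normrM ler_wpM2r//.
exact: le_trans (rV_coord_le _ _) dB.
Qed.

(** The integral is taken from -1 and normalised at 0, so that 0 is an interior point. The interval
    []-1, 1[] is enough: Picard iteration runs on [[-eps, eps]] with [eps < 1]. *)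
Lemma primitive (f : R -> R) : continuous f -> exists F : R -> R, F 0 = 0 /\
  forall t, -1 < t < 1 -> is_diff (t : R^o) (F : R^o -> R^o) (fun y : R^o => y * f t).
Proof.
move=> fc; pose G (x : R) : R := (\int[lebesgue_measure]_(t in `[-1, x]) f t)%R.
have D (t : R) : -1 < t < 1 -> derivable (G : R^o -> R^o) t 1 /\ derive1 G t = f t.
  move=> /andP[t0 t1].
  apply: (@continuous_FTC1_closed _ f (-1) t 1) => //; last exact: fc.
  apply: continuous_compact_integrable; first exact: segment_compact.
  exact: continuous_subspaceT.
exists (fun t => G t - G 0); split => [|t /D[d1 d2]]; first by rewrite subrr.
have dG : is_diff (t : R^o) (G : R^o -> R^o) (fun y : R^o => y * f t).
  apply: DiffDef; first exact/derivable1_diffP.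
  by rewrite (deriv1E d1) d2.
apply: (is_diff_eq (is_diff_sub dG (is_diff_const (G 0 : R^o) (t : R^o)))).
by apply/funext => y; rewrite subr0.
Qed.

Lemma primitive_rV n (f : R -> 'rV[R]_n) : continuous f ->
  exists F : R -> 'rV[R]_n, F 0 = 0 /\
  forall t, -1 < t < 1 ->
    is_diff (t : R^o) (F : R^o -> 'rV[R]_n) (fun y : R^o => y *: f t).
Proof.
move=> fc.
have fci i : continuous (fun t => f t 0 i).
  by move=> t; apply: (@continuous_comp _ _ _ f (fun u : 'rV[R]_n => u 0 i));
    [exact: fc|exact: coord_continuous].
pose F i := sval (cid (primitive (fci i))).
have F0 i : F i 0 = 0 by exact: (svalP (cid (primitive (fci i)))).1.
have dF i t : -1 < t < 1 ->
    is_diff (t : R^o) (F i : R^o -> R^o) (fun y : R^o => y * f t 0 i).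
  exact: (svalP (cid (primitive (fci i)))).2.
exists (fun t => \sum_i F i t *: delta_mx 0 i); split.
  by rewrite big1// => i _; rewrite F0 scale0r.
move=> t t01.
have H := @is_diff_sum _ _ _ _ (index_enum 'I_n) xpredT _ _ (t : R^o)
  (fun i _ => is_diff_scale (dF i t t01)
     (is_diff_const (delta_mx 0 i : 'rV[R]_n) (t : R^o))).
apply: (is_diff_eq H); apply/funext => y.
rewrite [in RHS](row_sum_delta (f t)) scaler_sumr; apply: eq_bigr => i _.
by rewrite scaler0 addr0 scalerA.
Qed.

(** With [d k = 2 C / 2^k] the intervals [[x k - d k, x k + d k]] are nested, as
    [d k - d (k + 1) = C / 2^k]; the supremum of their left ends lies in all of them. The explicit
    rate serves later to compare iterates with their limit. *)
Lemma geometric_limit (x : nat -> R) (C : R) : 0 <= C ->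
  (forall k, `|x k.+1 - x k| <= C / 2 ^+ k) ->
  exists l, forall k, `|x k - l| <= 2 * C / 2 ^+ k.
Proof.
move=> C0 H; pose d k := 2 * C / 2 ^+ k.
have dS k : d k.+1 = d k - C / 2 ^+ k.
  by rewrite /d exprS; field; rewrite expf_neq0//.
have d0 k : 0 <= d k by rewrite /d !mulr_ge0// invr_ge0 exprn_ge0.
have lo j k : (j <= k)%N -> x j - d j <= x k - d k.
  move=> /subnK <-; elim: (k - j)%N => [|i IH]; first by rewrite add0n.
  rewrite addSn (le_trans IH)// dS.
  by have := H (i + j)%N; rewrite ler_norml => /andP[+ _]; lra.
have hi j k : (j <= k)%N -> x k + d k <= x j + d j.
  move=> /subnK <-; elim: (k - j)%N => [|i IH]; first by rewrite add0n.
  rewrite addSn (le_trans _ IH)// dS.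
  by have := H (i + j)%N; rewrite ler_norml => /andP[_]; lra.
have lh j k : x j - d j <= x k + d k.
  have := lo j (maxn j k) (leq_maxl _ _); have := hi k (maxn j k) (leq_maxr _ _).
  by have := d0 (maxn j k); lra.
pose E := [set y | exists j, y = x j - d j].
have Eu k : ubound E (x k + d k) by move=> _ [j ->].
have hE : has_sup E.
  by split; [exists (x 0 - d 0%N), 0%N|exists (x 0 + d 0%N)].
exists (sup E) => k; rewrite ler_norml; apply/andP; split.
  rewrite -/(d k); have : sup E <= x k + d k by apply: ge_sup => //; case: hE.
  by lra.
rewrite -/(d k); have : x k - d k <= sup E by apply: ub_le_sup; [case: hE|exists k].
by lra.
Qed.

Lemma geometric_limit_rV n (x : nat -> 'rV[R]_n) (C : R) : 0 <= C ->
  (forall k, `|x k.+1 - x k| <= C / 2 ^+ k) ->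
  exists l, forall k, `|x k - l| <= 2 * C / 2 ^+ k.
Proof.
move=> C0 H.
have Hi i : exists l, forall k, `|x k 0 i - l| <= 2 * C / 2 ^+ k.
  apply: geometric_limit => // k; apply: le_trans (H k).
  by apply: le_trans (rV_coord_le _ i); rewrite !mxE.
exists (\row_i sval (cid (Hi i))) => k; apply: rV_norm_le.
  by rewrite !mulr_ge0// invr_ge0 exprn_ge0.
by move=> i; rewrite !mxE; case: cid.
Qed.

End ODE.

(** * Lipschitz bounds and Picard iteration *)

Section Lipschitz.
Context {R : realType}.

Definition lipschitz_ball (m n : nat) (F : 'rV[R]_m -> 'rV[R]_n) e (rho K : R) :=
  forall y z, ball e rho y -> ball e rho z -> `|F y - F z| <= K * `|y - z|.

Lemma ball_segment (V : normedModType R) (e y z : V) (rho t : R) :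
  ball e rho y -> ball e rho z -> 0 <= t <= 1 -> ball e rho (z + t *: (y - z)).
Proof.
rewrite -ball_normE/= => ey ez /andP[t0 t1].
have -> : e - (z + t *: (y - z)) = (1 - t) *: (e - z) + t *: (e - y).
  rewrite scalerBl scale1r -[e - y](subrKA z) [_ *: (_ + (z - y))]scalerDr [in RHS]addrA subrK.
  by rewrite opprD addrA -scalerN opprB.
rewrite (le_lt_trans (ler_normD _ _))// !normrZ ger0_norm ?subr_ge0// ger0_norm//.
have [t00|tn0] := eqVneq t 0; first by rewrite t00 subr0 mul0r mul1r addr0.
have t00 : 0 < t by rewrite lt_neqAle eq_sym tn0.
apply: (@lt_le_trans _ _ ((1 - t) * rho + t * rho)); last by rewrite -mulrDl subrK mul1r.
by rewrite ler_ltD// ?ltr_pM2l// ler_wpM2l ?subr_ge0// ltW.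
Qed.

(** The derivatives along basis vectors are continuous, hence bounded near [e] by the norm of their
    value there plus 1. The sum of these bounds dominates the whole differential, and the mean value
    theorem on segments of the ball does the rest. *)
Lemma Ck_lipschitz m n (U : set 'rV[R]_m) (F : 'rV[R]_m -> 'rV[R]_n) e :
  open U -> U e -> Ck 1 U F ->
  exists rho K : R, [/\ 0 < rho, 0 <= K, ball e rho `<=` U & lipschitz_ball F e rho K].
Proof.
move=> Uo Ue [dF cF].
have N l : \forall y \near e, `|'d F y (delta_mx 0 l)| <= `|'d F e (delta_mx 0 l)| + 1.
  have := cF (delta_mx 0 l) e Ue => /cvgr_norm_le; apply.
  by rewrite ltrDl.
have N' : \forall y \near e, U y /\
    forall l, `|'d F y (delta_mx 0 l)| <= `|'d F e (delta_mx 0 l)| + 1.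
  have NU : nbhs e U by exact: open_nbhs_nbhs.
  have NF : \forall y \near e, forall l,
      `|'d F y (delta_mx 0 l)| <= `|'d F e (delta_mx 0 l)| + 1.
    exact: (@filter_forall _ 'I_m (fun l y =>
      `|'d F y (delta_mx 0 l)| <= `|'d F e (delta_mx 0 l)| + 1) _ _ N).
  by apply: (@filterS2 _ (nbhs e) _ _ _ _ _ NU NF) => y.
have /nbhs_ballP[rho /= rho0 H] := N'.
exists rho, (\sum_l (`|'d F e (delta_mx 0 l)| + 1)); split => //.
- by apply: sumr_ge0 => l _; rewrite addr_ge0.
- by move=> y /H[].
have D y v : ball e rho y ->
    `|'d F y v| <= (\sum_l (`|'d F e (delta_mx 0 l)| + 1)) * `|v|.
  move=> /H[_ Hy].
  have E : 'd F y v = \sum_l v 0 l *: 'd F y (delta_mx 0 l).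
    by rewrite {1}[v]row_sum_delta linear_sum; apply: eq_bigr => l _; rewrite linearZ.
  rewrite [X in `|X| <= _]E; apply: (le_trans (ler_norm_sum _ _ _)).
  rewrite mulr_suml.
  apply: ler_sum => l _.
  rewrite normrZ mulrC.
  apply: ler_pM; [exact: normr_ge0|exact: normr_ge0|exact: Hy|exact: rV_coord_le].
move=> y z ey ez; apply: rV_norm_le => [|i].
  by rewrite mulr_ge0// sumr_ge0// => l _; rewrite addr_ge0.
have B t : 0 <= t <= 1 -> ball e rho (z + t *: (y - z)) by exact: ball_segment.
have dFi t (t01 : 0 <= t <= 1) := is_diff_coord i (is_diffP (dF _ (H _ (B t t01)).1)).
have [t t01|c /andP[c0 c1]] := @MVT_line _ _ (fun x => F x 0 i : R^o) z (y - z) 1 ltr01.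
  by case: (dFi t t01).
have c01 : 0 <= c <= 1 by rewrite !ltW.
rewrite (is_diff_val _ (dFi c c01)) scale1r mul1r subrKC => E.
rewrite mxE [X in _ + X]mxE E.
exact: le_trans (rV_coord_le _ _) (D _ _ (B c c01)).
Qed.

End Lipschitz.

Lemma geometric_small (R : realType) (C eps : R) : 0 < eps ->
  exists k : nat, C / 2 ^+ k <= eps.
Proof.
move=> eps0; exists (Num.bound `|C / eps|); set k := Num.bound _.
have k2 : (k%:R : R) <= 2 ^+ k by rewrite -natrX ler_nat ltnW// ltn_expl.
have : C / eps < 2 ^+ k.
  apply: lt_le_trans k2; apply: le_lt_trans (ler_norm _) _.
  exact: archi_boundP.
by rewrite ltr_pdivrMr// => /ltW H; rewrite ler_pdivrMr ?exprn_gt0// [X in _ <= X]mulrC.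
Qed.

Section Picard.
Context {R : realType} {m : nat}.
Variables (F : 'rV[R]_m -> 'rV[R]_m) (e : 'rV[R]_m) (rho K : R).
Hypotheses (rho0 : 0 < rho) (K0 : 0 <= K) (FK : lipschitz_ball F e rho K).

(** The two solutions are at most [2 * rho] apart. Whenever they are at most [D] apart, their
    velocities differ by at most [K * D], hence they themselves by at most [K * d * D <= D / 2];
    iterating forces equality. *)
Lemma ode_unique (d : R) (p q : R -> 'rV[R]_m) : K * d <= 1 / 2 ->
  (forall t, `|t| < d -> ball e rho (p t) /\ ball e rho (q t)) ->
  (forall t, `|t| < d -> is_diff (t : R^o) (p : R^o -> _) (fun y : R^o => y *: F (p t))) ->
  (forall t, `|t| < d -> is_diff (t : R^o) (q : R^o -> _) (fun y : R^o => y *: F (q t))) ->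
  p 0 = q 0 -> forall t, `|t| < d -> p t = q t.
Proof.
move=> Kd Hpq dp dq pq0.
have bnd k t : `|t| < d -> `|p t - q t| <= 2 * rho / 2 ^+ k.
  elim: k t => [|k IH] t td.
    have [] := Hpq t td; rewrite -!ball_normE/= => /ltW H1 /ltW H2.
    rewrite divr1 -(subrKA e) (le_trans (ler_normD _ _))// distrC.
    by rewrite mulr2n mulrDl mul1r lerD.
  have H := @curve_lipschitz _ _ (fun t => p t - q t) (fun t => F (p t) - F (q t))
    (K * (2 * rho / 2 ^+ k)) 0 t.
  rewrite pq0 subrr !subr0 in H.
  apply: (le_trans (H _ _)).
  - by rewrite !mulr_ge0// ?ltW// invr_ge0 exprn_ge0.
  - move=> s s01.
    have sd : `|s| < d.
      apply: le_lt_trans td; move: s01; case: (leP 0 t) => [t0|/ltW t0] /andP[s0 st].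
        by rewrite (ger0_norm s0) ger0_norm.
      by rewrite (ler0_norm t0) ler0_norm// lerN2.
    split.
      apply: (is_diff_eq (is_diff_sub (dp s sd) (dq s sd))).
      by apply/funext => y; rewrite scalerBr.
    have [Hp Hq] := Hpq s sd.
    by apply: (le_trans (FK Hp Hq)); rewrite ler_wpM2l// IH.
  - have d0 : 0 <= 2 * rho / 2 ^+ k.
      by rewrite !mulr_ge0// ?ltW// invr_ge0 exprn_ge0.
    have -> : 2 * rho / 2 ^+ k.+1 = 1 / 2 * (2 * rho / 2 ^+ k).
      by rewrite exprS; field; rewrite expf_neq0//.
    rewrite mulrAC ler_wpM2r// (le_trans _ Kd)// ler_wpM2l// ltW//.
move=> t td; apply/eqP; rewrite -subr_eq0 -normr_le0.
apply/ler_addgt0Pr => eps eps0; rewrite add0r.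
have [k Hk] := geometric_small (2 * rho) eps0.
exact: le_trans (bnd k t td) Hk.
Qed.


Lemma lipschitz_ball_bound y : ball e rho y -> `|F y| <= `|F e| + K * rho.
Proof.
move=> ey; have ee : ball e rho e by exact: ballxx.
rewrite -[F y](subrK (F e)) addrC (le_trans (ler_normD _ _))// lerD2l.
apply: (le_trans (FK ey ee)); rewrite ler_wpM2l//.
by move: ey; rewrite -ball_normE/= distrC => /ltW.
Qed.

Section Iteration.
Variable eps : R.
Hypotheses (eps0 : 0 < eps) (eps1 : eps < 1) (epsB : (`|F e| + K * rho) * eps <= rho / 2)
  (epsK : K * eps <= 1 / 2).

(** Clamping the time to [[-eps, eps]] keeps the iterates defined and continuous on the whole line.
    Of the conditions on [eps], [epsB] keeps the iterates within [rho / 2] of [e], and [epsK] makes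
    each step halve distances. *)
Let clamp (s : R) : R := Num.max (- eps) (Num.min eps s).

Let clamp_le s : `|clamp s| <= eps.
Proof.
rewrite /clamp ler_norml; apply/andP; split; first by rewrite le_max lexx.
by rewrite ge_max ge_min lexx/= andbT; have := eps0; lra.
Qed.

Let clamp_id s : `|s| <= eps -> clamp s = s.
Proof.
by rewrite ler_norml /clamp => /andP[s0 s1]; rewrite min_r// max_r.
Qed.

Let clamp_lip s t : `|clamp s - clamp t| <= `|s - t|.
Proof.
wlog st : s t / s <= t => [W|].
  by have [/W//|/ltW/W] := leP s t; rewrite distrC [X in _ <= X]distrC.
have e0 := eps0; rewrite distrC [X in _ <= X]distrC ler_norml ger0_norm ?subr_ge0//.
rewrite /clamp; case: (leP eps s) => ?; case: (leP eps t) => ?;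
  do 2?[case: (leP (- eps) _) => ?]; apply/andP; split; lra.
Qed.

Let X (u : R -> 'rV[R]_m) := continuous u /\ forall t, `|u t - e| <= rho / 2.

(** One Picard step: [u' t] is [e] plus the integral of [F \o u] from 0 to the clamped time. It is a
    relation because the primitive [H] comes from an existence statement. *)
Let step (u u' : R -> 'rV[R]_m) := exists H : R -> 'rV[R]_m, [/\ H 0 = 0,
  (forall t, -1 < t < 1 ->
    is_diff (t : R^o) (H : R^o -> 'rV[R]_m) (fun y : R^o => y *: F (u t))) &
  forall t, u' t = e + H (clamp t)].

Let Xball u t : X u -> ball e rho (u t).
Proof.
move=> [_ /(_ t) H]; rewrite -ball_normE/= distrC (le_lt_trans H)//.
by rewrite ltr_pdivrMr// ltr_pMr// ltr1n.
Qed.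

Let lip_continuous (C : R) (f : R -> 'rV[R]_m) :
  (forall s t, `|f s - f t| <= C * `|s - t|) -> continuous f.
Proof.
move=> H t; apply/cvgrPdist_lt => d d0.
have C1 : 0 < `|C| + 1 by rewrite ltr_wpDl.
apply/nbhs_ballP; exists (d / (`|C| + 1)); first by rewrite /= divr_gt0.
move=> s; rewrite /ball/= ltr_pdivlMr// => st.
apply: (le_lt_trans (H _ _)); apply: le_lt_trans st.
rewrite mulrC ler_wpM2l// (le_trans (ler_norm C))// lerDl//.
Qed.

Let F_continuous u : X u -> continuous (fun t => F (u t)).
Proof.
move=> Xu t; apply/cvgrPdist_lt => d d0.
have K1 : 0 < K + 1 by rewrite ltr_wpDl.
have dK : 0 < d / (K + 1) by rewrite divr_gt0.
have := Xu.1 t => /cvgrPdist_lt /(_ _ dK); apply: filterS => s.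
rewrite ltr_pdivlMr// => st; have Bt := Xball t Xu; have Bs := Xball s Xu.
apply: (le_lt_trans (FK Bt Bs)); apply: le_lt_trans st.
by rewrite mulrC ler_wpM2l// lerDl.
Qed.

Let eps_unit s : `|s| <= eps -> -1 < s < 1.
Proof. by rewrite ler_norml => /andP[s0 s1]; have e1 := eps1; apply/andP; split; lra. Qed.

Let between s t x : `|s| <= eps -> `|t| <= eps ->
  Num.min s t <= x <= Num.max s t -> `|x| <= eps.
Proof.
rewrite !ler_norml => /andP[s0 s1] /andP[t0 t1] /andP[]; rewrite ge_min le_max.
by move=> /orP[] ? /orP[] ?; apply/andP; split; lra.
Qed.

Let step_ex u : X u -> exists2 u', X u' & step u u'.
Proof.
move=> Xu; have [H [H0 dH]] := primitive_rV (F_continuous Xu).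
have B0 : 0 <= `|F e| + K * rho by rewrite addr_ge0// mulr_ge0// ltW.
have lipH s t : `|s| <= eps -> `|t| <= eps ->
    `|H t - H s| <= (`|F e| + K * rho) * `|t - s|.
  move=> se te; apply: (curve_lipschitz (df := fun t => F (u t))) => // x xst.
  have xe := between se te xst.
  split; [exact/dH/eps_unit|exact/lipschitz_ball_bound/Xball].
exists (fun t => e + H (clamp t)); last by exists H.
split=> [|t].
  apply: (@lip_continuous (`|F e| + K * rho)) => s t.
  rewrite opprD addrACA subrr add0r.
  by apply: le_trans (lipH _ _ _ _) _ => //; rewrite ler_wpM2l.
rewrite addrAC subrr add0r -[H _]subr0 -H0.
have e0 : `|0 : R| <= eps by rewrite normr0 ltW.
apply: le_trans (lipH _ _ e0 (clamp_le t)) _.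
by rewrite subr0; apply: le_trans epsB; rewrite ler_wpM2l.
Qed.

Let step_contract u u' v v' d : 0 <= d -> X u -> X v -> step u u' -> step v v' ->
  (forall t, `|u t - v t| <= d) -> forall t, `|u' t - v' t| <= d / 2.
Proof.
move=> d0 Xu Xv [H [H0 dH Hu]] [G [G0 dG Gv]] uv t.
rewrite Hu Gv opprD addrACA subrr add0r.
have e0 : `|0 : R| <= eps by rewrite normr0 ltW.
have := @curve_lipschitz _ _ (fun t => H t - G t) (fun t => F (u t) - F (v t))
    (K * d) 0 (clamp t).
rewrite H0 G0 subrr !subr0 => L.
apply: (le_trans (L _ _)); first by rewrite mulr_ge0.
- move=> x xt; have xe := between e0 (clamp_le t) xt; split.
    apply: (is_diff_eq (is_diff_sub (dH x (eps_unit xe)) (dG x (eps_unit xe)))).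
    by apply/funext => y; rewrite scalerBr.
  by apply: (le_trans (FK (Xball x Xu) (Xball x Xv))); rewrite ler_wpM2l.
- rewrite mulrAC [d / 2]mulrC -[2^-1]mul1r ler_wpM2r//.
  by apply: le_trans epsK; rewrite ler_wpM2l.
Qed.

Lemma ode_exists_eps : exists a : R -> 'rV[R]_m, a 0 = e /\
  forall t, `|t| < eps -> ball e rho (a t) /\
    is_diff (t : R^o) (a : R^o -> 'rV[R]_m) (fun y : R^o => y *: F (a t)).
Proof.
have X0 : X (fun=> e).
  by split=> [|t]; [exact: cst_continuous|rewrite subrr normr0 divr_ge0// ltW].
pose next (w : {u | X u}) : {u | X u} :=
  let s := cid2 (step_ex (svalP w)) in exist _ (s2val s) (s2valP s).
pose u k := iter k next (exist _ _ X0).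
have Xu k : X (sval (u k)) by exact: svalP.
have Su k : step (sval (u k)) (sval (u k.+1)).
  by rewrite /u iterS /next /=; case: cid2.
have C0 : 0 <= rho / 2 by rewrite divr_ge0// ltW.
have B k t : `|sval (u k.+1) t - sval (u k) t| <= rho / 2 / 2 ^+ k.
  elim: k t => [|k IH] t; first by rewrite divr1; exact: (Xu 1%N).2.
  rewrite exprSr invfM mulrA.
  apply: (step_contract _ (Xu k.+1) (Xu k) (Su k.+1) (Su k) IH).
  by rewrite divr_ge0// exprn_ge0.
have lim_ex t := geometric_limit_rV C0 (fun k => B k t).
pose a t := sval (cid (lim_ex t)).
have Ha k t : `|sval (u k) t - a t| <= 2 * (rho / 2) / 2 ^+ k.
  by rewrite /a; case: cid.
have small d : 0 < d -> exists k, 2 * (rho / 2) / 2 ^+ k <= d.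
  exact: geometric_small.
have Xa : X a.
  split=> [t|t].
    apply/cvgrPdist_lt => d d0; have d30 : 0 < d / 3 by rewrite divr_gt0.
    have [k Hk] := small _ d30.
    have := (Xu k).1 t => /cvgrPdist_lt /(_ _ d30); apply: filterS => s ts.
    rewrite -(subrKA (sval (u k) t)) (le_lt_trans (ler_normD _ _))//.
    rewrite -[sval (u k) t - a s](subrKA (sval (u k) s)).
    have H1 := le_trans (Ha k t) Hk; have H2 := le_trans (Ha k s) Hk.
    have H3 := ler_normD (sval (u k) t - sval (u k) s) (sval (u k) s - a s).
    by rewrite distrC in H1; lra.
  apply/ler_addgt0Pr => d d0; have [k Hk] := small _ d0.
  rewrite -(subrKA (sval (u k) t)) (le_trans (ler_normD _ _))// addrC lerD//.
    exact: (Xu k).2.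
  by rewrite distrC (le_trans (Ha k t) Hk).
(* A Picard step from the limit [a] returns [a]: the step halves the distance to the iterates, so
   they converge to [a'] as well. The integral equation for [a'] is then one for [a]. *)
have [a' Xa' Saa'] := step_ex Xa.
have aa' t : a t = a' t.
  apply/eqP; rewrite -subr_eq0 -normr_le0; apply/ler_addgt0Pr => d d0; rewrite add0r.
  have [k Hk] := small _ d0.
  have dk0 : 0 <= 2 * (rho / 2) / 2 ^+ k by apply: divr_ge0; [exact: mulr_ge0|exact: exprn_ge0].
  have H1 := step_contract dk0 (Xu k) Xa (Su k) Saa' (Ha k) t.
  have H2 := Ha k.+1 t; rewrite exprSr invfM mulrA in H2.
  rewrite -(subrKA (sval (u k.+1) t)) (le_trans (ler_normD _ _))//.
  by rewrite distrC; lra.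
have [H [H0 dH Ht]] := Saa'.
exists a; split.
  by rewrite aa' Ht clamp_id ?normr0 ?ltW// H0 addr0.
move=> t te; split; first exact: Xball.
have dHt := dH t (eps_unit (ltW te)).
apply: (@near_is_diff _ _ _ (fun s => e + H s)); last first.
  apply: (is_diff_eq (is_diff_add (is_diff_const e (t : R^o)) dHt)).
  by apply/funext => y; rewrite add0r.
have : id @ (t : R^o) --> (t : R^o) by exact: cvg_id.
by move=> /cvgr_norm_lt /(_ _ te); apply: filterS => s se; rewrite aa' Ht clamp_id// ltW.
Qed.

End Iteration.

End Picard.

(** * Charts *)

Section Charts.
Context {R : realType}.

Section OneChart.
Context {T : topologicalType} {n : nat} (c : chart R T n).

Lemma cmapKP x : cdom c x -> cinv c (c x) = x.
Proof. by move=> /mem_set /(cmapK (c := c)). Qed.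

Lemma ccod_cmap x : cdom c x -> ccod c (c x).
Proof. by move=> xc; exists x. Qed.

Lemma cinvKP y : ccod c y -> c (cinv c y) = y.
Proof. by move=> [x /cmapKP E <-]; rewrite E. Qed.

Lemma cdom_cinv y : ccod c y -> cdom c (cinv c y).
Proof. by move=> [x xc <-]; rewrite cmapKP. Qed.

Lemma open_ccod : open (ccod c). Proof. exact: ccod_open. Qed.

Lemma cmap_cvg x : cdom c x -> {for x, continuous c}.
Proof. by move=> /mem_set; exact: cmap_continuous. Qed.

Lemma cinv_cvg y : ccod c y -> {for y, continuous (cinv c)}.
Proof. by move=> /mem_set; exact: cinv_continuous. Qed.

Lemma near_ccod y : ccod c y -> \forall z \near y, ccod c z.
Proof. by move=> H; apply: open_nbhs_nbhs; split => //; exact: open_ccod. Qed.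

End OneChart.

Lemma open_setI_preimage (S T : topologicalType) (U : set S) (B : set T) (f : S -> T) :
  open U -> open B -> (forall x, U x -> {for x, continuous f}) ->
  open (U `&` f @^-1` B).
Proof.
move=> Uo Bo fc; rewrite openE => x [Ux Bx]; apply: filterI.
  exact: open_nbhs_nbhs.
by apply: (fc x Ux); exact: open_nbhs_nbhs.
Qed.

Lemma open_setM (S T : topologicalType) (A : set S) (B : set T) :
  open A -> open B -> open (A `*` B).
Proof.
move=> Ao Bo; rewrite openE => -[a b] [/= Aa Bb].
by exists (A, B) => //=; split; apply: open_nbhs_nbhs.
Qed.

(** The chain rule across a space without linear structure: near [y], continuity of [f] keeps its
    values in the domain of [c], where [cinv c \o c] may be inserted. *)
Lemma is_diff_through (V W : normedModType R) (T : topologicalType) n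
    (c : chart R T n) (f : V -> T) (g : T -> W) (y : V) D1 D2 :
  {for y, continuous f} -> cdom c (f y) ->
  is_diff y (c \o f) D1 -> is_diff (c (f y)) (g \o cinv c) D2 ->
  is_diff y (g \o f) (D2 \o D1).
Proof.
move=> fc cfy d1 d2.
apply: (near_is_diff _ (is_diff_comp' d1 (d2 : is_diff ((c \o f) y) _ _))).
have : \forall z \near y, cdom c (f z).
  by apply: fc; apply: open_nbhs_nbhs; split => //; exact: cdom_open.
by apply: filterS => z /= /cmapKP ->.
Qed.

Lemma transition_diff n (M : manifoldType R n) (x z z' : M) :
  cdom (chart_at z) x -> cdom (chart_at z') x ->
  differentiable (chart_at z' \o cinv (chart_at z)) (chart_at z x).
Proof.
move=> xz xz'; have [+ _] := chart_at_smooth z z' 1; apply.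
by exists x.
Qed.

(** Continuity is a separate clause: off its domain the chart [chart_at (f x)] has arbitrary values,
    so a differentiable coordinate expression does not by itself make [f] continuous. *)
Definition mdifferentiable m n (M : manifoldType R m) (N : manifoldType R n)
    (f : M -> N) (x : M) : Prop :=
  {for x, continuous f} /\
  differentiable (chart_at (f x) \o f \o cinv (chart_at x)) (chart_at x x).

Lemma is_diff_mdiff m n (M : manifoldType R m) (N : manifoldType R n)
    (f : M -> N) x : mdifferentiable f x ->
  is_diff (chart_at x x) (chart_at (f x) \o (f \o cinv (chart_at x))) (mdiff f x).
Proof. by move=> [_ df]; exact: is_diffP. Qed.

Section Mdiff.
Context {m n p : nat} {M : manifoldType R m} {N : manifoldType R n}
  {P : manifoldType R p}.

Lemma continuous_cinv (T : topologicalType) (f : M -> T) (z x : M) :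
  cdom (chart_at z) x ->
  {for x, continuous f} -> {for chart_at z x, continuous (f \o cinv (chart_at z))}.
Proof.
move=> xz fx; apply: continuous_comp; first exact/cinv_cvg/ccod_cmap.
by rewrite cmapKP.
Qed.

Lemma is_diff_mdiff_comp (f : M -> N) (W : normedModType R) (g : N -> W) x D :
  mdifferentiable f x ->
  is_diff (chart_at (f x) (f x)) (g \o cinv (chart_at (f x))) D ->
  is_diff (chart_at x x) (g \o f \o cinv (chart_at x)) (D \o mdiff f x).
Proof.
move=> df dg; have xx := chart_atP x; have yy := chart_atP (f x).
have E : (f \o cinv (chart_at x)) (chart_at x x) = f x by rewrite /= cmapKP.
have fc : {for chart_at x x, continuous (f \o cinv (chart_at x))}.
  by apply: continuous_cinv => //; case: df.
have cf : cdom (chart_at (f x)) ((f \o cinv (chart_at x)) (chart_at x x)).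
  by rewrite E.
have dg' : is_diff (chart_at (f x) ((f \o cinv (chart_at x)) (chart_at x x)))
  (g \o cinv (chart_at (f x))) D by rewrite E.
exact: (is_diff_through fc cf (is_diff_mdiff df) dg').
Qed.

Lemma mdifferentiable_comp (f : M -> N) (g : N -> P) x :
  mdifferentiable f x -> mdifferentiable g (f x) -> mdifferentiable (g \o f) x.
Proof.
move=> df dg; split; first by apply: continuous_comp; [case: df|case: dg].
by case: (is_diff_mdiff_comp (g := chart_at (g (f x)) \o g) df (is_diff_mdiff dg)).
Qed.

Lemma mdiff_comp (f : M -> N) (g : N -> P) x v :
  mdifferentiable f x -> mdifferentiable g (f x) ->
  mdiff (g \o f) x v = mdiff g (f x) (mdiff f x v).
Proof.
move=> df dg; rewrite {1}/mdiff.
exact: (is_diff_val v (is_diff_mdiff_comp (g := chart_at (g (f x)) \o g) df (is_diff_mdiff dg))).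
Qed.

End Mdiff.

Lemma mdiff_id m (M : manifoldType R m) (x : M) v : mdiff (fun y : M => y) x v = v.
Proof.
rewrite /mdiff; apply: (@is_diff_val _ _ _ _ id).
apply: (near_is_diff _ (is_diff_id _)).
have : \forall z \near chart_at x x, ccod (chart_at x) z.
  exact/near_ccod/ccod_cmap/chart_atP.
by apply: filterS => z /= H; rewrite cinvKP.
Qed.

Section Smooth2.
Context {m1 m2 n : nat} {M1 : manifoldType R m1} {M2 : manifoldType R m2}
  {N : manifoldType R n} (f : M1 -> M2 -> N).
Hypothesis fs : smooth_map2 f.

Definition loc2 (x : M1) (y : M2) (z : N) (p : 'rV[R]_m1 * 'rV[R]_m2) : 'rV[R]_n :=
  chart_at z (f (cinv (chart_at x) p.1) (cinv (chart_at y) p.2)).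

Definition dom2 (x : M1) (y : M2) (z : N) : set ('rV[R]_m1 * 'rV[R]_m2) :=
  (ccod (chart_at x) `*` ccod (chart_at y)) `&`
  [set p | cdom (chart_at z) (f (cinv (chart_at x) p.1) (cinv (chart_at y) p.2))].

Lemma open_dom2 x y z : open (dom2 x y z).
Proof.
apply: open_setI_preimage; last by case: (fs x y).
  by apply: open_setM; exact: open_ccod.
exact: cdom_open.
Qed.

Lemma smooth_loc2 x y z : smooth_on (dom2 x y z) (loc2 x y z).
Proof. by case: (fs x y) => _; exact. Qed.

Lemma dom2P x y z a b : cdom (chart_at x) a -> cdom (chart_at y) b ->
  cdom (chart_at z) (f a b) -> dom2 x y z (chart_at x a, chart_at y b).
Proof. by move=> xa yb zc; split; [split; exact: ccod_cmap|rewrite /= !cmapKP]. Qed.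

Lemma loc2E x y z a b : cdom (chart_at x) a -> cdom (chart_at y) b ->
  loc2 x y z (chart_at x a, chart_at y b) = chart_at z (f a b).
Proof. by move=> xa yb; rewrite /loc2/= !cmapKP. Qed.

Lemma loc2_diff x y z p : dom2 x y z p -> differentiable (loc2 x y z) p.
Proof. by have [H _] := @smooth_loc2 x y z 1%N; exact: H. Qed.

Lemma smooth_map2_continuous x y : {for (x, y), continuous (fun p => f p.1 p.2)}.
Proof.
have [fc _] := fs x y.
have Hp : (ccod (chart_at x) `*` ccod (chart_at y)) (chart_at x x, chart_at y y).
  by split; exact/ccod_cmap/chart_atP.
have cx := cmap_cvg (chart_atP x); have cy := cmap_cvg (chart_atP y).
move=> A; rewrite /= => NA; have := fc _ Hp A; rewrite /= !cmapKP; last 2 first.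
- exact: chart_atP.
- exact: chart_atP.
move=> /(_ NA) H.
have [[A1 B1] [/= NA1 NB1] AB] := H.
exists ((chart_at x @^-1` A1) `&` cdom (chart_at x),
        (chart_at y @^-1` B1) `&` cdom (chart_at y)) => /=.
  split; apply: filterI; [exact: cx| |exact: cy|].
  - by apply: open_nbhs_nbhs; split; [exact: cdom_open|exact: chart_atP].
  - by apply: open_nbhs_nbhs; split; [exact: cdom_open|exact: chart_atP].
move=> [a b] [/= [A1a xa] [B1b yb]].
by have := AB (chart_at x a, chart_at y b) (conj A1a B1b); rewrite /= !cmapKP.
Qed.

End Smooth2.

End Charts.

(** * One-parameter subgroups *)

Section Slices.
Context {R : realType}.
Implicit Types V W Y Z : normedModType R.

Lemma is_diff_pair' V W Z (f df : V -> W) (g dg : V -> Z) (x : V) :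
  is_diff x f df -> is_diff x g dg ->
  is_diff x (fun y => (f y, g y)) (fun v => (df v, dg v)).
Proof. by move=> ? ?; apply: is_diff_pair. Qed.

Lemma is_diff_slicer V W Y Z (f : V * W -> Z) a (g dg : Y -> W) (y : Y) :
  differentiable f (a, g y) -> is_diff y g dg ->
  is_diff y (fun b => f (a, g b)) (fun v => 'd f (a, g y) (0, dg v)).
Proof.
move=> df dgy.
have H := is_diff_pair' (is_diff_const a y) dgy.
exact: (is_diff_comp' H (is_diffP (df : differentiable f ((fun b => (a, g b)) y)))).
Qed.

Lemma is_diff_slicel V W Y Z (f : V * W -> Z) b (g dg : Y -> V) (y : Y) :
  differentiable f (g y, b) -> is_diff y g dg ->
  is_diff y (fun a => f (g a, b)) (fun v => 'd f (g y, b) (dg v, 0)).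
Proof.
move=> df dgy.
have H := is_diff_pair' dgy (is_diff_const b y).
exact: (is_diff_comp' H (is_diffP (df : differentiable f ((fun a => (g a, b)) y)))).
Qed.

Lemma is_diff_near V W (f df : V -> W) (y : V) (D : set W) :
  is_diff y f df -> open D -> D (f y) -> \forall b \near y, D (f b).
Proof.
move=> [/differentiable_continuous fc _] Do Dy.
by apply: fc; exact: open_nbhs_nbhs.
Qed.

End Slices.

Section LieLocal.
Context {R : realType} {m : nat} (G : lieGroupType R m).
Local Notation c1 := (chart_at (1%g : G)).
Let mulG (x y : G) : G := (x * y)%g.

Definition lie_e : 'rV[R]_m := c1 1%g.
Local Notation e := lie_e.
Definition lie_mul : 'rV[R]_m * 'rV[R]_m -> 'rV[R]_m := loc2 mulG 1%g 1%g 1%g.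
Definition lie_dom : set ('rV[R]_m * 'rV[R]_m) := dom2 mulG 1%g 1%g 1%g.
Local Notation U := (ccod c1).

Let mulG_smooth : smooth_map2 mulG. Proof. exact: mulg_smooth. Qed.

Lemma open_lie_dom : open lie_dom. Proof. exact: open_dom2. Qed.

Lemma lie_mul_smooth : smooth_on lie_dom lie_mul. Proof. exact: smooth_loc2. Qed.

Lemma lie_mul_diff p : lie_dom p -> differentiable lie_mul p.
Proof. exact: loc2_diff. Qed.

Lemma lie_eE : cinv c1 e = 1%g.
Proof. exact/cmapKP/chart_atP. Qed.

Lemma lie_eU : U e.
Proof. exact/ccod_cmap/chart_atP. Qed.

Lemma lie_dom_er a : U a -> lie_dom (a, e).
Proof.
move=> Ua; split; first by split => //; exact: lie_eU.
by rewrite /= lie_eE /mulG mulg1; exact: cdom_cinv.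
Qed.

Lemma lie_mul_er a : U a -> lie_mul (a, e) = a.
Proof. by move=> Ua; rewrite /lie_mul /loc2 /= lie_eE /mulG mulg1 cinvKP. Qed.

Lemma lie_mul_el a : U a -> lie_mul (e, a) = a.
Proof. by move=> Ua; rewrite /lie_mul /loc2 /= lie_eE /mulG mul1g cinvKP. Qed.

Lemma cinv_lie_mul p : lie_dom p ->
  cinv c1 (lie_mul p) = (cinv c1 p.1 * cinv c1 p.2)%g.
Proof. by move=> [_ H]; rewrite /lie_mul /loc2 cmapKP. Qed.

Lemma lie_mulU p : lie_dom p -> U (lie_mul p).
Proof. by move=> [_ H]; exact: ccod_cmap. Qed.

Lemma near_lie_dom p : lie_dom p -> \forall q \near p, lie_dom q.
Proof. by move=> H; apply: open_nbhs_nbhs; split => //; exact: open_lie_dom. Qed.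

(* The left-invariant vector field of [X] in the chart around 1. *)
Definition left_field (X a : 'rV[R]_m) : 'rV[R]_m := 'd lie_mul (a, e) (0, X).

Lemma left_field_diff (a : 'rV[R]_m) : U a ->
  is_diff e (fun b => lie_mul (a, b)) (left_field ^~ a).
Proof.
move=> Ua; have D := lie_mul_diff (lie_dom_er Ua).
exact: (is_diff_slicer (g := id) D (is_diff_id e)).
Qed.

Lemma left_field_e (X : 'rV[R]_m) : left_field X e = X.
Proof.
have H := left_field_diff lie_eU.
rewrite -(is_diff_val X H); apply: (@is_diff_val _ _ _ _ id).
apply: (near_is_diff _ (is_diff_id e)).
by have := near_ccod lie_eU; apply: filterS => b Ub; rewrite lie_mul_el.
Qed.

Lemma left_field_smooth (X : 'rV[R]_m) : smooth_on U (left_field X).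
Proof.
move=> k; have [_ /(_ (0, X)) H] := @lie_mul_smooth k.+1.
have fs : finite_span ('rV[R]_m * 'rV[R]_m)%type.
  by apply: finite_span_pair; exact: finite_span_rV.
have Ho := @open_ccod _ _ _ c1.
apply: (@Ck_comp _ _ _ _ k U lie_dom (fun a => (a, e))
  (fun p => 'd lie_mul p (0, X)) fs Ho open_lie_dom lie_dom_er) => //.
apply: (Ck_pair Ho); last exact: Ck_cst.
by apply: (Ck_lin _ Ho) => [a b c|]; [|move=> x; exact: cvg_id].
Qed.

(** Left invariance in coordinates: differentiate the associativity [p1 (p2 b) = (p1 p2) b] in [b]
    at [e]. It holds near [e] only, where all the products stay in the chart; hence the three
    neighbourhoods. *)
Lemma left_field_mul (X : 'rV[R]_m) p : lie_dom p ->
  'd lie_mul p (0, left_field X p.2) = left_field X (lie_mul p).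
Proof.
case: p => p1 p2 Wp; have [[/= U1 U2] _] := Wp.
have D2 := lie_mul_diff (lie_dom_er U2).
have E2 := lie_mul_er U2.
have H1 : is_diff e (fun b => lie_mul (p1, lie_mul (p2, b)))
    (fun v => 'd lie_mul (p1, lie_mul (p2, e)) (0, left_field v p2)).
  have Dp : differentiable lie_mul (p1, lie_mul (p2, e)).
    by rewrite E2; exact: lie_mul_diff.
  exact: (is_diff_slicer (g := fun b => lie_mul (p2, b)) Dp (left_field_diff U2)).
have H2 := left_field_diff (lie_mulU Wp).
have -> : 'd lie_mul (p1, p2) (0, left_field X p2) =
    'd (fun b => lie_mul (p1, lie_mul (p2, b))) e X.
  by rewrite (is_diff_val X H1) E2.
rewrite -(is_diff_val X H2); apply: is_diff_val.
have d2 := left_field_diff U2.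
have N1 : \forall b \near e, lie_dom (p1, lie_mul (p2, b)).
  by apply: (is_diff_near (is_diff_pair' (is_diff_const p1 e) d2) open_lie_dom);
    rewrite E2.
have N2 : \forall b \near e, lie_dom (p2, b).
  exact: (is_diff_near (is_diff_pair' (is_diff_const p2 e) (is_diff_id e))
    open_lie_dom (lie_dom_er U2)).
have N3 : \forall b \near e, lie_dom (lie_mul (p1, p2), b).
  exact: (is_diff_near (is_diff_pair' (is_diff_const (lie_mul (p1, p2)) e)
    (is_diff_id e)) open_lie_dom (lie_dom_er (lie_mulU Wp))).
apply: (near_is_diff _ (is_diffP (is_diff_ex H2))).
apply: filterS3 N1 N2 N3 => b W1 W2 W3.
have : cinv c1 (lie_mul (lie_mul (p1, p2), b)) = cinv c1 (lie_mul (p1, lie_mul (p2, b))).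
  by rewrite !cinv_lie_mul//= mulgA.
by move=> /(congr1 c1); rewrite !cinvKP//; exact: lie_mulU.
Qed.

End LieLocal.

(** * Extension of a local one-parameter subgroup *)

Section Extension.
Context {R : realType} {G : groupType}.
Variables (gamma : R -> G) (d : R).
Hypotheses (d0 : 0 < d)
  (gammaD : forall s t, `|s| < d -> `|t| < d -> gamma (s + t) = (gamma s * gamma t)%g).

Let gamma0 : gamma 0 = 1%g.
Proof.
have H : gamma (0 + 0) = (gamma 0 * gamma 0)%g by apply: gammaD; rewrite normr0.
by rewrite addr0 in H; apply: (mulgI (gamma 0)); rewrite mulg1.
Qed.

Let gamma_exp n t : `|t| * n%:R < d -> gamma (t * n%:R) = (gamma t ^+ n)%g.
Proof.
elim: n => [|n IH]; first by move=> _; rewrite mulr0 expg0 gamma0.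
move=> H; have H' : `|t| * n%:R < d.
  by apply: le_lt_trans H; rewrite ler_wpM2l// ler_nat.
rewrite -natr1 mulrDr mulr1 gammaD.
- by rewrite IH// expgSr.
- by rewrite normrM normr_nat.
- apply: le_lt_trans H; rewrite -[X in X <= _]mulr1 ler_wpM2l//.
  by rewrite ler1n.
Qed.

(** Both powers equal the one for the common refinement [N * M]. *)
Let indep (t : R) (N M : nat) : (0 < N)%N -> (0 < M)%N ->
  `|t| < d * N%:R -> `|t| < d * M%:R ->
  (gamma (t / N%:R) ^+ N)%g = (gamma (t / M%:R) ^+ M)%g.
Proof.
have key (P Q : nat) : (0 < P)%N -> (0 < Q)%N -> `|t| < d * P%:R ->
    (gamma (t / P%:R) ^+ P)%g = (gamma (t / (P * Q)%:R) ^+ (P * Q))%g.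
  move=> P0 Q0 tP; rewrite mulnC expgnA -(@gamma_exp Q (t / (Q * P)%:R)).
    congr (gamma _ ^+ P)%g; rewrite natrM; field.
    by rewrite !pnatr_eq0 -!lt0n P0 Q0.
  rewrite normrM normfV normr_nat.
  have -> : `|t| / (Q * P)%:R * Q%:R = `|t| / P%:R.
    by rewrite natrM; field; rewrite !pnatr_eq0 -!lt0n P0 Q0.
  by rewrite ltr_pdivrMr ?ltr0n.
by move=> N0 M0 tN tM; rewrite (key N M)// (key M N)// mulnC.
Qed.

Lemma one_parameter_extend : exists Gamma : R -> G,
  (forall s t, Gamma (s + t) = (Gamma s * Gamma t)%g) /\
  (forall t, `|t| < d -> Gamma t = gamma t).
Proof.
(* Dividing by [N t] brings every number of modulus at most [t] below [d]. In the additivity proof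
   the single [K = N (|s| + |t|)] therefore serves [s], [t] and [s + t]. *)
pose N (t : R) := (Num.bound (t / d)).+1.
have HN t s : 0 <= t -> `|s| <= t -> `|s| < d * (N t)%:R.
  move=> t0 st; apply: (le_lt_trans st).
  rewrite -ltr_pdivrMl// mulrC (lt_le_trans (archi_boundP _))//.
    by rewrite divr_ge0// ltW.
  by rewrite ler_nat.
exists (fun t => gamma (t / (N `|t|)%:R) ^+ N `|t|)%g; split=> [s t|t td]; last first.
  rewrite (@indep _ _ 1)// ?HN//; last by rewrite mulr1.
  by rewrite expg1 divr1.
set K := N (`|s| + `|t|).
have K0 : (0 < K)%N by [].
have KR : 0 < K%:R :> R by rewrite ltr0n.
have st0 : 0 <= `|s| + `|t| by rewrite addr_ge0.
have sK : `|s| < d * K%:R by apply: HN; rewrite ?lerDl.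
have tK : `|t| < d * K%:R by apply: HN; rewrite ?lerDr.
have stK : `|s + t| < d * K%:R by apply: HN => //; exact: ler_normD.
rewrite (@indep (s + t) _ K)// ?HN// (@indep s _ K)// ?HN// (@indep t _ K)// ?HN//.
have dK u : `|u| < d * K%:R -> `|u / K%:R| < d.
  by rewrite normrM normfV normr_nat ltr_pdivrMr.
have E : gamma ((s + t) / K%:R) = (gamma (s / K%:R) * gamma (t / K%:R))%g.
  by rewrite mulrDl gammaD// dK.
(* The factors commute because both products are [gamma] of the same sum; this is what lets the
   power of the product split. *)
have C : commute (gamma (s / K%:R)) (gamma (t / K%:R)).
  by rewrite /commute -gammaD ?dK// -gammaD ?dK// addrC.
by rewrite E expgMn.
Qed.

End Extension.

Section Shift.
Context {R : realType}.

Lemma is_diff_shift (V W : normedModType R) (f df : V -> W) (a x : V) :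
  is_diff (x + a) f df -> is_diff x (fun y => f (y + a)) df.
Proof.
move=> H; have S : is_diff x (fun y => y + a) id.
  have := is_diff_add (is_diff_id x) (is_diff_const a x).
  by rewrite (_ : (fun v => id v + 0) = id)//; apply/funext => v; rewrite addr0.
exact: (is_diff_comp' S H).
Qed.

(** Bootstrapping: the derivative of [a] is [F \o a], so if [a] is of class C^k it is of class
    C^(k+1). *)
Lemma ode_smooth m (U : set 'rV[R]_m) (F : 'rV[R]_m -> 'rV[R]_m)
    (a : R^o -> 'rV[R]_m) (I : set R^o) :
  open U -> open I -> smooth_on U F -> (forall t, I t -> U (a t)) ->
  (forall t, I t -> is_diff t a (fun y : R^o => y *: F (a t))) ->
  smooth_on I a.
Proof.
move=> Uo Io Fs aU da k; elim: k => [|k IH].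
  by move=> t It; have [/differentiable_continuous] := da t It.
split=> [t It|v]; first by case: (da t It).
apply: (@Ck_ext _ _ _ _ _ (fun t => (v : R^o) *: (F \o a) t) _ Io).
  by move=> t It; rewrite (is_diff_val v (da t It)).
apply: (Ck_scale Io); first exact: Ck_cst.
apply: (Ck_comp _ Io Uo aU IH (Fs k)); exact: finite_span_rV.
Qed.

Lemma small_time (B C K : R) : 0 <= B -> 0 < C -> 0 <= K ->
  exists eps : R, [/\ 0 < eps, eps < 1, B * eps <= C & K * eps <= 1 / 2].
Proof.
move=> B0 C0 K0; have B1 : 0 < B + 1 by rewrite ltr_wpDl.
have K1 : 0 < 2 * (K + 1) by rewrite mulr_gt0// ltr_wpDl.
(* One bound for each requirement; adding 1 to [B] and to [K] avoids a division by zero. *)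
exists (Num.min (1 / 2) (Num.min (C / (B + 1)) (1 / (2 * (K + 1))))); split.
- by rewrite !lt_min !divr_gt0.
- rewrite gt_min; apply/orP; left; lra.
- apply: (@le_trans _ _ (B * (C / (B + 1)))).
    by rewrite ler_wpM2l// !ge_min lexx !orbT.
  by rewrite mulrA ler_pdivrMr// mulrDr mulr1 mulrC lerDl ltW.
- apply: (@le_trans _ _ (K * (1 / (2 * (K + 1))))).
    by rewrite ler_wpM2l// !ge_min lexx !orbT.
  by rewrite mulrA mulr1 ler_pdivrMr//; lra.
Qed.

End Shift.

Section OneParameter.
Context {R : realType} {m : nat} (G : lieGroupType R m).
Local Notation c1 := (chart_at (1%g : G)).
Local Notation e := (lie_e G).
Local Notation U := (ccod c1).
Variable X : 'rV[R]_m.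
Let F := left_field G X.
Let mu := lie_mul G.

(** The curve [a] solves [a' = F a] with [a 0 = e]. Both [t |-> a (t + s)] and [t |-> mu (a s, a t)]
    are integral curves of the left-invariant field [F] through [a s], hence equal. *)
Lemma local_one_parameter : exists (a : R -> 'rV[R]_m) (d : R),
  [/\ 0 < d, a 0 = e,
      forall t : R^o, `|t| < d -> U (a t) /\
         is_diff t (a : R^o -> _) (fun y : R^o => y *: F (a t)) &
      forall s t, `|s| < d -> `|t| < d -> lie_dom G (a s, a t) /\ a (s + t) = mu (a s, a t)].
Proof.
have Uo := @open_ccod _ _ _ c1.
have [rho [K [rho0 K0 BU FK]]] := Ck_lipschitz Uo (lie_eU G) (@left_field_smooth _ _ G X 1).
have B0 : 0 <= `|F e| + K * rho by rewrite addr_ge0// mulr_ge0// ltW.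
have rho20 : 0 < rho / 2 by rewrite divr_gt0.
have [eps [eps0 eps1 epsB epsK]] := small_time B0 rho20 K0.
have [a [a0 Ha]] := ode_exists_eps rho0 K0 FK eps0 eps1 epsB epsK.
have We := lie_dom_er (lie_eU G).
have muee : mu (e, e) = e by exact: lie_mul_er (lie_eU G).
have muc : {for (e, e), continuous mu}.
  exact: (differentiable_continuous (lie_mul_diff We)).
have Bmu : nbhs (e, e) (fun p => ball e rho (mu p)).
  by apply: muc; rewrite muee; exact: nbhsx_ballx.
have [[A B] [/= NA NB] AB] := filterI (near_lie_dom We) Bmu.
have ac : {for (0 : R^o), continuous (a : R^o -> _)}.
  by have [|_ [/differentiable_continuous]] := Ha 0; rewrite ?normr0.
have NAB : \forall t \near (0 : R^o), A (a t) /\ B (a t).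
  apply: filterI; apply: ac; rewrite a0//.
have /nbhs_ballP[d1 /= d10 Hd1] := NAB.
(* The bound [eps / 2] keeps [s + t] where the solution lives; [d1] keeps the two factors where
   their product is defined in the chart and lies in the ball of uniqueness. *)
exists a, (Num.min d1 (eps / 2)).
have d0 : 0 < Num.min d1 (eps / 2) by rewrite lt_min d10 divr_gt0.
have deps (t : R) : `|t| < Num.min d1 (eps / 2) -> `|t| < eps.
  by rewrite lt_min => /andP[_ H]; apply: (lt_trans H); lra.
have dAB t : `|t| < Num.min d1 (eps / 2) -> A (a t) /\ B (a t).
  by rewrite lt_min => /andP[H _]; apply: Hd1; rewrite /ball/= sub0r normrN.
split => //.
  by move=> t td; have [H1 H2] := Ha t (deps t td); split => //; exact: BU.
move=> s t sd td; have [As _] := dAB s sd; have [_ Bt] := dAB t td.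
split; first by have [] := AB (a s, a t) (conj As Bt).
have sumeps (u : R) : `|u| < Num.min d1 (eps / 2) -> `|u + s| < eps.
  move=> ud; apply: (le_lt_trans (ler_normD _ _)).
  by move: ud sd; rewrite !lt_min => /andP[_ ?] /andP[_ ?]; lra.
rewrite addrC.
apply: (@ode_unique _ _ F e rho K rho0 K0 FK (Num.min d1 (eps / 2))
  (fun t => a (t + s)) (fun t => mu (a s, a t))) => //.
- apply: (le_trans _ epsK); rewrite ler_wpM2l// ge_min; apply/orP; right; lra.
- move=> u ud; have [_ Bu] := dAB u ud; split.
    by have [] := Ha (u + s) (sumeps u ud).
  by have [] := AB (a s, a u) (conj As Bu).
- move=> u ud; have [_ H] := Ha (u + s) (sumeps u ud).
  exact: is_diff_shift.
- move=> u ud; have [_ Bu] := dAB u ud.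
  have [W _] := AB (a s, a u) (conj As Bu).
  have [_ Du] := Ha u (deps u ud).
  have H := is_diff_slicer (lie_mul_diff W) Du.
  have Hd : (fun y : R^o => 'd (lie_mul G) (a s, a u) (0, y *: F (a u))) =
      (fun y : R^o => y *: F (mu (a s, a u))); last by rewrite -Hd; exact: H.
  apply/funext => y; rewrite /F /mu -(left_field_mul X W).
  have -> : ((0 : 'rV[R]_m), y *: left_field G X (a u)) =
      y *: ((0 : 'rV[R]_m), left_field G X (a u)).
    by congr pair; rewrite /= scaler0.
  by rewrite linearZ.
- rewrite add0r a0 /mu lie_mul_er//.
  by have [/BU] := Ha s (deps s sd).
Qed.

Lemma one_parameter_exists : exists gamma : R -> G,
  one_parameter_subgroup X gamma.
Proof.
have [a [d [d0 a0 Ha aD]]] := local_one_parameter.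
pose g t := cinv c1 (a t).
have gD s t : `|s| < d -> `|t| < d -> g (s + t) = (g s * g t)%g.
  by move=> sd td; have [W E] := aD s t sd td; rewrite /g E cinv_lie_mul.
have [Gam [GamD Gamg]] := one_parameter_extend d0 gD.
have cg t : `|t| < d -> c1 (g t) = a t.
  by move=> td; rewrite /g cinvKP//; have [] := Ha t td.
have gdom t : `|t| < d -> cdom c1 (g t).
  by move=> td; apply: cdom_cinv; have [] := Ha t td.
have Id (t0 : R) : open [set t : R^o | `|t - t0| < d].
  rewrite (_ : [set _ | _] = ball t0 d); first exact: ball_open.
  by apply/seteqP; split=> t /=; rewrite /ball/= distrC.
have as0 : smooth_on [set t : R^o | `|t - 0| < d] a.
  apply: (ode_smooth (F := F) (@open_ccod _ _ _ c1) (Id 0)).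
  - exact: left_field_smooth.
  - by move=> t /=; rewrite subr0 => /Ha[].
  - by move=> t /=; rewrite subr0 => /Ha[].
have as_ (t0 : R) : smooth_on [set t : R^o | `|t - t0| < d] (fun t : R^o => a (t - t0)).
  move=> k; have sh : Ck k [set t : R^o | `|t - t0| < d] (fun t : R^o => t - t0 : R^o).
    apply: (Ck_add (Id t0)); last exact: Ck_cst.
    by apply: (Ck_lin _ (Id t0)) => [b c x|x]; [|exact: cvg_id].
  have sub t : [set t : R^o | `|t - t0| < d] t -> [set t : R^o | `|t - 0| < d] (t - t0).
    by rewrite /= subr0.
  exact: (Ck_comp (@finite_span_R R) (Id t0) (Id 0) sub sh (as0 k)).
have mulG_s : smooth_map2 (fun x y : G => (x * y)%g) by exact: mulg_smooth.
pose p (t0 : R) (t : R^o) := (chart_at (Gam t0) (Gam t0), a (t - t0)).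
have ps t0 : smooth_on [set t : R^o | `|t - t0| < d] (p t0).
  by move=> k; apply: (Ck_pair (Id t0)); [exact: Ck_cst|exact: as_].
(* Near any [t0] the curve is [Gam t0] times a translate of the local solution, so its smoothness
   there reduces to that of the product and of [a]. *)
have GamE t0 t : `|t - t0| < d -> Gam t = (Gam t0 * g (t - t0))%g.
  by move=> td; rewrite -Gamg// -GamD subrKC.
pose I t0 z : set R^o := [set t : R^o | `|t - t0| < d] `&`
   p t0 @^-1` dom2 (fun x y : G => (x * y)%g) (Gam t0) 1%g z.
have Io t0 z : open (I t0 z).
  by apply: open_setI_preimage; [exact: Id|exact: (open_dom2 mulG_s)|exact: (ps t0 0%N)].
have It0 t0 z : cdom (chart_at z) (Gam t0) -> I t0 z t0.
  move=> zt; split; first by rewrite /= subrr normr0.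
  rewrite /= /p subrr a0; apply: dom2P; [exact: chart_atP|exact: chart_atP|].
  by rewrite mulg1.
have E t0 z t : I t0 z t -> loc2 (fun x y : G => (x * y)%g) (Gam t0) 1%g z (p t0 t)
    = chart_at z (Gam t) /\ cdom (chart_at z) (Gam t).
  move=> [/= td [_ /=]]; rewrite /p /loc2 /= cmapKP; last exact: chart_atP.
  by rewrite -/(g _) -GamE.
have sm t0 z : smooth_on (I t0 z) (fun t : R^o => chart_at z (Gam t)).
  move=> k; apply: (@Ck_ext _ _ _ k _ (loc2 (fun x y : G => (x * y)%g) (Gam t0) 1%g z \o p t0)
    _ (Io t0 z)); first by move=> t /E[].
  have fs : finite_span ('rV[R]_m * 'rV[R]_m)%type.
    by apply: finite_span_pair; exact: finite_span_rV.
  have S := smooth_loc2 mulG_s (Gam t0) 1%g z k.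
  have O : open (dom2 (fun x y : G => (x * y)%g) (Gam t0) 1%g z) by exact: (open_dom2 mulG_s).
  have HI t : I t0 z t -> dom2 (fun x y : G => (x * y)%g) (Gam t0) 1%g z (p t0 t).
    by case.
  by apply: (Ck_comp fs (Io t0 z) O HI _ S); apply: CkW (ps t0 k) => t [].
exists Gam; split => //.
  split=> [t0 _|z].
    have zt := chart_atP (Gam t0).
    have c0 : {for t0, continuous (fun t : R^o => chart_at (Gam t0) (Gam t))}.
      exact: (sm t0 _ 0%N t0 (It0 t0 _ zt)).
    have N : \forall t \near (t0 : R^o),
        Gam t = cinv (chart_at (Gam t0)) (chart_at (Gam t0) (Gam t)).
      apply: (near_open (Io t0 (Gam t0)) (It0 t0 _ zt)) => t /E[_ H].
      by rewrite cmapKP.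
    have c2 : {for t0, continuous (cinv (chart_at (Gam t0)) \o
         (fun t : R^o => chart_at (Gam t0) (Gam t)))}.
      by apply: continuous_comp => //; exact/cinv_cvg/ccod_cmap.
    move: c2; rewrite /prop_for /continuous_at /= cmapKP// => c2.
    apply: cvg_trans c2; apply: near_eq_cvg; apply: filterS N => t Nt; exact: esym Nt.
  move=> k; apply: Ck_local => t0 [_ /= zt]; exists (I t0 z); first exact: It0.
  exact: sm.
have D0 : is_diff (0 : R^o) (fun t : R^o => chart_at (1%g : G) (Gam t)) (fun y : R^o => y *: X).
  have [|_ Da] := Ha 0; first by rewrite normr0.
  rewrite a0 /F left_field_e in Da.
  apply: (near_is_diff _ Da).
  apply: (near_open (Id 0)); first by rewrite /= subrr normr0.
  by move=> t /=; rewrite subr0 => td; rewrite Gamg// cg.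
by rewrite derive1E' ?(is_diff_val _ D0) ?scale1r//; case: D0.
Qed.

End OneParameter.

(** * Fundamental vector fields *)

Section Smooth2Mdiff.
Context {R : realType} {m1 m2 n : nat} {M1 : manifoldType R m1}
  {M2 : manifoldType R m2} {N : manifoldType R n} (f : M1 -> M2 -> N).
Hypothesis fs : smooth_map2 f.

Lemma smooth2_mdiffr a b : mdifferentiable (f a) b.
Proof.
have za := chart_atP a; have zb := chart_atP b; have zf := chart_atP (f a b).
split.
  move=> A /(@smooth_map2_continuous _ _ _ _ _ _ _ _ fs a b)[[A1 B1] [/= NA NB] AB].
  by apply: filterS NB => b' Bb'; apply: (AB (a, b')); split => //; exact: nbhs_singleton.
have D := loc2_diff fs (dom2P za zb zf).
have [H _] := is_diff_slicer (g := id) D (is_diff_id (chart_at b b)).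
rewrite (_ : _ \o _ = fun b' => loc2 f a b (f a b) (chart_at a a, b')) //.
by apply/funext => b' /=; rewrite /loc2/= cmapKP.
Qed.

Lemma smooth2_mdiffl a b : mdifferentiable (f^~ b) a.
Proof.
have za := chart_atP a; have zb := chart_atP b; have zf := chart_atP (f a b).
split.
  move=> A /(@smooth_map2_continuous _ _ _ _ _ _ _ _ fs a b)[[A1 B1] [/= NA NB] AB].
  by apply: filterS NA => a' Aa'; apply: (AB (a', b)); split => //; exact: nbhs_singleton.
have D := loc2_diff fs (dom2P za zb zf).
have [H _] := is_diff_slicel (g := id) D (is_diff_id (chart_at a a)).
rewrite (_ : _ \o _ = fun a' => loc2 f a b (f a b) (a', chart_at b b)) //.
by apply/funext => a' /=; rewrite /loc2/= cmapKP.
Qed.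

End Smooth2Mdiff.

Section Orbit.
Context {R : realType} {m n : nat} (G : lieGroupType R m) (M : manifoldType R n).
Variable act : G -> M -> M.
Hypothesis hact : smooth_action act.
Local Notation c1 := (chart_at (1%g : G)).
Local Notation e := (lie_e G).
Let acts : smooth_map2 act := act_smooth hact.

Lemma exp_curveP X : one_parameter_subgroup X (exp_curve G X).
Proof. by apply: xgetPex; exact: one_parameter_exists. Qed.

Lemma exp_curve0 X : exp_curve G X 0 = 1%g.
Proof.
have [H _ _] := exp_curveP X; have := H 0 0; rewrite addr0 => E.
by apply: (mulgI (exp_curve G X 0)); rewrite mulg1.
Qed.

Lemma exp_curve_cvg X : {for (0 : R^o), continuous (exp_curve G X : R^o -> G)}.
Proof. by have [_ [H _] _] := exp_curveP X; exact: H. Qed.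

Lemma exp_curve_diff X :
  is_diff (0 : R^o) (fun t : R^o => c1 (exp_curve G X t)) (fun s : R^o => s *: X).
Proof.
have [_ [_ H] D] := exp_curveP X; have [df _] := H 1%g 1%N.
have d0 : differentiable (fun t : R^o => c1 (exp_curve G X t)) (0 : R^o).
  by apply: df; split => //=; rewrite exp_curve0; exact: chart_atP.
apply: (is_diff_eq (is_diffP d0)); apply/funext => s.
rewrite -[s in LHS]mulr1 linearZ /= -derive1E'//; congr (_ *: _).
exact: D.
Qed.

Section AtPoint.
Variable x : M.
Local Notation c := (chart_at x).
Local Notation y0 := (chart_at x x).

Definition act_loc := loc2 act 1%g x x.
Definition act_dom := dom2 act 1%g x x.

Lemma open_act_dom : open act_dom. Proof. exact: open_dom2. Qed.

Lemma act_loc_smooth : smooth_on act_dom act_loc. Proof. exact: smooth_loc2. Qed.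

Lemma act_loc_diff p : act_dom p -> differentiable act_loc p.
Proof. exact: loc2_diff. Qed.

Lemma act_loc_diff2 p v : act_dom p -> differentiable (fun q => 'd act_loc q v) p.
Proof. by have [_ /(_ v) [H _]] := @act_loc_smooth 2%N; exact: H. Qed.

Lemma near_act_dom p : act_dom p -> \forall q \near p, act_dom q.
Proof. by move=> H; apply: open_nbhs_nbhs; split => //; exact: open_act_dom. Qed.

Lemma act_dom_e y : ccod c y -> act_dom (e, y).
Proof.
move=> cy; split; first by split => //; exact: lie_eU.
by rewrite /= lie_eE (act_one hact); exact: cdom_cinv.
Qed.

Lemma act_loc_e y : ccod c y -> act_loc (e, y) = y.
Proof.
by move=> cy; rewrite /act_loc /loc2/= lie_eE (act_one hact) cinvKP.
Qed.

Lemma cinv_act_loc p : act_dom p ->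
  cinv c (act_loc p) = act (cinv c1 p.1) (cinv c p.2).
Proof. by move=> [_ H]; rewrite /act_loc /loc2 cmapKP. Qed.

(* The fundamental vector field of [X] in the chart around [x]. *)
Definition act_field (X : 'rV[R]_m) (y : 'rV[R]_n) : 'rV[R]_n :=
  'd act_loc (e, y) (X, 0).

Lemma act_field_linear y : linear (act_field^~ y).
Proof.
move=> a X Y; rewrite /act_field -linearZ -linearD.
by congr ('d _ _ _); congr pair; rewrite /= ?scaler0 ?addr0.
Qed.

Lemma fin_span2 : finite_span ('rV[R]_m * 'rV[R]_n)%type.
Proof. by apply: finite_span_pair; exact: finite_span_rV. Qed.

Lemma act_field_smooth X : smooth_on (ccod c) (act_field X).
Proof.
move=> k; have [_ /(_ (X, 0)) H] := @act_loc_smooth k.+1.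
have Ho := @open_ccod _ _ _ c.
have P : Ck k (ccod c) (fun y => (e, y)).
  apply: (Ck_pair Ho); first exact: Ck_cst.
  by apply: (Ck_lin _ Ho) => [a u v|z]; [|exact: cvg_id].
exact: (Ck_comp fin_span2 Ho open_act_dom act_dom_e P H).
Qed.

(** [fundamental] is read in a different chart at each point. The transition differential [tvec]
    relates all these values to one smooth field in the chart of [x]; of the exponential curve, only
    the velocity at 0 enters. *)
Lemma fundamental_tvec X y : ccod c y ->
  fundamental act X (cinv c y) = tvec c y (act_field X y).
Proof.
move=> cy; set z := cinv c y; have zz := chart_atP z.
pose f (t : R^o) := act (exp_curve G X t) z.
have f0 : f 0 = z by rewrite /f exp_curve0 (act_one hact).
have fc : {for (0 : R^o), continuous f}.
  apply: (@continuous_comp _ _ _ (exp_curve G X : R^o -> G) (act^~ z)).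
    exact: exp_curve_cvg.
  by case: (smooth2_mdiffl acts (exp_curve G X 0) z).
have d1 : is_diff (0 : R^o) (c \o f) (fun s => 'd act_loc (e, y) (s *: X, 0)).
  have E0 : c1 (exp_curve G X 0) = e by rewrite exp_curve0.
  have D : differentiable act_loc (c1 (exp_curve G X 0), y).
    by rewrite E0; exact/act_loc_diff/act_dom_e.
  have H := is_diff_slicel (g := fun t : R^o => c1 (exp_curve G X t)) D (exp_curve_diff X).
  rewrite E0 in H; apply: (near_is_diff _ H).
  have : \forall t \near (0 : R^o), cdom c1 (exp_curve G X t).
    apply: exp_curve_cvg; rewrite exp_curve0; apply: open_nbhs_nbhs.
    by split; [exact: cdom_open|exact: chart_atP].
  by apply: filterS => t H'; rewrite /act_loc /loc2/= cmapKP.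
have cf : cdom c (f 0) by rewrite f0; exact: cdom_cinv.
have d2 : is_diff (c (f 0)) (chart_at z \o cinv c) ('d (chart_at z \o cinv c) y).
  rewrite f0 cinvKP//; apply: is_diffP.
  by have := transition_diff (cdom_cinv cy) zz; rewrite cinvKP.
have d := is_diff_through fc cf d1 d2.
rewrite /fundamental derive1E'; last by case: d.
by rewrite (is_diff_val _ d) /= scale1r.
Qed.

End AtPoint.

End Orbit.

(** * The Lie bracket in coordinates around the identity *)

Section LieBracket.
Context {R : realType} {m : nat} (G : lieGroupType R m).
Local Notation c1 := (chart_at (1%g : G)).
Local Notation e := (lie_e G).
Local Notation U := (ccod c1).
Local Notation mu := (lie_mul G).
Let mulG_s : smooth_map2 (fun x y : G => (x * y)%g) := @mulg_smooth R m G.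

Lemma left_field_linear a : linear (left_field G ^~ a).
Proof.
move=> k X Y; rewrite /left_field -linearZ -linearD.
by congr ('d _ _ _); congr pair; rewrite /= ?scaler0 ?addr0.
Qed.

Lemma left_field_differentiable X a : U a -> differentiable (left_field G X) a.
Proof. by have [H _] := @left_field_smooth _ _ G X 1%N; exact: H. Qed.

(** Brings [left_invariant], whose values are read in the chart of each point, back to the chart at
    1, where the bracket is computed from [left_field]. *)
Lemma left_invariant_loc X a : U a ->
  tcoord c1 (cinv c1 a) (left_invariant X (cinv c1 a)) = left_field G X a.
Proof.
move=> Ua; set g := cinv c1 a; have gg := chart_atP g.
have -> : left_invariant X g =
    'd (chart_at g \o (fun h : G => (g * h)%g) \o cinv c1) e X.
  by rewrite /left_invariant /mdiff mulg1.
have [_ dm] := smooth2_mdiffr mulG_s g 1%g.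
rewrite mulg1 in dm.
pose f (b : 'rV[R]_m) := (g * cinv c1 b)%g.
have fe : f e = g by rewrite /f lie_eE mulg1.
have fc : {for e, continuous f}.
  have [mc _] := smooth2_mdiffr mulG_s g 1%g.
  exact: (continuous_cinv (chart_atP (1%g : G)) mc).
have cf : cdom (chart_at g) (f e) by rewrite fe.
have d2 : is_diff (chart_at g (f e)) (c1 \o cinv (chart_at g))
    ('d (c1 \o cinv (chart_at g)) (chart_at g g)).
  by rewrite fe; apply: is_diffP; apply: transition_diff => //; exact: cdom_cinv.
have d := is_diff_through (g := c1) fc cf (is_diffP dm) d2.
have Ed : 'd (c1 \o f) e X = tcoord c1 g _ := is_diff_val X d.
by rewrite -Ed; exact: (is_diff_val X (left_field_diff Ua)).
Qed.

Lemma lie_bracketE X Y :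
  lie_bracket G X Y = 'd (left_field G Y) e X - 'd (left_field G X) e Y.
Proof.
have li Z : left_invariant Z (1%g : G) = Z.
  rewrite /left_invariant (_ : (fun h : G => _) = (fun h => h)) ?mdiff_id//.
  by apply/funext => h; rewrite mul1g.
have E Z v : 'd (fun y => tcoord c1 (cinv c1 y) (left_invariant Z (cinv c1 y))) e v =
   'd (left_field G Z) e v.
  have D := is_diffP (left_field_differentiable Z (lie_eU G)).
  apply: is_diff_val; apply: (near_is_diff _ D).
  apply: (near_open (@open_ccod _ _ _ c1) (lie_eU G)) => b Ub.
  by rewrite left_invariant_loc.
transitivity ('d (fun y => tcoord c1 (cinv c1 y) (left_invariant Y (cinv c1 y))) e
      (left_invariant X (1%g : G)) -
    'd (fun y => tcoord c1 (cinv c1 y) (left_invariant X (cinv c1 y))) e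
      (left_invariant Y (1%g : G))); first by [].
congr (_ - _).
  exact: (etrans (E Y _) (congr1 ('d (left_field G Y) e) (li X))).
exact: (etrans (E X _) (congr1 ('d (left_field G X) e) (li Y))).
Qed.

Lemma left_field_diff_linear Y : linear (fun X => 'd (left_field G X) e Y).
Proof.
move=> k X X'.
have -> : left_field G (k *: X + X') = (fun a => k *: left_field G X a + left_field G X' a).
  by apply/funext => a; rewrite left_field_linear.
have H Z := is_diffP (left_field_differentiable Z (lie_eU G)).
have D := is_diff_add (@is_diffZ _ _ _ _ _ k e (H X)) (H X').
exact: (is_diff_val Y D).
Qed.

Lemma lie_bracketxx X : lie_bracket G X X = 0 :> 'rV[R]_m.
Proof. by rewrite lie_bracketE subrr. Qed.

Lemma lie_bracketC X Y : lie_bracket G X Y = - lie_bracket G Y X :> 'rV[R]_m.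
Proof. by rewrite !lie_bracketE opprB. Qed.

Lemma lie_bracketl Y : linear (fun X => lie_bracket G X Y).
Proof.
move=> k X X'; rewrite !lie_bracketE.
have aux (u v w z : 'rV[R]_m) : (k *: u + v) - (k *: w + z) = k *: (u - w) + (v - z).
  by rewrite scalerBr opprD addrACA.
have E1 : 'd (left_field G Y) e (k *: X + X') =
  k *: 'd (left_field G Y) e X + 'd (left_field G Y) e X' by exact: linearP.
exact: (etrans (congr2 (fun u v => u - v) E1 (left_field_diff_linear Y k X X')) (aux _ _ _ _)).
Qed.

End LieBracket.

(** * Brackets of fundamental vector fields *)

Section FundBracket.
Context {R : realType} {m n : nat} (G : lieGroupType R m) (M : manifoldType R n).
Variable act : G -> M -> M.
Hypothesis hact : smooth_action act.
Local Notation c1 := (chart_at (1%g : G)).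
Local Notation e := (lie_e G).
Local Notation mu := (lie_mul G).
Variable x : M.
Local Notation c := (chart_at x).
Local Notation y0 := (chart_at x x).
Local Notation A := (act_loc act x).
Local Notation xi := (act_field act x).

Let cy0 : ccod c y0. Proof. exact/ccod_cmap/chart_atP. Qed.
Let We := act_dom_e hact cy0.

Let Lo : open (lie_dom G).
Proof. exact: open_lie_dom. Qed.

Let Wo : open (act_dom act x).
Proof. exact: open_act_dom. Qed.

(** Differentiate [(a h) y = a (h y)] in [h] at [e]. *)
Lemma act_loc_mul a y : act_dom act x (a, y) -> ccod c1 a -> ccod c y -> forall Y,
  'd A (a, y) (left_field G Y a, 0) = 'd A (a, y) (0, xi Y y).
Proof.
move=> Wa Ua cy Y.
have E1 := lie_mul_er Ua.
have E2 : A (e, y) = y := act_loc_e hact cy.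
have D1 : is_diff e (fun h => A (mu (a, h), y))
      (fun v => 'd A (mu (a, e), y) (left_field G v a, 0)).
  apply: is_diff_slicel; first by rewrite E1; exact: act_loc_diff.
  exact: left_field_diff.
have de : is_diff e (fun h => A (h, y)) (fun v => xi v y).
  by apply: (is_diff_slicel (g := id) _ (is_diff_id e)); exact/act_loc_diff/act_dom_e.
have D2 : is_diff e (fun h => A (a, A (h, y))) (fun v => 'd A (a, A (e, y)) (0, xi v y)).
  by apply: (is_diff_slicer _ de); rewrite E2; exact: act_loc_diff.
have -> : 'd A (a, y) (left_field G Y a, 0) = 'd (fun h => A (mu (a, h), y)) e Y.
  by rewrite (is_diff_val Y D1) E1.
have -> : 'd A (a, y) (0, xi Y y) = 'd (fun h => A (a, A (h, y))) e Y.
  by rewrite (is_diff_val Y D2) E2.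
apply: is_diff_val; apply: (near_is_diff _ (is_diffP (is_diff_ex D2))).
have N1 : \forall h \near e, act_dom act x (mu (a, h), y).
  apply: (is_diff_near (is_diff_pair' (left_field_diff Ua) (is_diff_const y e))
    Wo).
  by rewrite E1.
have N2 : \forall h \near e, lie_dom G (a, h).
  exact: (is_diff_near (is_diff_pair' (is_diff_const a e) (is_diff_id e))
    Lo (lie_dom_er Ua)).
have N3 : \forall h \near e, act_dom act x (a, A (h, y)).
  apply: (is_diff_near (is_diff_pair' (is_diff_const a e) de) Wo).
  by rewrite E2.
have N4 : \forall h \near e, act_dom act x (h, y).
  exact: (is_diff_near (is_diff_pair' (is_diff_id e) (is_diff_const y e))
    Wo (act_dom_e hact cy)).
apply: filterS3 (filterI N1 N2) N3 N4 => h [W1 W2] W3 W4.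
have EL : cinv c (A (mu (a, h), y)) = act (cinv c1 (mu (a, h))) (cinv c y).
  exact: cinv_act_loc W1.
have ER : cinv c (A (a, A (h, y))) = act (cinv c1 a) (cinv c (A (h, y))).
  exact: cinv_act_loc W3.
have ER2 : cinv c (A (h, y)) = act (cinv c1 h) (cinv c y) by exact: cinv_act_loc W4.
have EM : cinv c1 (mu (a, h)) = (cinv c1 a * cinv c1 h)%g by exact: cinv_lie_mul W2.
have : cinv c (A (mu (a, h), y)) = cinv c (A (a, A (h, y))).
  by rewrite EL ER ER2 EM (act_mul hact).
have H p : act_dom act x p -> ccod c (A p) by move=> [_ H]; exact: ccod_cmap.
by move=> /(congr1 c); rewrite !cinvKP//; apply: H.
Qed.

(** [xi X] is the derivative of the action along the group, so its derivative along [v] is a mixed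
    second derivative of the action, which may be taken in the other order. *)
Lemma diff_act_loc_sym X v :
  'd (fun p => 'd A p (0, v)) (e, y0) (X, 0) = 'd (xi X) y0 v.
Proof.
have N : \forall p \near (e, y0), differentiable A p.
  by apply: filterS (near_act_dom hact We) => p; exact: act_loc_diff.
have S := diff_sym_span (finite_span_rV n) N (act_loc_diff2 hact (0, v) We)
  (act_loc_diff2 hact (X, 0) We).
have H := is_diff_slicer (g := id) (act_loc_diff2 hact (X, 0) We) (is_diff_id y0).
exact: (etrans S (esym (is_diff_val v H))).
Qed.

(** Differentiating [act_loc_mul] in [a] at [e] gives [key]. On exchanging [X] and [Y] and
    subtracting, the second derivatives of the action in group directions cancel by symmetry. In the
    convention of [vf_bracket] the left side is the bracket of [xi Y] with [xi X]: for a left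
    action, passing to fundamental fields reverses brackets. *)
Lemma act_field_bracket X Y :
  'd (xi X) y0 (xi Y y0) - 'd (xi Y) y0 (xi X y0) = xi (lie_bracket G X Y) y0.
Proof.
have key X' Y' : 'd (fun p => 'd A p (Y', 0)) (e, y0) (X', 0) +
    xi ('d (left_field G Y') e X') y0 = 'd (xi X') y0 (xi Y' y0).
  have near_e : \forall a \near e, act_dom act x (a, y0) /\ ccod c1 a.
    apply: filterI; last exact/near_ccod/lie_eU.
    exact: (is_diff_near (is_diff_pair' (is_diff_id e) (is_diff_const y0 e))
      Wo We).
  have dF w : differentiable (fun p => 'd A p w) (e, y0) by exact: act_loc_diff2.
  have dz : is_diff e (fun a => (a, y0)) (fun v => (v, 0)).
    exact: (is_diff_pair' (is_diff_id e) (is_diff_const y0 e)).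
  have dl : is_diff e (left_field G Y') ('d (left_field G Y') e).
    exact/is_diffP/left_field_differentiable/lie_eU.
  have du : is_diff e (fun a => (left_field G Y' a, 0 : 'rV[R]_n))
      (fun v => ('d (left_field G Y') e v, 0)).
    exact: (is_diff_pair' dl (is_diff_const 0 e)).
  have H1 := is_diff_diff (@fin_span2 R m n) dF dz du.
  have H2 := is_diff_diff (@fin_span2 R m n) dF dz
    (is_diff_const ((0 : 'rV[R]_m), xi Y' y0) e).
  have E1 := etrans (is_diff_val X' H1) (congr1
    (fun w => 'd (fun p => 'd A p (w, 0)) (e, y0) (X', 0) +
       'd A (e, y0) ('d (left_field G Y') e X', 0)) (left_field_e G Y')).
  have E2 := etrans (is_diff_val X' H2) (etrans (congr1
    (fun w => 'd (fun p => 'd A p (0, xi Y' y0)) (e, y0) (X', 0) + w)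
    (linear0 ('d A (e, y0)))) (addr0 _)).
  apply: (etrans (esym E1)); apply: (etrans _ (etrans E2 (diff_act_loc_sym X' _))).
  apply: is_diff_val; apply: (near_is_diff _ (is_diffP (is_diff_ex H2))).
  by apply: filterS near_e => a [Wa Ua]; rewrite act_loc_mul.
have sym : 'd (fun p => 'd A p (Y, 0)) (e, y0) (X, 0) =
    'd (fun p => 'd A p (X, 0)) (e, y0) (Y, 0).
  apply: (diff_sym_span (finite_span_rV _)).
  - by have := near_act_dom hact We; apply: filterS => p; exact: act_loc_diff.
  - exact: act_loc_diff2.
  - exact: act_loc_diff2.
rewrite lie_bracketE.
have aux (u v w w' : 'rV[R]_n) : w = w' -> (w + u) - (w' + v) = u - v.
  by move=> ->; rewrite opprD addrACA subrr add0r.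
apply: (etrans (congr2 (fun u v => u - v) (esym (key X Y)) (esym (key Y X)))).
apply: (etrans (aux _ _ _ _ sym)).
have lin u v : xi u y0 - xi v y0 = xi (u - v) y0.
  by rewrite addrC -scaleN1r -(act_field_linear act x y0) scaleN1r addrC.
exact: lin.
Qed.

End FundBracket.

(** * The adjoint action preserves brackets *)

Section Adjoint.
Context {R : realType} {m : nat} (G : lieGroupType R m).
Local Notation c1 := (chart_at (1%g : G)).
Local Notation e := (lie_e G).
Local Notation U := (ccod c1).
Local Notation mu := (lie_mul G).
Let mulG (x y : G) : G := (x * y)%g.
Let mulG_s : smooth_map2 mulG := @mulg_smooth R m G.
Let conj (g h : G) : G := (g * h * g^-1)%g.

Let conj1 g : conj g 1%g = 1%g.
Proof. by rewrite /conj mulg1 mulgV. Qed.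

Lemma conj_mdiff g h : mdifferentiable (fun h : G => (g * h * g^-1)%g) h.
Proof.
exact: (mdifferentiable_comp (smooth2_mdiffr mulG_s g h)
  (smooth2_mdiffl mulG_s (g * h)%g (g^-1)%g)).
Qed.

Lemma Ad_linear (g : G) : linear (Ad g).
Proof. by move=> k X Y; rewrite /Ad /mdiff; exact: linearP. Qed.

Lemma Ad1 X : Ad (1%g : G) X = X.
Proof.
rewrite /Ad (_ : (fun h : G => _) = (fun h => h)) ?mdiff_id//.
by apply/funext => h; rewrite mul1g invg1 mulg1.
Qed.

Lemma AdM (g h : G) X : Ad (g * h)%g X = Ad g (Ad h X).
Proof.
rewrite {1}/Ad (_ : (fun k : G => _) = conj g \o conj h); last first.
  by apply/funext => k; rewrite /conj /= invgM !mulgA.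
rewrite mdiff_comp; [|exact: conj_mdiff|exact: conj_mdiff].
by rewrite conj1.
Qed.

Section AdBracket.
Variable g : G.

(** Conjugation is factored as left multiplication by [g], read in the chart at [g] (this is [f1],
    on [O1]), followed by right multiplication by [g^-1]. On [O2] both steps stay in their charts,
    so smoothness comes from that of the product. *)
Let phi (a : 'rV[R]_m) : 'rV[R]_m := c1 (conj g (cinv c1 a)).
Let O1 : set 'rV[R]_m := [set a | dom2 mulG g 1%g g (chart_at g g, a)].
Let f1 (a : 'rV[R]_m) := loc2 mulG g 1%g g (chart_at g g, a).
Let O2 : set 'rV[R]_m := O1 `&` f1 @^-1`
  [set b | dom2 mulG g g^-1%g 1%g (b, chart_at g^-1%g g^-1%g)].

Let fs2 : finite_span ('rV[R]_m * 'rV[R]_m)%type.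
Proof. by apply: finite_span_pair; exact: finite_span_rV. Qed.

Let slice_r k (u : 'rV[R]_m) (O : set 'rV[R]_m) : open O ->
  Ck k O (fun a : 'rV[R]_m => (u, a)).
Proof.
move=> Oo; apply: (Ck_pair Oo); first exact: Ck_cst.
by apply: (Ck_lin _ Oo) => [a v w|z]; [|exact: cvg_id].
Qed.

Let slice_l k (u : 'rV[R]_m) (O : set 'rV[R]_m) : open O ->
  Ck k O (fun a : 'rV[R]_m => (a, u)).
Proof.
move=> Oo; apply: (Ck_pair Oo); last exact: Ck_cst.
by apply: (Ck_lin _ Oo) => [a v w|z]; [|exact: cvg_id].
Qed.

Let open_r (u : 'rV[R]_m) (D : set ('rV[R]_m * 'rV[R]_m)) : open D ->
  open [set a | D (u, a)].
Proof.
move=> Do; rewrite -[X in open X]setTI.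
apply: (open_setI_preimage (f := fun a => (u, a)) openT Do) => a _.
exact: (@slice_r 0%N u setT openT a).
Qed.

Let open_l (u : 'rV[R]_m) (D : set ('rV[R]_m * 'rV[R]_m)) : open D ->
  open [set a | D (a, u)].
Proof.
move=> Do; rewrite -[X in open X]setTI.
apply: (open_setI_preimage (f := fun a => (a, u)) openT Do) => a _.
exact: (@slice_l 0%N u setT openT a).
Qed.

Let O1o : open O1.
Proof. by apply: open_r; exact: (open_dom2 mulG_s). Qed.

Let f1s : smooth_on O1 f1.
Proof.
move=> k; have Do : open (dom2 mulG g 1%g g) by exact: (open_dom2 mulG_s).
have I a : O1 a -> dom2 mulG g 1%g g (chart_at g g, a) by [].
exact: (Ck_comp fs2 O1o Do I (@slice_r k (chart_at g g) O1 O1o)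
  (smooth_loc2 mulG_s g 1%g g k)).
Qed.

Let O2'o : open [set b | dom2 mulG g g^-1%g 1%g (b, chart_at g^-1%g g^-1%g)].
Proof. by apply: open_l; exact: (open_dom2 mulG_s). Qed.

Let O2o : open O2.
Proof. by apply: open_setI_preimage => //; exact: (f1s 0%N). Qed.

Let O2P a : O2 a -> U a /\ cdom c1 (conj g (cinv c1 a)).
Proof.
move=> [[[/= _ Ua] H1] [_ H2]]; split => //.
have zg := chart_atP g; have zi := chart_atP (g^-1)%g.
move: H1 H2; rewrite /f1 /loc2 /= (cmapKP zg) (cmapKP zi) => H1.
by rewrite (cmapKP H1).
Qed.

Let phiE a : O2 a ->
  phi a = loc2 mulG g g^-1%g 1%g (f1 a, chart_at g^-1%g g^-1%g).
Proof.
have zg := chart_atP g; have zi := chart_atP (g^-1)%g.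
move=> [[_ +] _]; rewrite /f1 /loc2 /phi /conj /= (cmapKP zg) (cmapKP zi) => H1.
by rewrite (cmapKP H1).
Qed.

Let phis : smooth_on O2 phi.
Proof.
move=> k; apply: (Ck_ext O2o (f := (fun b => loc2 mulG g g^-1%g 1%g
  (b, chart_at g^-1%g g^-1%g)) \o f1)); first by move=> a /phiE.
have Do : open (dom2 mulG g g^-1%g 1%g) by exact: (open_dom2 mulG_s).
have S : Ck k [set b | dom2 mulG g g^-1%g 1%g (b, chart_at g^-1%g g^-1%g)]
   (fun b => loc2 mulG g g^-1%g 1%g (b, chart_at g^-1%g g^-1%g)).
  have I' b : [set b | dom2 mulG g g^-1%g 1%g (b, chart_at g^-1%g g^-1%g)] b ->
    dom2 mulG g g^-1%g 1%g (b, chart_at g^-1%g g^-1%g) by [].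
  exact: (Ck_comp fs2 O2'o Do I' (@slice_l k (chart_at g^-1%g g^-1%g) _ O2'o)
    (smooth_loc2 mulG_s g g^-1%g 1%g k)).
have I a : O2 a -> [set b | dom2 mulG g g^-1%g 1%g (b, chart_at g^-1%g g^-1%g)] (f1 a).
  by case.
apply: (Ck_comp (finite_span_rV m) O2o O2'o I _ S).
by apply: CkW (f1s k) => a [].
Qed.

Let phie : phi e = e.
Proof. by rewrite /phi lie_eE conj1. Qed.

Let O2e : O2 e.
Proof.
have g1 : mulG g 1%g = g by rewrite /mulG mulg1.
have H1 : O1 e.
  by apply: dom2P; rewrite ?g1; exact: chart_atP.
split => //=; rewrite /f1 loc2E; [|exact: chart_atP|exact: chart_atP].
rewrite g1; apply: dom2P; [exact: chart_atP|exact: chart_atP|].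
by rewrite /mulG mulgV; exact: chart_atP.
Qed.

Let phi_diff a : O2 a -> is_diff a phi ('d phi a).
Proof. by move=> Oa; apply: is_diffP; have [H _] := phis 1%N; exact: H. Qed.

Let phi_diff2 v a : O2 a -> differentiable (fun b => 'd phi b v) a.
Proof. by move=> Oa; have [_ /(_ v) [H _]] := phis 2%N; exact: H. Qed.

Let AdE X : Ad g X = 'd phi e X.
Proof. by rewrite /Ad /mdiff mulg1 mulgV. Qed.

Let cinv_phi a : O2 a -> cinv c1 (phi a) = conj g (cinv c1 a).
Proof. by move=> /O2P[_ H]; rewrite /phi cmapKP. Qed.

Let phiU a : O2 a -> U (phi a).
Proof. by move=> /O2P[_ H]; exact: ccod_cmap. Qed.

(** Conjugation is multiplicative; differentiate [phi (a b) = phi a * phi b], both products taken in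
    the group, in [b] at [e]. *)
Let phi_left a Y : O2 a -> 'd phi a (left_field G Y a) = left_field G (Ad g Y) (phi a).
Proof.
move=> Oa; have [Ua ca] := O2P Oa.
have E1 := lie_mul_er Ua.
have dl := left_field_diff Ua.
have D1 : is_diff e (fun b => phi (mu (a, b))) (fun v => 'd phi a (left_field G v a)).
  have H : is_diff (mu (a, e)) phi ('d phi a) by rewrite E1; exact: phi_diff.
  exact: (is_diff_comp' dl H).
have D2 : is_diff e (fun b => mu (phi a, phi b)) (fun v => left_field G (Ad g v) (phi a)).
  have Dm : is_diff (phi e) (fun b => mu (phi a, b)) (left_field G ^~ (phi a)).
    by rewrite phie; exact/left_field_diff/phiU.
  apply: (is_diff_eq (is_diff_comp' (phi_diff O2e) Dm)); apply/funext => v.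
  exact: (congr1 (fun w => left_field G w (phi a)) (esym (AdE v))).
apply: (etrans (esym (is_diff_val Y D1))); apply: (etrans _ (is_diff_val Y D2)).
apply: is_diff_val; apply: (near_is_diff _ (is_diffP (is_diff_ex D2))).
have Lo : open (lie_dom G) by exact: open_lie_dom.
have N1 : \forall b \near e, O2 (mu (a, b)).
  by apply: (is_diff_near dl O2o); rewrite E1.
have N2 : \forall b \near e, lie_dom G (a, b).
  exact: (is_diff_near (is_diff_pair' (is_diff_const a e) (is_diff_id e)) Lo (lie_dom_er Ua)).
have N3 : \forall b \near e, O2 b by exact: (is_diff_near (is_diff_id e) O2o O2e).
have N4 : \forall b \near e, lie_dom G (phi a, phi b).
  apply: (is_diff_near (is_diff_pair' (is_diff_const (phi a) e) (phi_diff O2e)) Lo).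
  by rewrite phie; exact/lie_dom_er/phiU.
apply: filterS3 (filterI N1 N2) N3 N4 => b [W1 W2] W3 W4.
have EL : cinv c1 (mu (a, b)) = (cinv c1 a * cinv c1 b)%g by exact: cinv_lie_mul W2.
have ER : cinv c1 (mu (phi a, phi b)) = (conj g (cinv c1 a) * conj g (cinv c1 b))%g.
  by rewrite -(cinv_phi Oa) -(cinv_phi W3); exact: cinv_lie_mul W4.
have : cinv c1 (mu (phi a, phi b)) = cinv c1 (phi (mu (a, b))).
  by rewrite ER (cinv_phi W1) EL /conj !mulgA mulgVK.
move=> /(congr1 c1); rewrite !cinvKP//; last exact: lie_mulU.
exact: phiU.
Qed.

(** Differentiating [phi_left] in [a] at [e] along [X'] gives [key]. Antisymmetrising cancels the
    second derivative of [phi] and leaves the formula [lie_bracketE] on both sides. *)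
Lemma Ad_bracket X Y :
  Ad g (lie_bracket G X Y) = lie_bracket G (Ad g X) (Ad g Y).
Proof.
have key X' Y' : 'd (fun a => 'd phi a Y') e X' + 'd phi e ('d (left_field G Y') e X') =
    'd (left_field G (Ad g Y')) e (Ad g X').
  have dl : is_diff e (left_field G Y') ('d (left_field G Y') e).
    exact/is_diffP/left_field_differentiable/lie_eU.
  have dF w : differentiable (fun p => 'd phi p w) e by exact: phi_diff2.
  have H1 := is_diff_diff (finite_span_rV m) dF (is_diff_id e) dl.
  have E1 := etrans (is_diff_val X' H1) (congr1
    (fun w => 'd (fun p => 'd phi p w) e X' +
       'd phi e ('d (left_field G Y') e X')) (left_field_e G Y')).
  apply: (etrans (esym E1)).
  have H2 : is_diff e (left_field G (Ad g Y') \o phi)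
      ('d (left_field G (Ad g Y')) e \o 'd phi e).
    have H : is_diff (phi e) (left_field G (Ad g Y')) ('d (left_field G (Ad g Y')) e).
      by rewrite phie; exact/is_diffP/left_field_differentiable/lie_eU.
    exact: (is_diff_comp' (phi_diff O2e) H).
  have E2 := etrans (is_diff_val X' H2)
    (congr1 ('d (left_field G (Ad g Y')) e) (esym (AdE X'))).
  apply: (etrans _ E2).
  have N : \forall a \near e, left_field G (Ad g Y') (phi a) = 'd phi a (left_field G Y' a).
    by apply: (near_open O2o O2e) => a Oa; exact: (esym (phi_left Y' Oa)).
  exact: (is_diff_val X' (near_is_diff N (is_diffP (is_diff_ex H2)))).
have sym : 'd (fun a => 'd phi a Y) e X = 'd (fun a => 'd phi a X) e Y.
  apply: (diff_sym_span (finite_span_rV _)); [|exact: phi_diff2|exact: phi_diff2].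
  by apply: (near_open O2o O2e) => a /phi_diff[].
apply: (etrans (AdE _)).
apply: (etrans (congr1 ('d phi e) (lie_bracketE G X Y))).
apply: (etrans _ (esym (lie_bracketE G _ _))).
have aux (u v w w' : 'rV[R]_m) : w = w' -> (w + u) - (w' + v) = u - v.
  by move=> ->; rewrite opprD addrACA subrr add0r.
apply: esym; apply: (etrans (congr2 (fun u v => u - v) (esym (key X Y)) (esym (key Y X)))).
apply: (etrans (aux _ _ _ _ sym)).
exact: (esym (linearB _ _ _)).
Qed.

End AdBracket.

End Adjoint.

(** * Differential forms in charts, and their invariance under the action *)

Section FormsLocal.
Context {R : realType} {n : nat} (M : manifoldType R n).

Lemma tvec_center (x : M) v : tvec (chart_at x) (chart_at x x) v = v.
Proof.
have xx := chart_atP x; rewrite /tvec (cmapKP xx).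
apply: (@is_diff_val _ _ _ _ id).
apply: (near_is_diff _ (is_diff_id (chart_at x x))).
by have := near_ccod (ccod_cmap xx); apply: filterS => z Hz; rewrite /= cinvKP.
Qed.

Lemma form_loc_center r (w : M -> ('I_r -> tangent R n) -> R) (x : M) v :
  form_loc w (chart_at x) (chart_at x x) v = w x v.
Proof.
rewrite /form_loc (cmapKP (chart_atP x)); congr (w x _).
by apply/funext => i; exact: tvec_center.
Qed.

Lemma form_loc_multilinear r (w : diff_form M r) (c : chart R M n) y :
  multilinear (form_loc w c y).
Proof.
move=> v i a u u'; rewrite /form_loc.
have E u0 : (fun j => tvec c y (upd v i u0 j)) =
    upd (fun j => tvec c y (v j)) i (tvec c y u0).
  by apply/funext => j; rewrite /upd; case: eqP.
rewrite !E -(form_multilinear w); congr (w _ (upd _ _ _)).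
exact: linearP.
Qed.

Lemma form_loc_diff r (w : diff_form M r) (x : M) v y : ccod (chart_at x) y ->
  differentiable (fun y => form_loc w (chart_at x) y v : R^o) y.
Proof. by have [H _] := form_smooth w x v 1%N; exact: H. Qed.

End FormsLocal.

Section Fundamental.
Context {R : realType} {m n : nat} (G : lieGroupType R m) (M : manifoldType R n).
Variable act : G -> M -> M.
Hypothesis hact : smooth_action act.
Local Notation c1 := (chart_at (1%g : G)).
Local Notation e := (lie_e G).
Let acts : smooth_map2 act := act_smooth hact.

Lemma fundamental_center X x : fundamental act X x = act_field act x X (chart_at x x).
Proof.
have H := fundamental_tvec hact X (ccod_cmap (chart_atP x)).
by rewrite tvec_center (cmapKP (chart_atP x)) in H.
Qed.

Lemma fundamental_linear x : linear (fun X => fundamental act X x).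
Proof. by move=> k X Y; rewrite !fundamental_center; exact: act_field_linear. Qed.

Lemma fundamental_orbit X x : fundamental act X x = mdiff (act^~ x) (1%g : G) X.
Proof.
have xx := chart_atP x; rewrite fundamental_center /mdiff (act_one hact).
have D := act_loc_diff hact (act_dom_e hact (ccod_cmap xx)).
have H := is_diff_slicel (g := id) D (is_diff_id e).
have E : (chart_at x \o act^~ x) \o cinv c1 = fun a => act_loc act x (id a, chart_at x x).
  by apply/funext => a; rewrite /act_loc /loc2 /= (cmapKP xx).
rewrite E; exact: (esym (is_diff_val X H)).
Qed.

(** Both sides are the differential at 1 of [h |-> g h x = (g h g^-1) (g x)]. *)
Lemma fundamental_push g X x :
  mdiff (act g) x (fundamental act X x) = fundamental act (Ad g X) (act g x).
Proof.
rewrite !fundamental_orbit /Ad.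
have d1 : mdifferentiable (act^~ x) (1%g : G) := smooth2_mdiffl acts 1%g x.
have d2 : mdifferentiable (act g) (act 1%g x) := smooth2_mdiffr acts g _.
have d3 := conj_mdiff g (1%g : G).
have d4 : mdifferentiable (act^~ (act g x)) (g * 1 * g^-1)%g := smooth2_mdiffl acts _ _.
have E1 := mdiff_comp X d1 d2; have E2 := mdiff_comp X d3 d4.
have Ef : act g \o act^~ x = act^~ (act g x) \o (fun h : G => (g * h * g^-1)%g).
  by apply/funext => h /=; rewrite -!(act_mul hact) mulgVK.
rewrite Ef in E1; rewrite (act_one hact) in E1.
have E3 : (g * 1 * g^-1)%g = 1%g by rewrite mulg1 mulgV.
apply: (etrans (esym E1)); apply: (etrans E2).
exact: (congr1 (fun h => mdiff (act^~ (act g x)) h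
  (mdiff (fun h : G => (g * h * g^-1)%g) (1%g : G) X)) E3).
Qed.

(** The target chart of the tangent map varies with [a]; here the map is expressed in the single
    chart of [x], where it can be differentiated in [a]. *)
Lemma mdiff_act_loc x a v : act_dom act x (a, chart_at x x) ->
  mdiff (act (cinv c1 a)) x v =
  tvec (chart_at x) (act_loc act x (a, chart_at x x))
    ('d (act_loc act x) (a, chart_at x x) (0, v)).
Proof.
move=> Wa; have xx := chart_atP x; set g := cinv c1 a; set c := chart_at x.
pose f := act g \o cinv c.
have fx : f (c x) = act g x by rewrite /f /= (cmapKP xx).
have Ecf : c \o f = fun y => act_loc act x (a, id y) by [].
have D := is_diff_slicer (g := id) (act_loc_diff hact Wa) (is_diff_id (c x)).
have cx : cdom c (f (c x)) by have [_ H] := Wa.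
have fc : {for c x, continuous f}.
  by apply: (continuous_cinv xx); have [] := smooth2_mdiffr acts g x.
have Ec : c (f (c x)) = act_loc act x (a, c x) by [].
have Ei : cinv c (act_loc act x (a, c x)) = act g x by rewrite -Ec (cmapKP cx) fx.
have d2 : is_diff (c (f (c x))) (chart_at (act g x) \o cinv c)
    ('d (chart_at (act g x) \o cinv c) (c (f (c x)))).
  apply: is_diffP; apply: transition_diff => //; rewrite fx; exact: chart_atP.
have d := is_diff_through fc cx D d2.
have L := is_diff_val v d.
by rewrite /tvec Ei; exact: L.
Qed.

(* [L_X alpha = 0] in coordinates. *)
Lemma lie_derivative r (alpha : diff_form M r) :
  (forall g, preserves_form (act g) alpha) ->
  forall (X : 'rV[R]_m) (x : M) (v : 'I_r -> 'rV[R]_n),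
  'd (fun y => form_loc alpha (chart_at x) y v : R^o) (chart_at x x)
     (fundamental act X x) +
  \sum_j alpha x (upd v j ('d (act_field act x X) (chart_at x x) (v j))) = 0.
Proof.
move=> inv X x v; have xx := chart_atP x; set c := chart_at x; set y0 := chart_at x x.
have cy0 : ccod c y0 by exact: ccod_cmap.
have We := act_dom_e hact cy0.
have E0 : act_loc act x (e, y0) = y0 := act_loc_e hact cy0.
pose T a := form_loc alpha c (act_loc act x (a, y0)).
pose w (j : 'I_r) (a : 'rV[R]_m) := 'd (act_loc act x) (a, y0) (0, v j).
have Tm a : multilinear (T a) by exact: form_loc_multilinear.
have Hw j : is_diff e (w j) (fun Y => 'd (fun p => 'd (act_loc act x) p (0, v j)) (e, y0) (Y, 0)).
  exact: (is_diff_slicel (g := id) (act_loc_diff2 hact (0, v j) We) (is_diff_id e)).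
have dA := is_diff_slicel (g := id) (act_loc_diff hact We) (is_diff_id e).
have HT u : is_diff e (fun a => T a u : R^o)
    ('d (fun y => form_loc alpha c y u : R^o) y0 \o (fun Y => 'd (act_loc act x) (e, y0) (Y, 0))).
  have dF : is_diff (act_loc act x (e, y0)) (fun y => form_loc alpha c y u : R^o)
     ('d (fun y => form_loc alpha c y u : R^o) y0).
    by rewrite E0; exact/is_diffP/form_loc_diff.
  exact: (is_diff_comp' dA dF).
have H := is_diff_multilinear Tm Hw (fun u => is_diff_ex (HT u)).
have Ew : w^~ e = v.
  apply/funext => j; rewrite /w.
  have dA2 := is_diff_slicer (g := id) (act_loc_diff hact We) (is_diff_id y0).
  apply: (etrans (esym (is_diff_val (v j) dA2))).
  apply: (@is_diff_val _ _ _ _ id); apply: (near_is_diff _ (is_diff_id y0)).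
  by have := near_ccod cy0; apply: filterS => y cy; rewrite (act_loc_e hact cy).
pose P (z : 'I_r -> 'rV[R]_n) := is_diff e (fun a => T a (w^~ a) : R^o)
  (fun Y => 'd (fun a => T a z : R^o) e Y + \sum_j T e (upd z j
     ('d (fun p => 'd (act_loc act x) p (0, v j)) (e, y0) (Y, 0)))).
have {}H : P v by rewrite -Ew; exact: H.
(* [T a (w^~ a)] is the pullback of [alpha] by the action of [a], evaluated at [x] on [v]; by
   invariance it is constant near [e]. Its differential is also given by the product rule [H]. *)
have C : is_diff e (fun a => T a (w^~ a) : R^o) (fun=> 0).
  apply: (near_is_diff _ (is_diff_const (alpha x v : R^o) e)).
  have Wo : open (act_dom act x) by exact: open_act_dom.
  have N : \forall a \near e, act_dom act x (a, y0).
    exact: (is_diff_near (is_diff_pair' (is_diff_id e) (is_diff_const y0 e)) Wo We).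
  apply: filterS N => a Wa.
  rewrite -(inv (cinv c1 a)) /T /form_loc.
  have -> : cinv c (act_loc act x (a, y0)) = act (cinv c1 a) x.
    by rewrite (cinv_act_loc Wa) /= (cmapKP xx).
  congr (alpha _ _); apply/funext => j; exact: mdiff_act_loc.
have E := etrans (esym (is_diff_val X H)) (is_diff_val X C).
apply: (etrans _ E); rewrite fundamental_center.
apply: (congr2 (fun a b : R => a + b)); first exact: (esym (is_diff_val X (HT v))).
apply: eq_bigr => j _.
have EL u : T e u = alpha x u by rewrite /T E0; exact: form_loc_center.
apply: (etrans _ (esym (EL _))); congr (alpha x (upd v j _)).
exact: (esym (diff_act_loc_sym hact x X (v j))).
Qed.

End Fundamental.

(** * Exterior algebra *)

Section Alternating.
Context {R : realType}.

Definition is_alternating (n r : nat) (T : ('I_r -> 'rV[R]_n) -> R) : Prop :=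
  forall v i j, i != j -> v i = v j -> T v = 0.

Section Basics.
Context {n r : nat}.
Implicit Types (v : 'I_r -> 'rV[R]_n) (T : ('I_r -> 'rV[R]_n) -> R).

(** Polarisation: expand [B (u + u') (u + u') = 0]. Vanishing is asked for the one pair [i], [j], so
    that the lemma can serve before full alternation is known. *)
Lemma multilinear_swap T i j : multilinear T -> i != j ->
  (forall v, v i = v j -> T v = 0) ->
  forall v, T (fun l => v (tperm i j l)) = - T v.
Proof.
move=> Tm ij H v; pose B a b := T (upd (upd v i a) j b).
have Bl a a' b : B (a + a') b = B a b + B a' b.
  by rewrite /B !(updC v _ _ ij) multilinearD.
have Br a b b' : B a (b + b') = B a b + B a b' by rewrite /B multilinearD.
have B0 a : B a a = 0.
  by apply: H; rewrite /upd eqxx (negbTE ij) eqxx.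
have E1 : T v = B (v i) (v j).
  congr T; apply/funext => l; rewrite /upd.
  by case: eqP => [->|_] //; case: eqP => [->|_].
have E2 : T (fun l => v (tperm i j l)) = B (v j) (v i).
  congr T; apply/funext => l; rewrite /upd; case: tpermP => [->|->|/eqP/negbTE -> /eqP/negbTE ->//].
    by rewrite eqxx (negbTE ij).
  by rewrite eqxx.
have := B0 (v i + v j); rewrite Bl !Br !B0 add0r addr0 E1 E2 => /eqP.
by rewrite addrC addr_eq0 => /eqP.
Qed.

(** Only vanishing is carried along a product of transpositions, so the sign of the permutation
    never has to be tracked. *)
Lemma alternating_perm T (s : 'S_r) : multilinear T -> is_alternating T ->
  forall v, T v = 0 -> T (fun l => v (s l)) = 0.
Proof.
move=> Tm Ta; have [ts -> dts] := prod_tpermP s.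
elim: ts dts => [_|[i j] ts IH /= /andP[ij dts]] v v0.
  by rewrite big_nil; rewrite (_ : (fun l => _) = v)//; apply/funext => l; rewrite perm1.
rewrite big_cons.
rewrite (_ : (fun l => _) = fun l =>
    (fun l => v ((\prod_(t <- ts) tperm t.1 t.2)%g l)) (tperm i j l)); last first.
  by apply/funext => l; rewrite permM.
have S := multilinear_swap Tm ij (fun w => @Ta w i j ij)
  (fun l => v ((\prod_(t <- ts) tperm t.1 t.2)%g l)).
by rewrite S IH// oppr0.
Qed.

(** Induction on the distance of the two equal arguments: swapping the farther one with its left
    neighbour changes only the sign and brings them closer. *)
Lemma alternating_adjacent T : multilinear T ->
  (forall v (i j : 'I_r), j = i.+1 :> nat -> v i = v j -> T v = 0) -> is_alternating T.
Proof.
move=> Tm H.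
have K d : forall v (i j : 'I_r), j = (i + d.+1)%N :> nat -> v i = v j -> T v = 0.
  elim: d => [|d IH] v i j E vij; first by apply: H vij; rewrite E addn1.
  have j'r : (i + d.+1 < r)%N by rewrite -addnS (leq_trans _ (ltn_ord j))// E addnS.
  pose j' := Ordinal j'r.
  have jj' : j' != j by apply/eqP => /(congr1 val) /=; rewrite E; lia.
  have adj w : w j' = w j -> T w = 0 by apply: H; rewrite E /= !addnS.
  have ij' : i != j' by apply/eqP => /(congr1 val) /=; lia.
  have ij : i != j by apply/eqP => /(congr1 val) /=; rewrite E; lia.
  have S := multilinear_swap Tm jj' adj v.
  apply/eqP; rewrite -oppr_eq0 -S; apply/eqP; apply: (IH _ i j') => //.
  by rewrite tpermL tpermD// eq_sym.
move=> v i j; rewrite neq_ltn => /orP[ij|ji] vij.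
  by apply: (K (j - i).-1 v i j _ vij); rewrite prednK ?subn_gt0// subnKC// ltnW.
by apply: (K (i - j).-1 v j i _ (esym vij)); rewrite prednK ?subn_gt0// subnKC// ltnW.
Qed.

Lemma multilinear_basis0 T : multilinear T ->
  (forall I : 'I_r -> 'I_n, T (fun a => basis_vec (I a)) = 0) -> forall v, T v = 0.
Proof.
move=> Tm H v.
(* The slots from [d] on already hold basis vectors; expanding one more slot by linearity lowers
   [d]. *)
suff K d : (d <= r)%N -> forall v, (forall j : 'I_r, (d <= j)%N -> exists i, v j = basis_vec i) ->
    T v = 0.
  by apply: (K r (leqnn r)) => j; rewrite leqNgt ltn_ord.
elim: d => [|d IH] dr {}v Hv.
  have Hv' j : exists i, v j = basis_vec i by exact: Hv.
  rewrite (_ : v = fun a => basis_vec (sval (cid (Hv' a))))//.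
  by apply/funext => a; case: cid.
rewrite -(upd_id v (Ordinal dr)) multilinear_delta// big1// => l _.
rewrite IH ?mulr0 ?(ltnW dr)// => j; rewrite leq_eqVlt => /predU1P[dj|dj].
  by exists l; rewrite /upd -val_eqE /= -dj eqxx.
have [i vj] := Hv j dj; exists i; rewrite /upd -val_eqE /= gtn_eqF//.
Qed.

End Basics.

Lemma increasing_lt k m (f : increasing_tuple k m) (i j : 'I_k) :
  (i < j)%N -> (val f i < val f j)%N.
Proof. by move=> ij; have /forallP/(_ i)/forallP/(_ j)/implyP := valP f; apply. Qed.

Lemma increasing_inj k m (f : increasing_tuple k m) : injective (val f).
Proof.
move=> i j E; apply: val_inj; case: (ltngtP i j) => // ij.
  by have := increasing_lt f ij; rewrite E ltnn.
by have := increasing_lt f ij; rewrite E ltnn.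
Qed.

(** [f] lists the image of [I] in increasing order, and [s a] is the rank of [I a] in that list. *)
Lemma increasing_perm k m (I : 'I_k -> 'I_m) : injective I ->
  exists (f : increasing_tuple k m) (s : 'S_k), forall a, I a = val f (s a).
Proof.
move=> Iinj; pose A := [set I a | a : 'I_k]%SET.
have cA : #|A| = k by rewrite card_imset ?card_ord.
pose F := [ffun j : 'I_k => enum_val (cast_ord (esym cA) j)].
have sA : sorted ltn (map val (enum A)).
  apply: (subseq_sorted ltn_trans _ (iota_ltn_sorted 0 m)).
  by rewrite -val_enum_ord; apply: map_subseq; rewrite enumT; exact: filter_subseq.
have Finc : [forall i : 'I_k, forall j : 'I_k, (i < j)%N ==> (F i < F j)%N].
  apply/forallP => i; apply/forallP => j; apply/implyP => ij; rewrite !ffunE.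
  rewrite !(enum_val_nth (I i)).
  have sz (l : 'I_k) : (l < size (map val (enum A)))%N by rewrite size_map -cardE cA.
  have := sorted_ltn_nth ltn_trans 0%N sA _ _ (sz i) (sz j) ij.
  by rewrite !(nth_map (I i)) -?cardE ?cA.
have IA a : I a \in A by exact: imset_f.
pose s a := cast_ord cA (enum_rank_in (IA a) (I a)).
have Fs a : I a = F (s a).
  by rewrite ffunE cast_ordK enum_rankK_in.
have sinj : injective s.
  by move=> a b E; apply: Iinj; rewrite !Fs E.
by exists (exist _ F Finc), (perm sinj) => a; rewrite permE -Fs.
Qed.

Lemma alternating_basis0 k m (T : ('I_k -> 'rV[R]_m) -> R) :
  multilinear T -> is_alternating T ->
  (forall f : increasing_tuple k m, T (fun a => basis_vec (val f a)) = 0) ->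
  forall v, T v = 0.
Proof.
move=> Tm Ta H; apply: multilinear_basis0 => // I.
have [Iinj|] := pselect (injective I).
  have [f [s Is]] := increasing_perm Iinj.
  have := alternating_perm s Tm Ta (H f).
  by congr (T _ = 0); apply/funext => a; rewrite Is.
move=> nI; have [i [j [ij Iij]]] : exists i j, i != j /\ I i = I j.
  apply/not_existsP => K; apply: nI => i j Iij; apply/eqP/negPn/negP => ij.
  by apply: (K i); exists j.
by apply: (Ta _ i j ij); rewrite Iij.
Qed.

Definition minor k m (X : 'I_k -> 'rV[R]_m) (f : 'I_k -> 'I_m) : R :=
  \det (\matrix_(a < k, b < k) X a 0 (f b)).

Lemma wedgeE k m (X : seq 'rV[R]_m) (f : increasing_tuple k m) :
  wedge k X f = minor (fun a => nth 0 X a) (val f).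
Proof. by rewrite ffunE. Qed.

Lemma nth_ord_image k (S : Type) (x0 : S) (X : 'I_k -> S) (a : 'I_k) :
  nth x0 [seq X a | a : 'I_k] a = X a.
Proof. by rewrite (nth_map a) ?nth_ord_enum// size_enum_ord. Qed.

Lemma wedge_image k m (X : 'I_k -> 'rV[R]_m) (f : increasing_tuple k m) :
  wedge k [seq X a | a : 'I_k] f = minor X (val f).
Proof. by rewrite wedgeE; congr minor; apply/funext => a; rewrite nth_ord_image. Qed.

Lemma minor_multilinear k m (f : 'I_k -> 'I_m) : multilinear (fun X => minor X f).
Proof.
move=> v i a u u'; rewrite /minor -[X in _ = _ + X]mul1r.
apply: (determinant_multilinear (i0 := i)).
- by apply/rowP => b; rewrite !mxE /upd !eqxx !mxE mul1r.
- by apply/matrixP => p q; rewrite !mxE /upd eq_sym (negbTE (neq_lift _ _)).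
- by apply/matrixP => p q; rewrite !mxE /upd eq_sym (negbTE (neq_lift _ _)).
Qed.

Lemma minor_alternating k m (f : 'I_k -> 'I_m) : is_alternating (fun X => minor X f).
Proof.
move=> v i j ij vij; apply: (determinant_alternate ij) => b.
by rewrite !mxE vij.
Qed.

(** Two strictly sorted lists of [k] entries coincide as soon as one is contained in the other. *)
Lemma increasing_image_inj k m (f g : increasing_tuple k m) :
  (forall a, exists b, val g a = val f b) -> f = g.
Proof.
move=> H; pose S (h : increasing_tuple k m) := [seq (val h a : nat) | a : 'I_k].
have srt h : sorted ltn (S h).
  apply: (homo_sorted (e := fun i j : 'I_k => (i < j)%N)).
    by move=> i j; exact: increasing_lt.
  have := iota_ltn_sorted 0 k; rewrite -val_enum_ord sorted_map.
  by rewrite enumT.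
have Su h : uniq (S h) by exact: (sorted_uniq ltn_trans ltnn (srt h)).
have sub : {subset S g <= S f}.
  move=> _ /mapP[a _ ->]; have [b ->] := H a.
  by apply/mapP; exists b => //; exact: mem_enum.
have sz h : size (S h) = k by rewrite size_map size_enum_ord.
have [|_ E] := uniq_min_size (Su g) sub; first by rewrite !sz.
have {E} E : S g = S f by apply: (irr_sorted_eq ltn_trans ltnn).
apply: val_inj; apply/ffunP => a; apply: val_inj => /=.
have := congr1 (nth 0%N ^~ a) E.
by rewrite /S !nth_ord_image.
Qed.

(** For [f != g] some value of [g] is missed by [f], and the corresponding row of the matrix is
    zero. *)
Lemma minor_basis k m (f g : increasing_tuple k m) :
  minor (fun a => basis_vec (val g a)) (val f) = (f == g)%:R.
Proof.
case: eqVneq => [->|fg].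
  rewrite /minor (_ : \matrix_(_, _) _ = 1%:M) ?det1//.
  apply/matrixP => a b; rewrite !mxE eqxx /=.
  by rewrite (inj_eq (@increasing_inj _ _ g)) eq_sym.
have [a Ha] : exists a, forall b, val g a != val f b.
  apply/not_existsP => K; move/eqP: fg; apply; apply: increasing_image_inj => a.
  apply/not_existsP => K'; apply: (K a) => b; apply/eqP => E; exact: (K' b).
rewrite /minor (expand_det_row _ a) big1// => b _.
by rewrite !mxE eqxx /= eq_sym (negbTE (Ha b)) mul0r.
Qed.

(** The difference of the two sides is alternating and vanishes on increasing tuples of basis
    vectors. *)
Lemma alternating_expand k m (T : ('I_k -> 'rV[R]_m) -> R) :
  multilinear T -> is_alternating T -> forall X,
  T X = \sum_(f : increasing_tuple k m) minor X (val f) * T (fun a => basis_vec (val f a)).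
Proof.
move=> Tm Ta X; apply/eqP; rewrite -subr_eq0; apply/eqP; move: X.
apply: alternating_basis0.
- move=> v i a u u'; rewrite Tm.
  have -> : \sum_(f : increasing_tuple k m) minor (upd v i (a *: u + u')) (val f) *
      T (fun a => basis_vec (val f a)) =
    a * (\sum_(f : increasing_tuple k m) minor (upd v i u) (val f) *
      T (fun a => basis_vec (val f a))) +
    \sum_(f : increasing_tuple k m) minor (upd v i u') (val f) *
      T (fun a => basis_vec (val f a)).
    rewrite mulr_sumr -big_split; apply: eq_bigr => f _.
    by rewrite minor_multilinear mulrDl mulrA.
  by rewrite mulrBr opprD addrACA.
- move=> v i j ij vij; rewrite (Ta _ _ _ ij vij) big1 ?subr0// => f _.
  by rewrite (minor_alternating _ ij vij) mul0r.
- move=> g; rewrite (bigD1 g)//= minor_basis eqxx mul1r big1 ?addr0 ?subrr// => f fg.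
  by rewrite minor_basis (negbTE fg) mul0r.
Qed.

End Alternating.

(** * Maps of exterior powers, studied through their transposes *)

Section ExteriorMaps.
Context {R : realType}.

(** The linear functional on the exterior power that an alternating form [T] induces; a minor as [T]
    reads off a component. Identities for [wedge], [Lambda_map] and [lieL] thus become identities
    between alternating forms. *)
Definition pairing (k m : nat) (T : ('I_k -> 'rV[R]_m) -> R) (p : Lambda R k m) : R :=
  \sum_f p f * T (fun a => basis_vec (val f a)).

Lemma Lambda_mapE k m n (A : 'rV[R]_m -> 'rV[R]_n) (p : Lambda R k m) h :
  Lambda_map A p h = pairing (fun X => minor (fun a => A (X a)) (val h)) p.
Proof.
rewrite /Lambda_map sum_ffunE; apply: eq_bigr => f _.
by rewrite ffunE wedge_image.
Qed.

Lemma pairing_Lambda_map k m n (A : 'rV[R]_m -> 'rV[R]_n) (p : Lambda R k m)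
    (T : ('I_k -> 'rV[R]_n) -> R) :
  multilinear T -> is_alternating T ->
  pairing T (Lambda_map A p) = pairing (fun X => T (fun a => A (X a))) p.
Proof.
move=> Tm Ta; rewrite /pairing.
under eq_bigr do rewrite Lambda_mapE /pairing mulr_suml.
rewrite exchange_big/=; apply: eq_bigr => f _.
rewrite (alternating_expand Tm Ta (fun a => A _)) mulr_sumr.
by apply: eq_bigr => g _; rewrite mulrA.
Qed.

Lemma pairing_wedge k m (Y : seq 'rV[R]_m) (T : ('I_k -> 'rV[R]_m) -> R) :
  multilinear T -> is_alternating T -> pairing T (wedge k Y) = T (fun a => nth 0 Y a).
Proof.
move=> Tm Ta; rewrite (alternating_expand Tm Ta); apply: eq_bigr => f _.
by rewrite wedgeE.
Qed.

Lemma pairing_linear k m (T : ('I_k -> 'rV[R]_m) -> R) a p q :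
  pairing T (a *: p + q) = a * pairing T p + pairing T q.
Proof.
rewrite /pairing mulr_sumr -big_split; apply: eq_bigr => f _.
by rewrite !ffunE mulrDl -mulrA.
Qed.

Lemma pairing_sum k m (T : ('I_k -> 'rV[R]_m) -> R) (I : Type) (s : seq I) (P : pred I)
    (a : I -> R) (q : I -> Lambda R k m) :
  pairing T (\sum_(i <- s | P i) a i *: q i) = \sum_(i <- s | P i) a i * pairing T (q i).
Proof.
elim: s => [|i s IH]; first by rewrite !big_nil /pairing big1// => f _; rewrite ffunE mul0r.
by rewrite !big_cons; case: ifP => // _; rewrite pairing_linear IH.
Qed.

Section LinearMap.
Context {m n : nat} (A : 'rV[R]_m -> 'rV[R]_n).
Hypothesis Al : linear A.

Lemma upd_linear k (X : 'I_k -> 'rV[R]_m) i u :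
  (fun a => A (upd X i u a)) = upd (fun a => A (X a)) i (A u).
Proof. by apply/funext => a; rewrite /upd; case: eqP. Qed.

Lemma multilinear_comp k (T : ('I_k -> 'rV[R]_n) -> R) :
  multilinear T -> multilinear (fun X => T (fun a => A (X a))).
Proof. by move=> Tm v i a u u'; rewrite !upd_linear Al Tm. Qed.

Lemma alternating_comp k (T : ('I_k -> 'rV[R]_n) -> R) :
  is_alternating T -> is_alternating (fun X => T (fun a => A (X a))).
Proof. by move=> Ta v i j ij vij; apply: (Ta _ i j ij); rewrite vij. Qed.

End LinearMap.

Lemma Lambda_map_comp k m n l (A : 'rV[R]_n -> 'rV[R]_l) (B : 'rV[R]_m -> 'rV[R]_n)
    (p : Lambda R k m) : linear A ->
  Lambda_map A (Lambda_map B p) = Lambda_map (fun X => A (B X)) p.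
Proof.
move=> Al; apply/ffunP => h; rewrite Lambda_mapE pairing_Lambda_map.
- by rewrite Lambda_mapE.
- exact: (multilinear_comp Al (minor_multilinear (val h))).
- exact: (alternating_comp A (minor_alternating (val h))).
Qed.

Lemma Lambda_map_id k m (p : Lambda R k m) : Lambda_map (fun X => X) p = p.
Proof.
apply/ffunP => h; rewrite Lambda_mapE /pairing (bigD1 h)//= minor_basis eqxx mulr1.
by rewrite big1 ?addr0// => f fh; rewrite minor_basis eq_sym (negbTE fh) mulr0.
Qed.

Section Contract.
Context {s r n : nat} (sr : (s <= r)%N) (b : ('I_r -> 'rV[R]_n) -> R)
  (S : seq 'rV[R]_n).
Hypotheses (bm : multilinear b) (ba : is_alternating b).

Definition append (X : 'I_s -> 'rV[R]_n) : 'I_r -> 'rV[R]_n :=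
  fun i => nth 0 ([seq X a | a : 'I_s] ++ S) i.

Lemma append_lt X (a : 'I_s) : append X (widen_ord sr a) = X a.
Proof.
rewrite /append nth_cat size_map size_enum_ord /= ltn_ord.
by rewrite nth_ord_image.
Qed.

Lemma append_upd X a u : append (upd X a u) = upd (append X) (widen_ord sr a) u.
Proof.
apply/funext => i; rewrite /upd; case: eqP => [->|ia].
  by rewrite append_lt /upd eqxx.
rewrite /append !nth_cat !size_image !card_ord; case: ifP => // i_s.
rewrite -[i : nat]/(Ordinal i_s : nat) !nth_ord_image /upd; case: eqP => // E.
by case: ia; apply: val_inj; rewrite /= -E.
Qed.

Lemma multilinear_append : multilinear (fun X => b (append X)).
Proof. by move=> v i a u u'; rewrite !append_upd bm. Qed.

Lemma alternating_append : is_alternating (fun X => b (append X)).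
Proof.
move=> v i j ij vij; apply: (ba (i := widen_ord sr i) (j := widen_ord sr j)).
  by apply: contra ij => /eqP/(congr1 val)/= /val_inj ->.
by rewrite !append_lt.
Qed.

End Contract.

Lemma contractE s r n (b : ('I_r -> 'rV[R]_n) -> R) (w : 'I_(r - s) -> 'rV[R]_n)
    (q : Lambda R s n) :
  Defs.contract q b w = pairing (fun X => b (append (codom w) X)) q.
Proof. by []. Qed.

End ExteriorMaps.

(** * The transpose of the map L *)

Section LieDifferential.
Context {R : realType} {m k : nat}.
Variables (br : 'rV[R]_m -> 'rV[R]_m -> 'rV[R]_m) (T : ('I_k.-1 -> 'rV[R]_m) -> R).
Hypotheses (brl : forall y, linear (br^~ y)) (brr : forall x, linear (br x))
  (brxx : forall x, br x x = 0) (Tm : multilinear T) (Ta : is_alternating T).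
Implicit Types X : 'I_k -> 'rV[R]_m.

Definition others (i j : nat) : seq nat :=
  [seq l <- iota 0 k | (l != i) && (l != j)].

Definition bracket_list X (i j : nat) : seq 'rV[R]_m :=
  let s := [seq X a | a : 'I_k] in br s`_i s`_j :: [seq s`_l | l <- others i j].

(* The transpose of [lieL], for a general bracket [br]. *)
Definition lie_differential X : R :=
  \sum_(i < k) \sum_(j < k | (i < j)%N)
     (-1) ^+ (i + j) * T (fun a => nth 0 (bracket_list X i j) a).

Let N X (l : nat) := [seq X a | a : 'I_k]`_l.

Let NE X (a : 'I_k) : N X a = X a. Proof. by rewrite /N nth_ord_image. Qed.

Let N_upd X (a : 'I_k) u (l : nat) : N (upd X a u) l = if l == a then u else N X l.
Proof.
have [lk|kl] := ltnP l k.
  rewrite -[l]/(Ordinal lk : nat) !NE /upd -val_eqE; by case: eqP.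
rewrite /N nth_default ?size_image ?card_ord// nth_default ?size_image ?card_ord//.
by rewrite gtn_eqF// (leq_trans (ltn_ord a)).
Qed.

Let mem_others (i j l : nat) : (l \in others i j) = [&& l != i, l != j & (l < k)%N].
Proof. by rewrite mem_filter mem_iota /= add0n -andbA. Qed.

Let others_uniq i j : uniq (others i j).
Proof. exact/filter_uniq/iota_uniq. Qed.

Lemma size_others (i j : nat) : (i < j)%N -> (j < k)%N -> size (others i j) = k.-2.
Proof.
move=> ij jk; have -> : others i j = rem i (rem j (iota 0 k)).
  rewrite (rem_filter j) ?iota_uniq// (rem_filter i) ?filter_uniq ?iota_uniq//.
  by rewrite -filter_predI; apply: eq_filter => l.
rewrite size_rem; last first.
  by rewrite mem_rem_uniq ?iota_uniq// inE mem_iota/= ltn_eqF//= (ltn_trans ij).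
by rewrite size_rem ?mem_iota// size_iota.
Qed.

Let Z X i j : 'I_k.-1 -> 'rV[R]_m := fun a => nth 0 (bracket_list X i j) a.

(** Each term depends on the argument [a] through one slot [p] of its list: the slot of the bracket
    if [a] is [i] or [j], and otherwise the slot of [a] among the remaining vectors. Multilinearity
    of the sum follows. *)
Let Z_upd X (i j a : 'I_k) : (i < j)%N ->
  exists (p : 'I_k.-1) (lam : 'rV[R]_m -> 'rV[R]_m), linear lam /\
    forall u, Z (upd X a u) i j = upd (Z X i j) p (lam u).
Proof.
move=> ij; have k1 : (0 < k.-1)%N by have := ltn_ord j; lia.
have lin_id : linear (fun u : 'rV[R]_m => u) by [].
have tail u (q : nat) : a = i \/ a = j ->
    [seq N (upd X a u) l | l <- others i j] = [seq N X l | l <- others i j].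
  move=> aij; apply/eq_in_map => l; rewrite mem_others => /and3P[li lj _].
  rewrite N_upd; case: eqP => // la.
  by case: aij => E; move: li lj; rewrite la E eqxx.
have [ai|ai] := eqVneq a i.
  exists (Ordinal k1), (br^~ (N X j)); split; first exact: brl.
  move=> u; apply/funext => -[[|q] qk]; rewrite /upd -val_eqE /= /Z /bracket_list /=.
    rewrite -!/(N _ _) !N_upd ai eqxx.
    by case: eqP => // ji; move: ij; rewrite ji ltnn.
  by rewrite -!/(N _) tail//; left.
have [aj|aj] := eqVneq a j.
  exists (Ordinal k1), (br (N X i)); split; first exact: brr.
  move=> u; apply/funext => -[[|q] qk]; rewrite /upd -val_eqE /= /Z /bracket_list /=.
    rewrite -!/(N _ _) !N_upd aj eqxx.
    by case: eqP => // ji; move: ij; rewrite ji ltnn.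
  by rewrite -!/(N _) tail//; right.
have ain : (a : nat) \in others i j.
  by rewrite mem_others ltn_ord andbT; apply/andP.
have pk : ((index (a : nat) (others i j)).+1 < k.-1)%N.
  have := ain; rewrite -index_mem size_others//; have := ltn_ord j; lia.
exists (Ordinal pk), id; split => // u; apply/funext => -[[|q] qk];
    rewrite /upd -val_eqE /= /Z /bracket_list /=.
  rewrite -!/(N _ _) !N_upd.
  have -> : (i == a :> nat) = false by rewrite eq_sym; exact: negbTE ai.
  by have -> : (j == a :> nat) = false by rewrite eq_sym; exact: negbTE aj.
have qs : (q < size (others i j))%N by rewrite size_others//; have := ltn_ord j; lia.
rewrite !(nth_map 0%N)// -!/(N _ _) N_upd eqSS.
case: eqP => [E|nE].
  by rewrite -E index_uniq// eqxx.
case: eqP => // E; case: nE; rewrite E; exact: nth_index.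
Qed.

Lemma lie_differential_multilinear : multilinear lie_differential.
Proof.
move=> X a t u u'; rewrite /lie_differential mulr_sumr -big_split; apply: eq_bigr => i _.
rewrite mulr_sumr -big_split; apply: eq_bigr => j ij.
have [p [lam [laml E]]] := Z_upd X a ij.
rewrite -!/(Z _ i j) !E laml Tm. by rewrite mulrDr mulrCA.
Qed.

Let others_swap (a j : nat) X : (a.+1 < k)%N -> j != a -> j != a.+1 -> N X a = N X a.+1 ->
  [seq N X l | l <- others a j] = [seq N X l | l <- others a.+1 j].
Proof.
move=> ak ja ja1 E.
have Ek : iota 0 k = iota 0 a ++ [:: a; a.+1] ++ iota a.+2 (k - a.+2).
  have {1}-> : k = (a + (2 + (k - a.+2)))%N by lia.
  by rewrite iotaD iotaD add0n addn2.
rewrite /others Ek !filter_cat !map_cat; congr (_ ++ _).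
  congr map; apply: eq_in_filter => l; rewrite mem_iota add0n => /andP[_ la].
  by rewrite ltn_eqF// [in RHS]ltn_eqF// ltnW.
congr (_ ++ _).
  have h1 : (a == a.+1) = false by rewrite ltn_eqF.
  have h2 : (a.+1 == a) = false by rewrite gtn_eqF.
  have h3 : (a == j) = false by rewrite eq_sym (negbTE ja).
  have h4 : (a.+1 == j) = false by rewrite eq_sym (negbTE ja1).
  by rewrite /= !eqxx h1 h2 h3 h4 /= E.
congr map; apply: eq_in_filter => l; rewrite mem_iota => /andP[la _].
by rewrite gtn_eqF ?(ltnW la)// [in RHS]gtn_eqF.
Qed.

(** For adjacent equal arguments [a], [a'] the term of the pair [(a, a')] is 0 because [br x x = 0].
    Exchanging [a] and [a'] is an involution of the other pairs which, by adjacency, preserves their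
    order and reverses the sign of each term; so their sum equals its own negative. *)
Lemma lie_differential_alternating : is_alternating lie_differential.
Proof.
apply: alternating_adjacent; first exact: lie_differential_multilinear.
move=> X a a' aa' Xaa'.
have NN : N X a = N X a' by rewrite !NE.
pose F (p : 'I_k * 'I_k) := (-1) ^+ (p.1 + p.2) * T (Z X p.1 p.2).
rewrite /lie_differential pair_big_dep /= -/F.
rewrite (eq_bigr F)//.
rewrite (bigD1 (a, a'))/=; last by rewrite aa'.
have k1 : (0 < k.-1)%N by have := ltn_ord a'; rewrite aa'; lia.
have -> : F (a, a') = 0.
  rewrite /F /= (_ : Z X a a' = upd (Z X a a') (Ordinal k1) 0) ?multilinear0 ?mulr0//.
  rewrite -[LHS](upd_id _ (Ordinal k1)); congr upd.
  by rewrite /Z /bracket_list /= -!/(N _ _) NN brxx.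
rewrite add0r; set S := \sum_(_ | _) _.
pose t := tperm a a'.
have aN : a != a' by rewrite -val_eqE /= aa' ltn_eqF.
have tP (p : 'I_k * 'I_k) : ((t p.1 < t p.2)%N && ((t p.1, t p.2) != (a, a'))) =
    ((p.1 < p.2)%N && (p != (a, a'))).
  case: p => i j; rewrite !xpair_eqE /= /t -!val_eqE /=.
  have nat_neq (u w : 'I_k) : u <> w -> (u : nat) <> w by move=> uw /val_inj.
  case: tpermP => [->|->|/nat_neq ia /nat_neq ia'];
  case: tpermP => [->|->|/nat_neq ja /nat_neq ja'] /=; lia.
have Fneg (i j : 'I_k) : (i < j)%N -> (i, j) != (a, a') -> F (t i, t j) = - F (i, j).
  have ak : (a.+1 < k)%N by rewrite -aa'.
  have NN' : N X a = N X a.+1 by rewrite NN aa'.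
  have oC u w : others u w = others w u.
    by apply: eq_filter => l; rewrite andbC.
  have Zl (l : 'I_k) : l != a -> l != a' -> Z X a l = Z X a' l.
    move=> la la'; apply/funext => q; rewrite /Z /bracket_list -!/(N _ _) NN.
    by rewrite (@others_swap a l X) ?aa'//; move: la'; rewrite -val_eqE /= aa'.
  have Zr (l : 'I_k) : l != a -> l != a' -> Z X l a = Z X l a'.
    move=> la la'; apply/funext => q; rewrite /Z /bracket_list -!/(N _ _) NN.
    rewrite (oC l a) (oC l a').
    by rewrite (@others_swap a l X) ?aa'//; move: la'; rewrite -val_eqE /= aa'.
  move=> ij; rewrite xpair_eqE /t /F /=.
  have [ia|ia] := eqVneq i a; first rewrite {}ia in ij *.
    rewrite /= tpermL => ja'; have ja : j != a by rewrite -val_eqE /=; lia.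
    rewrite tpermD 1?eq_sym// Zl// aa' addSn exprS; ring.
  have [ia'|ia'] := eqVneq i a'; first rewrite {}ia' in ij *.
    move=> _; have ja : j != a by rewrite -val_eqE /=; lia.
    have ja' : j != a' by rewrite -val_eqE /=; lia.
    rewrite tpermR tpermD 1?eq_sym// Zl// aa' addSn exprS; ring.
  move=> _; rewrite (@tpermD _ a a' i) 1?eq_sym//.
  have [->|ja] := eqVneq j a.
    by rewrite tpermL Zr// aa' addnS exprS; ring.
  have [->|ja'] := eqVneq j a'.
    by rewrite tpermR Zr// aa' addnS exprS; ring.
  rewrite (@tpermD _ a a' j) 1?eq_sym//.
  (* A pair disjoint from [a], [a'] is fixed by the exchange, and its term is 0: both equal vectors
     occur among the arguments of [T]. *)
  suff -> : T (Z X i j) = 0 by rewrite mulr0 oppr0.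
  have jk := ltn_ord j.
  have ain : (a : nat) \in others i j.
    by rewrite mem_others ltn_ord andbT; apply/andP; split; rewrite eq_sym.
  have ain' : (a' : nat) \in others i j.
    by rewrite mem_others ltn_ord andbT; apply/andP; split; rewrite eq_sym.
  have szs := size_others ij jk.
  have pk : ((index (a : nat) (others i j)).+1 < k.-1)%N.
    by have := ain; rewrite -index_mem szs; lia.
  have pk' : ((index (a' : nat) (others i j)).+1 < k.-1)%N.
    by have := ain'; rewrite -index_mem szs; lia.
  apply: (Ta (i := Ordinal pk) (j := Ordinal pk')).
    rewrite -val_eqE /= eqSS; apply: contraNneq aN => E.
    have /val_inj -> : (a : nat) = a' by rewrite -(nth_index 0%N ain) E nth_index.
    exact: eqxx.
  rewrite /Z /bracket_list /= !(nth_map 0%N) ?index_mem// !nth_index//.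
have S' : S = - S.
  rewrite {1}/S (reindex_inj (h := fun p => (t p.1, t p.2)))/=; last first.
    by move=> [p q] [p' q'] /= [/perm_inj -> /perm_inj ->].
  rewrite /S -sumrN; apply: eq_big => [p|[i j] /=]; first exact: tP.
  by rewrite (tP (i, j)) => /andP[ij ijN]; exact: Fneg.
by have := S'; lra.
Qed.

End LieDifferential.

Lemma Lambda_map_linear (R : realType) k m n (A : 'rV[R]_m -> 'rV[R]_n) :
  linear (@Lambda_map R k m n A).
Proof.
move=> a p q; apply/ffunP => h.
by rewrite !ffunE !Lambda_mapE pairing_linear.
Qed.

(** * The Lie kernel as a module over the group *)

Section LieKernel.
Context {R : realType} {m : nat} (G : lieGroupType R m).
Local Notation br := (@lie_bracket R m G).

Lemma lie_bracketr (X : 'rV[R]_m) : linear (br X).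
Proof.
move=> k Y Y'; rewrite !(lie_bracketC G X) (lie_bracketl G X).
by rewrite opprD scalerN.
Qed.

Lemma lieL_wedge_image k (X : 'I_k -> 'rV[R]_m) h :
  lieL_wedge G k [seq X a | a : 'I_k] h =
  lie_differential br (fun Y => minor Y (val h)) X.
Proof.
rewrite /lieL_wedge /lie_differential sum_ffunE; apply: eq_bigr => i _.
rewrite sum_ffunE; apply: eq_bigr => j _.
by rewrite ffunE wedgeE.
Qed.

Lemma lieLE k (p : Lambda R k m) h :
  lieL G p h = pairing (lie_differential br (fun Y => minor Y (val h))) p.
Proof.
rewrite /lieL sum_ffunE; apply: eq_bigr => f _.
by rewrite ffunE lieL_wedge_image.
Qed.

Lemma lie_differential_mult k (T : ('I_k.-1 -> 'rV[R]_m) -> R) :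
  multilinear T -> is_alternating T ->
  multilinear (lie_differential br T) /\ is_alternating (lie_differential br T).
Proof.
move=> Tm Ta; have l := lie_bracketl G; have r := lie_bracketr.
have xx := lie_bracketxx G.
by split; [exact: lie_differential_multilinear|exact: lie_differential_alternating].
Qed.

Lemma pairing_lieL k (T : ('I_k.-1 -> 'rV[R]_m) -> R) (p : Lambda R k m) :
  multilinear T -> is_alternating T ->
  pairing T (lieL G p) = pairing (lie_differential br T) p.
Proof.
move=> Tm Ta; rewrite /lieL pairing_sum; apply: eq_bigr => f _; congr (_ * _).
rewrite /lieL_wedge /lie_differential.
have -> (q : 'I_k -> Lambda R k.-1 m) : pairing T (\sum_i q i) = \sum_i pairing T (q i).
  have := pairing_sum T (index_enum 'I_k) xpredT (fun=> 1) q.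
  under eq_bigr do rewrite scale1r.
  by move=> ->; under eq_bigr do rewrite mul1r.
apply: eq_bigr => i _; rewrite pairing_sum; apply: eq_bigr => j ij; congr (_ * _).
by rewrite pairing_wedge.
Qed.

Lemma lie_differential_comp k (phi : 'rV[R]_m -> 'rV[R]_m)
    (T : ('I_k.-1 -> 'rV[R]_m) -> R) X :
  linear phi -> (forall x y, phi (br x y) = br (phi x) (phi y)) ->
  lie_differential br T (fun a => phi (X a)) =
  lie_differential br (fun Y => T (fun a => phi (Y a))) X.
Proof.
move=> pl pb.
have phi0 : phi 0 = 0.
  by have := pl (-1) 0 0; rewrite scaler0 addr0 scaleN1r addNr.
rewrite /lie_differential; apply: eq_bigr => i _; apply: eq_bigr => j _.
have N (l : nat) : [seq phi (X a0) | a0 : 'I_k]`_l = phi [seq X a0 | a0 : 'I_k]`_l.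
  have [lk|kl] := ltnP l k.
    by rewrite -[l]/(Ordinal lk : nat) !nth_ord_image.
  by rewrite !nth_default ?size_image ?card_ord// phi0.
have E : bracket_list br (fun a => phi (X a)) i j = map phi (bracket_list br X i j).
  rewrite /bracket_list /= !N pb -map_comp; congr (_ :: _).
  by apply: eq_map => l; exact: N.
congr (_ * T _); apply/funext => a; rewrite E.
have [al|la] := ltnP a (size (bracket_list br X i j)); first by rewrite (nth_map 0).
by rewrite !nth_default ?size_map// phi0.
Qed.

(** Compared component by component, both sides pair [p] with the same form, because
    [lie_differential] commutes with pulling forms back along a homomorphism of brackets. *)
Lemma lieL_Lambda_map k (phi : 'rV[R]_m -> 'rV[R]_m) (p : Lambda R k m) :
  linear phi -> (forall x y, phi (br x y) = br (phi x) (phi y)) ->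
  lieL G (Lambda_map phi p) = Lambda_map phi (lieL G p).
Proof.
move=> pl pb; apply/ffunP => h; rewrite lieLE Lambda_mapE.
have mm := @minor_multilinear R k.-1 m (val h).
have ma := @minor_alternating R k.-1 m (val h).
have [Dm Da] := lie_differential_mult mm ma.
rewrite pairing_Lambda_map// pairing_lieL; last 2 first.
- exact: (multilinear_comp pl mm).
- exact: (alternating_comp phi ma).
by apply: eq_bigr => f _; rewrite lie_differential_comp.
Qed.

Lemma lieL_linear k : linear (@lieL R m G k).
Proof.
move=> a p q; apply/ffunP => h.
by rewrite !ffunE !lieLE pairing_linear.
Qed.

(** [linfun] is known to agree with [lieL] only through a linear structure on it, which
    [lieL_linear] provides. *)
Lemma mem_lie_kernel k (p : Lambda R k m) : (p \in lie_kernel G k) = (lieL G p == 0).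
Proof.
pose LM := GRing.isLinear.Build _ _ _ _ _ (@lieL_linear k).
pose L : {linear Lambda R k m -> Lambda R k.-1 m} := HB.pack (@lieL R m G k) LM.
by rewrite /lie_kernel memv_ker (lfunE L).
Qed.

Lemma vsval_Ad_kernel k (g : G) (p : subvs_of (lie_kernel G k)) :
  vsval (Ad_kernel g p) = Lambda_map (Ad g) (vsval p).
Proof.
rewrite /Ad_kernel vsprojK// mem_lie_kernel lieL_Lambda_map.
- have : vsval p \in lie_kernel G k by exact: subvsP.
  rewrite mem_lie_kernel => /eqP ->; apply/eqP/ffunP => h.
  by rewrite Lambda_mapE /pairing big1 ?ffunE// => f _; rewrite ffunE mul0r.
- exact: Ad_linear.
- exact: Ad_bracket.
Qed.

Lemma Ad_kernelM k (g h : G) (p : subvs_of (lie_kernel G k)) :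
  Ad_kernel (g * h)%g p = Ad_kernel g (Ad_kernel h p).
Proof.
apply: val_inj; apply: (etrans (vsval_Ad_kernel (g * h)%g p)).
apply: (etrans _ (esym (vsval_Ad_kernel g (Ad_kernel h p)))).
apply: (etrans _ (congr1 (Lambda_map (Ad g)) (esym (vsval_Ad_kernel h p)))).
apply: (etrans _ (esym (Lambda_map_comp _ _ (Ad_linear g)))).
by congr Lambda_map; apply/funext => X; exact: AdM.
Qed.

Lemma Ad_kernel1 k (p : subvs_of (lie_kernel G k)) : Ad_kernel 1%g p = p.
Proof.
apply: val_inj; apply: (etrans (vsval_Ad_kernel 1%g p)).
have -> : Ad (1%g : G) = fun X => X by apply/funext => X; exact: Ad1.
exact: Lambda_map_id.
Qed.

Lemma Ad_kernel_linear k (g : G) :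
  linear (@Ad_kernel R m G k g).
Proof.
move=> a p q; apply: val_inj; apply: (etrans (vsval_Ad_kernel g _)).
apply: esym; apply: (etrans (linearP vsval a (Ad_kernel g p) (Ad_kernel g q))).
apply: (etrans (congr2 (fun u v => a *: u + v) (vsval_Ad_kernel g p) (vsval_Ad_kernel g q))).
apply: esym; apply: (etrans (congr1 (Lambda_map (Ad g)) (linearP vsval a p q))).
exact: Lambda_map_linear.
Qed.

End LieKernel.

(** * Contraction with multi-vector fields *)

Section MoveArguments.
Context {R : realType} {n r : nat} (b : ('I_r -> 'rV[R]_n) -> R).
Hypotheses (bm : multilinear b) (ba : is_alternating b).

(** With arguments given as a list, moving an argument becomes rearranging a concatenation. *)
Definition on_seq (s : seq 'rV[R]_n) : R := b (fun i => nth 0 s i).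

Lemma on_seq_swap P y z S : ((size P).+1 < r)%N ->
  on_seq (P ++ y :: z :: S) = - on_seq (P ++ z :: y :: S).
Proof.
move=> Pr; have Pr' : (size P < r)%N by rewrite ltnW.
have ij : Ordinal Pr' != Ordinal Pr by rewrite -val_eqE /= ltn_eqF.
have := multilinear_swap bm ij (fun v => @ba v _ _ ij) (fun i => nth 0 (P ++ z :: y :: S) i).
rewrite /on_seq => <-; congr b; apply/funext => l.
case: tpermP => [->|->|] /=.
- by rewrite !nth_cat ltnn ltnNge leqnSn /= subnn subSnn.
- by rewrite !nth_cat ltnn ltnNge leqnSn /= subnn subSnn.
- move=> /eqP; rewrite -val_eqE /= => l1 /eqP; rewrite -val_eqE /= => l2.
  rewrite !nth_cat; case: ltnP => // Pl.
  have -> : (l - size P)%N = (l - size P - 2).+2 by lia.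
  by [].
Qed.

Lemma on_seq_move P Q z S : (size (P ++ Q) < r)%N ->
  on_seq (P ++ Q ++ z :: S) = (-1) ^+ size Q * on_seq (P ++ z :: Q ++ S).
Proof.
elim/last_ind: Q S => [|Q y IH] S; first by rewrite expr0 mul1r.
rewrite size_cat size_rcons addnS => H.
rewrite cat_rcons catA on_seq_swap ?size_cat// -catA IH ?size_cat; last by rewrite ltnW.
by rewrite cat_rcons exprS mulN1r mulNr.
Qed.

Lemma upd_nth (P : seq 'rV[R]_n) y z S (j : 'I_r) : size P = j ->
  upd (fun i : 'I_r => nth 0 (P ++ y :: S) i) j z = (fun i => nth 0 (P ++ z :: S) i).
Proof.
move=> Pj; apply/funext => l; rewrite /upd -val_eqE /= !nth_cat Pj.
case: ltngtP => [lj|jl|->] //; last by rewrite subnn.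
by have -> : (l - j)%N = (l - j).-1.+1 by lia.
Qed.

End MoveArguments.

(** * Expansion of the exterior derivative of an invariant form *)

Section InvariantExpansion.
Context {R : realType} {n s : nat}.
Variables (b : ('I_s.+2 -> 'rV[R]_n) -> R) (X : 'I_s.+1 -> 'rV[R]_n)
  (D : 'I_s.+1 -> 'rV[R]_n -> 'rV[R]_n) (u t : 'rV[R]_n).
Hypotheses (bm : multilinear b) (ba : is_alternating b).

Let xs : seq 'rV[R]_n := [seq X a | a : 'I_s.+1].
Let N (l : nat) : 'rV[R]_n := xs`_l.

Let NE (a : 'I_s.+1) : N a = X a. Proof. by rewrite /N nth_ord_image. Qed.

Let xsE : xs = map N (iota 0 s.+1).
Proof. by rewrite -[LHS](mkseq_nth 0) size_image card_ord. Qed.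

Lemma rem_iota (i k : nat) : (i < k)%N -> rem i (iota 0 k) = iota 0 i ++ iota i.+1 (k - i.+1).
Proof.
move=> ik; rewrite remE.
have -> : index i (iota 0 k) = i.
  by have := @index_uniq _ 0%N i (iota 0 k); rewrite size_iota iota_uniq nth_iota// add0n; apply.
by rewrite take_iota drop_iota add0n (minn_idPl (ltnW ik)).
Qed.

Lemma nth_rem_iota (i k j : nat) : (i < k)%N -> (j < k.-1)%N ->
  nth 0%N (rem i (iota 0 k)) j = bump i j.
Proof.
move=> ik jk; rewrite rem_iota// nth_cat size_iota /bump.
have [ji|ij] := ltnP j i; first by rewrite nth_iota.
by rewrite nth_iota; lia.
Qed.

Let K (i : 'I_s.+1) := map N (rem (i : nat) (iota 0 s.+1)).

Let size_K i : size (K i) = s.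
Proof. by rewrite size_map size_rem ?mem_iota//= size_iota. Qed.

Let A1 (i : nat) := map N (iota 0 i).
Let A2 (i : nat) := map N (iota i.+1 (s - i)).

Let KE i : K i = A1 i ++ A2 i.
Proof. by rewrite /K rem_iota// map_cat subSS. Qed.

Let xsE2 (i : 'I_s.+1) : xs = A1 i ++ X i :: A2 i.
Proof.
rewrite xsE -NE -[_ :: _]/(map N ((i : nat) :: iota i.+1 (s - i))).
have -> : (i : nat) :: iota i.+1 (s - i) = iota i (s - i).+1 by [].
rewrite -map_cat; congr map.
have {1}-> : s.+1 = (i + (s - i).+1)%N by have := ltn_ord i; lia.
by rewrite iotaD.
Qed.

(** The arguments that remain when the exterior derivative differentiates along [X i]. In [B i l]
    the vector [X l] among them has been replaced by [D i (X l)] and moved to the front. *)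
Let W (i : 'I_s.+1) : 'I_s.+2 -> 'rV[R]_n := fun j => nth 0 (K i ++ [:: u; t]) j.
Let B (i l : 'I_s.+1) : R :=
  on_seq b (D i (X l) :: [seq N q | q <- @others s.+1 i l] ++ [:: u; t]).

Let term_lift i (j : 'I_s) :
  b (upd (W i) (widen_ord (leqW (leqnSn s)) j) (D i (X (lift i j)))) = (-1) ^+ j * B i (lift i j).
Proof.
have jK : (j < size (K i))%N by rewrite size_K.
have jr : (j < size (rem (i : nat) (iota 0 s.+1)))%N by rewrite -(size_map N).
have E : K i ++ [:: u; t] = take j (K i) ++ nth 0 (K i) j :: drop j.+1 (K i) ++ [:: u; t].
  by rewrite -cat_cons -(drop_nth 0 jK) catA cat_take_drop.
rewrite /W E upd_nth; last by rewrite size_take jK.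
have := on_seq_move bm ba (P := [::]) (Q := take j (K i)) (D i (X (lift i j)))
  (drop j.+1 (K i) ++ [:: u; t]).
rewrite /on_seq /= size_take jK => ->; last first.
  by have := ltn_ord j; lia.
rewrite /B /on_seq; congr (_ * b _); apply/funext => q; congr nth; congr (_ :: _).
rewrite catA; congr (_ ++ _); rewrite /K -map_take -map_drop -map_cat; congr map.
have ji : nth 0%N (rem (i : nat) (iota 0 s.+1)) j = lift i j by rewrite nth_rem_iota.
have ui : uniq (rem (i : nat) (iota 0 s.+1)) by rewrite rem_uniq ?iota_uniq.
have idx : index (lift i j : nat) (rem (i : nat) (iota 0 s.+1)) = j.
  by rewrite -ji index_uniq.
have := remE (lift i j : nat) (rem (i : nat) (iota 0 s.+1)); rewrite idx => <-.
rewrite rem_filter// rem_filter ?iota_uniq// -filter_predI /others.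
by apply: eq_filter => l /=; rewrite andbC.
Qed.

Let app (v : 'rV[R]_n) : 'I_s.+2 -> 'rV[R]_n := fun i => nth 0 (xs ++ [:: v]) i.

Let term_u i (j : 'I_s.+2) : j = s :> nat ->
  b (upd (W i) j (D i u)) =
  (-1) ^+ (s - i) * b (upd (app t) (widen_ord (leqnSn s.+1) i) (D i u)).
Proof.
move=> js; rewrite /W upd_nth ?size_K//.
rewrite /app (xsE2 i) -catA cat_cons upd_nth; last by rewrite size_map size_iota.
rewrite KE -catA.
have := on_seq_move bm ba (P := A1 i) (Q := A2 i) (D i u) [:: t].
rewrite /on_seq size_cat !size_map !size_iota => -> //.
by have := ltn_ord i; lia.
Qed.

Let term_t i (j : 'I_s.+2) : j = s.+1 :> nat ->
  b (upd (W i) j (D i t)) =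
  (-1) ^+ (s - i).+1 * b (upd (app u) (widen_ord (leqnSn s.+1) i) (D i t)).
Proof.
move=> js; rewrite /W -[[:: u; t]]/([:: u] ++ [:: t]) catA upd_nth; last first.
  by rewrite size_cat size_K addn1.
rewrite /app (xsE2 i) -[in RHS]catA cat_cons upd_nth; last by rewrite size_map size_iota.
rewrite KE -!catA.
have := on_seq_move bm ba (P := A1 i) (Q := A2 i ++ [:: u]) (D i t) [::].
rewrite /on_seq !size_cat !size_map !size_iota /= addn1 cats0 -!catA => -> //.
by have := ltn_ord i; lia.
Qed.

(* [X i] is the value of a symmetry field and [D i] its derivative at a point,
   [b] the value of the form there.  By invariance of the form, the left side is
   minus the part of its exterior derivative on [X ++ [:: u; t]] in which one
   differentiates along some [X i]; on the right, [D i (X l) - D l (X i)] is a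
   bracket of fields. *)
Lemma invariant_ext_d_expand :
  \sum_(i < s.+1) (-1) ^+ i * (\sum_(j < s.+2) b (upd (W i) j (D i (W i j)))) =
  (-1) ^+ s * (\sum_i b (upd (app t) (widen_ord (leqnSn s.+1) i) (D i u)) -
               \sum_i b (upd (app u) (widen_ord (leqnSn s.+1) i) (D i t))) -
  \sum_(i < s.+1) \sum_(l < s.+1 | (i < l)%N) (-1) ^+ (i + l) *
     on_seq b ((D i (X l) - D l (X i)) :: [seq N q | q <- @others s.+1 i l] ++ [:: u; t]).
Proof.
have Wlt i (j : 'I_s) : W i (widen_ord (leqW (leqnSn s)) j) = X (lift i j).
  rewrite /W nth_cat size_K /= ltn_ord /K (nth_map 0%N); last first.
    by rewrite size_rem ?mem_iota ?size_iota//= add0n.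
  by rewrite nth_rem_iota// -[bump i j]/(lift i j : nat) NE.
have inner i : \sum_(j < s.+2) b (upd (W i) j (D i (W i j))) =
    \sum_(j < s) (-1) ^+ j * B i (lift i j) +
    ((-1) ^+ (s - i) * b (upd (app t) (widen_ord (leqnSn s.+1) i) (D i u)) +
     (-1) ^+ (s - i).+1 * b (upd (app u) (widen_ord (leqnSn s.+1) i) (D i t))).
  rewrite [LHS]big_ord_recr big_ord_recr /= -addrA; congr (_ + (_ + _)).
  - apply: eq_bigr => j _; rewrite -term_lift -Wlt.
    by have -> : widen_ord (leqnSn s.+1) (widen_ord (leqnSn s) j) =
      widen_ord (leqW (leqnSn s)) j by apply: val_inj.
  - have -> : W i (widen_ord (leqnSn s.+1) ord_max) = u.
      by rewrite /W nth_cat size_K /= ltnn subnn.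
    exact: term_u.
  - have -> : W i ord_max = t.
      by rewrite /W nth_cat size_K /= ltnNge leqnSn subSnn.
    exact: term_t.
have others_sym i l : @others s.+1 i l = @others s.+1 l i.
  by rewrite /others; apply: eq_filter => q; rewrite andbC.
under eq_bigr => i _ do rewrite inner mulrDr mulrDr.
have sgn (i : 'I_s.+1) : (-1) ^+ i * (-1) ^+ (s - i) = (-1) ^+ s :> R.
  by rewrite -exprD subnKC// -ltnS.
rewrite big_split /= addrC; congr (_ + _).
  rewrite mulrBr !mulr_sumr -sumrB; apply: eq_bigr => i _.
  by rewrite !mulrA sgn [(-1) ^+ (s - i).+1]exprS mulN1r mulrN sgn mulNr.
have lifts (i : 'I_s.+1) (F : 'I_s.+1 -> R) : \sum_(j < s) F (lift i j) = \sum_(l | l != i) F l.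
  apply: (addrI (F i)).
  have <- : \sum_l F l = F i + \sum_(l | l != i) F l by rewrite (bigD1 i).
  by rewrite [RHS](bigD1_ord i).
pose E (i l : 'I_s.+1) : R := (-1) ^+ (i + l) * B i l.
(* Position [j] of the list without [X i] holds [X l] with [l = lift i j], which is [j] before [i]
   and [j + 1] from there on; hence the opposite signs of the two halves. Renaming indices in one
   half then produces [B i l - B l i], a bracket term. *)
have step (i : 'I_s.+1) : (-1) ^+ i * \sum_(j < s) (-1) ^+ j * B i (lift i j) =
    \sum_(l < s.+1 | (l < i)%N) E i l - \sum_(l < s.+1 | (i < l)%N) E i l.
  pose F (l : 'I_s.+1) : R := (if (i < l)%N then -1 else 1) * E i l.
  transitivity (\sum_(j < s) F (lift i j)).
    rewrite mulr_sumr; apply: eq_bigr => j _; rewrite /F /E mulrA -exprD.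
    rewrite /= /bump; case: (leqP i j) => ij; last by rewrite ltnNge (ltnW ij) mul1r.
    by rewrite ltnS ij addnCA add1n exprS !mulNr !mulrN !mul1r opprK.
  rewrite lifts (bigID (fun l : 'I_s.+1 => (i < l)%N)) /= addrC; congr (_ + _).
    apply: eq_big => l; first by rewrite -val_eqE /=; lia.
    by rewrite /F => /andP[_ /negbTE->]; rewrite mul1r.
  rewrite -sumrN; apply: eq_big => l; first by rewrite -val_eqE /=; lia.
  by rewrite /F => /andP[_ ->]; rewrite mulN1r.
under eq_bigr => i _ do rewrite step.
rewrite sumrB (exchange_big_dep predT)//= -sumrB -sumrN.
apply: eq_bigr => i _; rewrite -sumrB -sumrN; apply: eq_bigr => l il.
rewrite /E addnC -mulrBr -mulrN; congr (_ * _); rewrite /B others_sym.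
set S := _ ++ _; have hd z : on_seq b (z :: S) = b (upd (fun j => nth 0 (0 :: S) j) ord0 z).
  by rewrite (@upd_nth _ _ _ [::]).
rewrite !hd [D i _ - _]addrC -[- D l _]scaleN1r bm mulN1r opprD opprK//.
Qed.

End InvariantExpansion.

Section AppendOne.
Context {R : realType} {n s : nat}.
Implicit Types (X : 'I_s -> 'rV[R]_n) (v : 'rV[R]_n).

Lemma append_max X v : append [:: v] X (@ord_max s) = v.
Proof. by rewrite /append nth_cat size_image card_ord ltnn subnn. Qed.

Lemma append_updr X v u : append [:: v] X = upd (append [:: u] X) (@ord_max s) v.
Proof.
apply/funext => i; rewrite /upd; case: eqP => [->|im]; first exact: append_max.
have lt : (i < s)%N by have := ltn_ord i; move/eqP: im; rewrite -val_eqE /=; lia.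
by rewrite /append !nth_cat size_image card_ord lt.
Qed.

End AppendOne.

Lemma image_nth (R : realType) (n k : nat) (S : Type) (F : 'rV[R]_n -> S) (Z : seq 'rV[R]_n) :
  size Z = k -> [seq F (nth 0 Z a) | a : 'I_k] = map F Z.
Proof.
move=> Zk; apply: (@eq_from_nth _ (F 0)); first by rewrite size_image card_ord size_map.
rewrite size_image card_ord => i ik; rewrite (nth_map 0) ?Zk//.
by rewrite -[i]/(nat_of_ord (Ordinal ik)) nth_ord_image.
Qed.

(** * Closedness of the contraction with elements of the Lie kernel *)

Section MultiContract.
Context {R : realType} {m n s : nat} (G : lieGroupType R m) (M : manifoldType R n).
Variables (alpha : diff_form M s.+2) (act : G -> M -> M).
Hypothesis hact : smooth_action act.
Local Notation fund := (fundamental act).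

Let am x : multilinear (alpha x).
Proof. by move=> v i a u u'; exact: form_multilinear. Qed.

Let aa x : is_alternating (alpha x).
Proof. by move=> v i j; exact: form_alternating. Qed.

(** The 1-form [p _| alpha] as a pairing on the Lie algebra side, with fundamental fields
    substituted in [alpha]. With the degree written [s.+2], exactly one slot is left for [v]. *)
Definition multi_contract (p : Lambda R s.+1 m) (x : M) (v : 'rV[R]_n) : R :=
  pairing (fun Y => alpha x (append [:: v] (fun a => fund (Y a) x))) p.

Lemma contract_multivector (p : Lambda R s.+1 m) x v :
  Defs.contract (multivector act p x) (alpha x) (fun _ : 'I_(s.+2 - s.+2.-1) => v) =
  multi_contract p x v.
Proof.
rewrite contractE; have -> : codom (fun _ : 'I_(s.+2 - s.+2.-1) => v) = [:: v].
  rewrite /codom /image_mem; have : size (enum 'I_(s.+2 - s.+2.-1)) = 1%N.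
    by rewrite size_enum_ord subSnn.
  by case: (enum _) => [//|a [|//]].
have sr : (s.+1 <= s.+2)%N by [].
rewrite /multivector pairing_Lambda_map //.
  exact: (multilinear_append sr [:: v] (am x)).
exact: (alternating_append sr [:: v] (aa x)).
Qed.

Lemma multi_contract_linearr p x : linear (multi_contract p x : _ -> R^o).
Proof.
move=> k u v; rewrite /multi_contract /pairing scaler_sumr -big_split /=.
apply: eq_bigr => f _; rewrite (append_updr _ _ 0) am.
by rewrite -!append_updr mulrDr mulrCA.
Qed.

Lemma multi_contract_linearl x v : linear (fun p => multi_contract p x v : R^o).
Proof. by move=> k p q; exact: pairing_linear. Qed.

Let beta p (x : M) (v : 'I_1 -> 'rV[R]_n) : R := multi_contract p x (v ord0).

Let beta_multilinear p x v i a u u' :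
  beta p x (upd v i (a *: u + u')) = a * beta p x (upd v i u) + beta p x (upd v i u').
Proof. by rewrite (ord1 i) /beta /upd eqxx; exact: multi_contract_linearr. Qed.

Let beta_alternating p x (v : 'I_1 -> 'rV[R]_n) i j : i != j -> v i = v j -> beta p x v = 0.
Proof. by rewrite !ord1 eqxx. Qed.

(** In one chart the fundamental fields become the smooth fields [act_field], so [alpha] is
    evaluated on smoothly moving arguments and [Ck_multilinear] applies. *)
Let betaE p (z : M) v y : ccod (chart_at z) y ->
  form_loc (beta p) (chart_at z) y v =
  \sum_f p f *: (form_loc alpha (chart_at z) y
    (fun j => append [:: v ord0] (fun a => act_field act z (basis_vec (val f a)) y) j) : R^o).
Proof.
move=> cy; rewrite /form_loc /beta /multi_contract /pairing; apply: eq_bigr => f _.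
congr (_ * alpha _ _); apply/funext => j; rewrite /append !nth_cat !size_image card_ord.
case: ltnP => js.
  by rewrite -[j : nat]/(Ordinal js : nat) !nth_ord_image (fundamental_tvec hact).
by have -> : (j - s.+1)%N = 0%N by have := ltn_ord j; lia.
Qed.

Let beta_smooth p (z : M) (v : 'I_1 -> 'rV[R]_n) :
  smooth_on (ccod (chart_at z)) (fun y => form_loc (beta p) (chart_at z) y v : R^o).
Proof.
move=> k; have Uo := @open_ccod _ _ _ (chart_at z).
apply: (Ck_ext Uo (fun y cy => esym (betaE p v cy))).
apply: (@Ck_sum _ _ R^o k _ _ _ _ (fun f y => (p f : R^o) *: (form_loc alpha (chart_at z) y
    (fun j => append [:: v ord0] (fun a => act_field act z (basis_vec (val f a)) y) j) : R^o)) Uo).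
move=> f _.
apply: (@Ck_scale _ _ R^o k _ (fun=> p f : R^o) _ Uo); first exact: Ck_cst.
apply: (@Ck_multilinear _ _ _ _ (fun y => form_loc alpha (chart_at z) y)
  (fun j y => append [:: v ord0] (fun a => act_field act z (basis_vec (val f a)) y) j) _ k _ Uo).
- by move=> y; exact: form_loc_multilinear.
- move=> j; have [js|js] := ltnP j s.+1.
    pose i := Ordinal js; have -> : j = widen_ord (leqnSn _) i by apply: val_inj.
    under eq_fun do rewrite append_lt.
    exact: (act_field_smooth hact).
  have -> : j = ord_max by apply/val_inj => /=; have := ltn_ord j; lia.
  under eq_fun do rewrite append_max.
  exact: Ck_cst.
- by move=> u; exact: form_smooth.
Qed.

Definition multi_contract_form p : diff_form M 1 :=
  DiffForm (beta_multilinear p) (@beta_alternating p) (beta_smooth p).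

Section AtPoint.
Variable x : M.
Local Notation c := (chart_at x).
Local Notation y0 := (chart_at x x).
Implicit Types Y : 'I_s.+1 -> 'rV[R]_m.

Let X Y (a : 'I_s.+1) := fund (Y a) x.
Let D Y (a : 'I_s.+1) (v : 'rV[R]_n) : 'rV[R]_n := 'd (act_field act x (Y a)) y0 v.
(** The derivative along [u] of [alpha (X_0, ..., X_s, t)] by the product rule, where [t] is
    constant in the chart. *)
Let E Y (u t : 'rV[R]_n) : R :=
  'd (fun y => form_loc alpha c y (append [:: t] (X Y)) : R^o) y0 u +
  \sum_a alpha x (upd (append [:: t] (X Y)) (widen_ord (leqnSn s.+1) a) (D Y a u)).

Let multi_contract_diff p v u :
  'd (fun y => form_loc (multi_contract_form p) c y v : R^o) y0 u =
  pairing (fun Y => E Y u (v ord0)) p.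
Proof.
pose w Y (j : 'I_s.+2) y := append [:: v ord0] (fun a => act_field act x (Y a) y) j : 'rV[R]_n.
have w0 Y : w Y ^~ y0 = append [:: v ord0] (X Y).
  by rewrite /w; congr append; apply/funext => a; rewrite /X fundamental_center.
have H Y : is_diff y0 (fun y => form_loc alpha c y (w Y ^~ y) : R^o) (fun u => E Y u (v ord0)).
  have wd j : is_diff y0 (w Y j) (fun u => append [:: 0] (fun a => D Y a u) j).
    have [js|js] := ltnP j s.+1.
      pose i := Ordinal js; have -> : j = widen_ord (leqnSn _) i by apply: val_inj.
      rewrite /w; under eq_fun do rewrite append_lt.
      under [X in is_diff _ _ X]eq_fun do rewrite append_lt.
      apply: is_diffP; have [H _] := act_field_smooth hact x (Y i) 1%N.
      exact/H/ccod_cmap/chart_atP.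
    have -> : j = ord_max by apply/val_inj => /=; have := ltn_ord j; lia.
    rewrite /w; under eq_fun do rewrite append_max.
    under [X in is_diff _ _ X]eq_fun do rewrite append_max.
    exact: is_diff_const.
  have lm y : multilinear (form_loc alpha c y) by exact: form_loc_multilinear.
  have ld z : differentiable (fun y => form_loc alpha c y z : R^o) y0.
    exact/form_loc_diff/ccod_cmap/chart_atP.
  apply: (is_diff_eq (is_diff_multilinear lm wd ld)); apply/funext => z.
  rewrite w0 /E; congr (_ + _); rewrite big_ord_recr /= append_max.
  rewrite multilinear0 ?addr0//; apply: eq_bigr => a _.
  rewrite form_loc_center append_lt; congr (alpha x (upd _ _ _)).
have K : is_diff y0 (fun y => \sum_f p f *: (form_loc alpha c y
    (w (fun a => basis_vec (val f a)) ^~ y) : R^o))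
    (fun u => \sum_f p f *: (E (fun a => basis_vec (val f a)) u (v ord0) : R^o)).
  apply: is_diff_sum => f _; exact: (@is_diffZ _ _ _ _ _ (p f) _ (H _)).
have B : is_diff y0 (fun y => form_loc (multi_contract_form p) c y v : R^o)
    (fun u => \sum_f p f *: (E (fun a => basis_vec (val f a)) u (v ord0) : R^o)).
  apply: (near_is_diff _ K).
  apply: filterS (near_ccod (ccod_cmap (chart_atP x))) => y cy.
  by rewrite betaE.
by rewrite (is_diff_val _ B).
Qed.

Let T u t (Z : 'I_s -> 'rV[R]_m) : R :=
  alpha x (append [:: u; t] (fun a => fund (Z a) x)).

(** Evaluate [d alpha = 0] on the fundamental fields followed by [u] and [t]. The last two terms
    supply the derivatives of [alpha] along [u] and [t]. In the others, [lie_derivative] replaces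
    the derivative along a fundamental field, and [invariant_ext_d_expand] yields the remaining
    terms of [E] and brackets of fields, which [act_field_bracket] identifies as fundamental
    fields. *)
Let multi_contract_lie Y u t : closed_form alpha ->
  (forall g, preserves_form (act g) alpha) ->
  E Y u t - E Y t u = (-1) ^+ s * @lie_differential R m s.+1 (@lie_bracket R m G) (T u t) Y.
Proof.
move=> ac ap; set L := lie_differential _ _ _.
pose V : 'I_s.+3 -> 'rV[R]_n := append [:: u; t] (X Y).
(* Sign bookkeeping for the final line: [a] and [b] are the derivatives of [alpha] along [u] and
   [t], [st] and [su] the sums in which the fields are differentiated along [u] and [t], and [l] is
   the bracket sum. *)
have alg (a b st su l : R) : - ((-1) ^+ s * (st - su) - l) +
    (-1) ^+ s.+1 * a + (-1) ^+ s.+2 * b = 0 -> a + st - (b + su) = (-1) ^+ s * l.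
  rewrite !exprS !mulN1r opprK; have : (-1) ^+ s * (-1) ^+ s = 1 :> R.
    by rewrite -exprMn mulN1r opprK expr1n.
  move: ((-1) ^+ s) => e ee H; have -> : l = e * (a + st - (b + su)) by lra.
  by rewrite mulrA ee mul1r.
pose xs := [seq X Y a | a : 'I_s.+1].
pose W (i : 'I_s.+1) : 'I_s.+2 -> 'rV[R]_n :=
  fun j => nth 0 ([seq xs`_l | l <- rem (i : nat) (iota 0 s.+1)] ++ [:: u; t]) j.
have Vx (i : 'I_s.+1) : V (widen_ord (leqnSn s.+2) (widen_ord (leqnSn s.+1) i)) = X Y i.
  rewrite /V; have -> : widen_ord (leqnSn s.+2) (widen_ord (leqnSn s.+1) i) =
    widen_ord (leqW (leqnSn s.+1)) i by apply: val_inj.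
  exact: append_lt.
have VW (i : 'I_s.+1) :
    (fun j => V (lift (widen_ord (leqnSn s.+2) (widen_ord (leqnSn s.+1) i)) j)) = W i.
  apply/funext => j; have sr : size (rem (i : nat) (iota 0 s.+1)) = s.
    by rewrite size_rem ?size_iota// mem_iota /= add0n ltn_ord.
  rewrite /V /append /W !nth_cat size_map sr.
  rewrite !size_image card_ord -[nat_of_ord (lift _ _)]/(bump i j) /bump.
  have [js|sj] := ltnP j s.
    rewrite (nth_map 0%N); last by rewrite sr.
    rewrite nth_rem_iota// /bump; have -> //: ((i <= j) + j < s.+1)%N by lia.
  have -> : (i <= j)%N by have := ltn_ord i; lia.
  by rewrite add1n ltnS ltnNge sj subSS.
have Vu : (fun j => V (lift (widen_ord (leqnSn s.+2) ord_max) j)) = append [:: t] (X Y).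
  apply/funext => j; rewrite /V /append !nth_cat size_image card_ord /= /bump.
  have [js|sj] := ltnP j s.+1; first by rewrite add0n js.
  rewrite add1n ltnNge leqW//=.
  by have -> : (j.+1 - s.+1)%N = (j - s.+1).+1 by lia.
have Vt : (fun j => V (lift ord_max j)) = append [:: u] (X Y).
  apply/funext => j; rewrite /V /append !nth_cat size_image card_ord /= /bump.
  have -> : (s.+2 <= j)%N = false by have := ltn_ord j; lia.
  rewrite add0n; case: ltnP => // sj.
  by have -> : (j - s.+1 = 0)%N by have := ltn_ord j; lia.
have Vu0 : V (widen_ord (leqnSn s.+2) ord_max) = u.
  by rewrite /V /append nth_cat size_image card_ord /= ltnn subnn.
have Vt0 : V ord_max = t.
  by rewrite /V /append nth_cat size_image card_ord /= ltnNge leqnSn subSnn.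
have S1 (i : 'I_s.+1) : 'd (fun y => form_loc alpha c y (W i) : R^o) y0 (X Y i) =
    - \sum_(j < s.+2) alpha x (upd (W i) j (D Y i (W i j))).
  by apply/eqP; rewrite -addr_eq0; apply/eqP; exact: (lie_derivative hact ap).
have C := invariant_ext_d_expand (X Y) (D Y) u t (am x) (aa x).
have {}C : \sum_(i < s.+1) (-1) ^+ i * (\sum_(j < s.+2) alpha x (upd (W i) j (D Y i (W i j)))) =
    (-1) ^+ s * (\sum_i alpha x (upd (append [:: t] (X Y)) (widen_ord (leqnSn s.+1) i) (D Y i u)) -
     \sum_i alpha x (upd (append [:: u] (X Y)) (widen_ord (leqnSn s.+1) i) (D Y i t))) - L.
  rewrite [LHS]C; congr (_ - _).
  apply: eq_bigr => i _; apply: eq_bigr => l il; congr (_ * _).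
  rewrite /T /on_seq; congr (alpha x _); apply/funext => j; congr nth.
  rewrite -cat_cons; congr (_ ++ _).
  rewrite (image_nth (fun Z => fund Z x) (k := s.+1.-1)); last first.
    by rewrite /= size_map size_others//; have := ltn_ord l; lia.
  rewrite /bracket_list map_cons !nth_ord_image -map_comp; congr cons.
    rewrite /D /X !(fundamental_center hact); exact: act_field_bracket.
  apply/eq_in_map => q; rewrite mem_filter mem_iota add0n => /andP[_ qs] /=.
  by rewrite -[q]/(nat_of_ord (Ordinal qs)) !nth_ord_image.
have := ac x V; rewrite /ext_d big_ord_recr big_ord_recr /=.
rewrite Vu Vt Vu0 Vt0.
under eq_bigr => i _ do rewrite VW Vx S1 mulrN.
rewrite sumrN C; exact: alg.
Qed.

Lemma multi_contract_closed_at p v : closed_form alpha ->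
  (forall g, preserves_form (act g) alpha) -> lieL G p = 0 ->
  ext_d (multi_contract_form p) x v = 0.
Proof.
move=> ac ap Lp; rewrite /ext_d big_ord_recr big_ord_recr big_ord0 /= add0r.
rewrite expr0 mul1r expr1 mulN1r !multi_contract_diff.
set u := v (widen_ord _ _); set t := v ord_max.
have -> : v (lift (widen_ord (leqnSn 1) ord_max) ord0) = t by congr v; apply: val_inj.
have -> : v (lift ord_max ord0) = u by congr v; apply: val_inj.
(* Transposing [lie_differential] moves the brackets from the form to [p], where they make up
   [L p]. *)
transitivity ((-1) ^+ s * pairing (fun Z : 'I_s.+1.-1 -> 'rV[R]_m =>
    alpha x (append [:: u; t] (fun a => fund (Z a) x))) (lieL G p)).
  rewrite pairing_lieL.
  - rewrite /pairing mulr_sumr -sumrB; apply: eq_bigr => f _.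
    by rewrite -mulrBr multi_contract_lie// mulrCA.
  - exact: (multilinear_comp (fundamental_linear hact x)
      (multilinear_append (leqW (leqnSn s)) [:: u; t] (am x))).
  - exact: (@alternating_comp _ _ _ (fun X => fund X x) _ _
      (alternating_append (leqW (leqnSn s)) [:: u; t] (aa x))).
by rewrite Lp /pairing big1 ?mulr0// => f _; rewrite ffunE mul0r.
Qed.

End AtPoint.

End MultiContract.

(** * Bounded cocycles *)

Section BoundedCocycle.
Context {R : realType}.

Lemma le_geometric (x y C : R) : (forall k, x <= y + C / 2 ^+ k) -> x <= y.
Proof.
move=> H; rewrite leNgt; apply/negP => yx.
have C0 : 0 < C by have := H 0%N; rewrite expr0 divr1; lra.
pose k := Num.bound (C / (x - y)).
have /archi_boundP : 0 <= C / (x - y) by rewrite divr_ge0 ?ltW// subr_gt0.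
rewrite -/k => Ck; have k2 : k%:R < 2 ^+ k :> R by rewrite -natrX ltr_nat ltn_expl.
have := lt_trans Ck k2; rewrite ltr_pdivrMr ?subr_gt0// -ltr_pdivrMl ?exprn_gt0// => K.
by have := H k; rewrite mulrC; lra.
Qed.

Lemma mulmx_bound d p (A : 'M[R]_(d, p)) :
  exists2 c, 0 <= c & forall w : 'rV[R]_d, `|w *m A| <= c * `|w|.
Proof.
exists (\sum_i \sum_j `|A i j|) => [|w].
  by apply: sumr_ge0 => i _; exact: sumr_ge0.
apply: rV_norm_le => [|j].
  by rewrite mulr_ge0// sumr_ge0// => i _; exact: sumr_ge0.
rewrite mxE (le_trans (ler_norm_sum _ _ _))// mulr_suml ler_sum// => i _.
rewrite normrM mulrC ler_pM ?rV_coord_le//.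
by rewrite (bigD1 j)//= lerDl sumr_ge0.
Qed.

(** The norm of a row is a maximum of coordinates and not strictly convex; the Euclidean square has
    the parallelogram law, on which uniqueness of the minimum rests. *)
Definition sqnorm d (w : 'rV[R]_d) : R := \sum_i w 0 i ^+ 2.

Lemma sqnorm_ge0 d (w : 'rV[R]_d) : 0 <= sqnorm w.
Proof. by apply: sumr_ge0 => i _; exact: sqr_ge0. Qed.

Lemma norm_le_sqnorm d (w : 'rV[R]_d) : `|w| ^+ 2 <= sqnorm w.
Proof.
rewrite -[leRHS]sqr_sqrtr ?sqnorm_ge0// ler_sqr ?nnegrE ?sqrtr_ge0//.
apply: rV_norm_le => [|i]; rewrite ?sqrtr_ge0// -sqrtr_sqr ler_wsqrtr//.
by rewrite /sqnorm (bigD1 i)//= lerDl sumr_ge0// => j _; exact: sqr_ge0.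
Qed.

Lemma sqnorm_le_norm d (w : 'rV[R]_d) : sqnorm w <= d%:R * `|w| ^+ 2.
Proof.
have -> : d%:R * `|w| ^+ 2 = \sum_(i < d) `|w| ^+ 2 by rewrite sumr_const card_ord mulr_natl.
apply: ler_sum => i _; rewrite -real_normK ?num_real//.
by apply: lerXn2r; rewrite ?nnegrE ?rV_coord_le// normr_ge0.
Qed.

Lemma sqnorm_parallelogram d (a b : 'rV[R]_d) :
  sqnorm (2^-1 *: (a + b)) =
  2^-1 * sqnorm a + 2^-1 * sqnorm b - 4^-1 * sqnorm (a - b).
Proof.
rewrite /sqnorm !mulr_sumr -big_split -sumrB; apply: eq_bigr => i _ /=.
by rewrite !mxE; field.
Qed.

(** In each coordinate the right side minus the left is [t^-1 (t b - (a - b))^2]. *)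
Lemma sqnorm_young d (a b : 'rV[R]_d) (t : R) : 0 < t ->
  sqnorm a <= (1 + t) * sqnorm b + (1 + t^-1) * sqnorm (a - b).
Proof.
move=> t0; rewrite /sqnorm !mulr_sumr -big_split ler_sum// => i _ /=.
rewrite !mxE; set x := a 0 i; set y := b 0 i.
have := sqr_ge0 (t * y - (x - y)); have t1 : t * t^-1 = 1 by rewrite divff ?gt_eqF.
have : 0 <= t^-1 by rewrite invr_ge0 ltW.
rewrite -subr_ge0 => T Q; have -> : (1 + t) * y ^+ 2 + (1 + t^-1) * (x - y) ^+ 2 - x ^+ 2 =
  t^-1 * (t * y - (x - y)) ^+ 2 by field; rewrite gt_eqF.
by rewrite mulr_ge0//; lra.
Qed.

(** Choose finitely many members of largest rank; one more row cannot raise the rank, so it already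
    lies in their span. *)
Lemma finite_row_span (I : Type) d (s : I -> 'rV[R]_d) :
  exists N (h : 'I_N -> I), forall g, (s g <= \matrix_i s (h i))%MS.
Proof.
pose P k := `[< exists N (h : 'I_N -> I), \rank (\matrix_i s (h i)) = k >].
have P0 : exists k, P k.
  have h0 : 'I_0 -> I by case.
  by exists (\rank (\matrix_i s (h0 i))); apply/asboolP; exists 0%N, h0.
have Pd k : P k -> (k <= d)%N by move=> /asboolP[N [h <-]]; exact: rank_leq_col.
case: (ex_maxnP P0 Pd) => k /asboolP[N [h hk]] kmax.
exists N, h => g; set A := \matrix_i _.
pose h' (i : 'I_(N + 1)) := match fintype.split i with inl j => h j | inr _ => g end.
have E : \matrix_i s (h' i) = col_mx A (s g).
  apply/row_matrixP => i; rewrite rowK /h'; case: (fintype.splitP i) => j ij.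
  - have -> : i = lshift 1 j by exact: val_inj.
    by rewrite rowKu rowK.
  - have -> : i = rshift N j by exact: val_inj.
    by rewrite rowKd ord1 row_id.
have le : (\rank (col_mx A (s g)) <= k)%N.
  by rewrite -E; apply: kmax; apply/asboolP; exists (N + 1)%N, h'.
have sub : (A <= col_mx A (s g))%MS by rewrite -addsmxE addsmxSl.
have [_ /esym] := mxrank_leqif_sup sub.
rewrite eqn_leq mxrankS//= hk le => H.
by apply: submx_trans H; rewrite -addsmxE addsmxSr.
Qed.

(** The matrices [L g] need not be bounded in [g], but on the span [W] of the cocycle they are,
    since [s h *m L g] is a difference of two bounded values. Applied to [g^-1], this bounds [|w|]
    by a multiple of [|w *m L g|] uniformly in [g], which makes the supremum of the squared norms
    uniformly convex on [W]. *)
Lemma bounded_cocycle (G : groupType) d (L : G -> 'M[R]_d) (s : G -> 'rV[R]_d) (C : R) :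
  (forall g h, L (g * h)%g = L h *m L g) -> L 1%g = 1%:M ->
  (forall g h, s h *m L g = s (g * h)%g - s g) -> (forall g, `|s g| <= C) ->
  exists xi : 'rV[R]_d, forall g, xi *m L g + s g = xi.
Proof.
move=> LM L1 Ls sC; have [N [h sW]] := finite_row_span s.
set A := \matrix_i s (h i) in sW; pose W (w : 'rV[R]_d) := (w <= A)%MS.
pose T g w := w *m L g + s g.
have C0 : 0 <= C by exact: le_trans (sC 1%g).
have LE g (w : 'rV[R]_d) : W w ->
    w *m L g = \sum_i (w *m pinvmx A) 0 i *: (s (g * h i)%g - s g).
  move=> Ww; rewrite -{1}(mulmxKpV Ww) -[LHS]mulmxA mulmx_sum_row; apply: eq_bigr => i _.
  by rewrite row_mul rowK Ls.
have LW g w : W w -> W (w *m L g).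
  move=> Ww; rewrite /W LE// summx_sub// => i _; rewrite scalemx_sub// addmx_sub//.
  by rewrite eqmx_opp.
have [B B0 LB] : exists2 B, 0 <= B & forall g w, W w -> `|w *m L g| <= B * `|w|.
  have [c c0 cP] := mulmx_bound (pinvmx A); exists (N%:R * (c * (C + C))).
    by rewrite !mulr_ge0// addr_ge0.
  move=> g w Ww; rewrite LE// (le_trans (ler_norm_sum _ _ _))//.
  have -> : N%:R * (c * (C + C)) * `|w| = \sum_(i < N) (c * `|w|) * (C + C).
    by rewrite sumr_const card_ord -mulr_natl; ring.
  apply: ler_sum => i _; rewrite normrZ ler_pM//.
    exact: le_trans (rV_coord_le _ i) (cP w).
  by rewrite (le_trans (ler_normB _ _))// lerD.
have TW g w : W w -> W (T g w) by move=> Ww; rewrite /W addmx_sub//; exact: LW.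
have TM g k w : T g (T k w) = T (g * k)%g w.
  by rewrite /T mulmxDl -mulmxA -LM Ls addrA addrNK.
have LV g (w : 'rV[R]_d) : w *m L g *m L g^-1%g = w by rewrite -mulmxA -LM mulVg L1 mulmx1.
have lower g w : W w -> `|w| ^+ 2 <= B ^+ 2 * sqnorm (w *m L g).
  move=> Ww; apply: (@le_trans _ _ ((B * `|w *m L g|) ^+ 2)).
    by rewrite ler_sqr ?nnegrE ?mulr_ge0// -{1}(LV g w) LB//; exact: LW.
  by rewrite exprMn ler_wpM2l ?sqr_ge0// norm_le_sqnorm.
pose D a w := forall g, sqnorm (T g w) <= a.
(* By the parallelogram law and [lower], the infimum [mu] of the [a] with
   [D a w] for some [w] in [W] is attained, at a single point [xi]; since
   [D mu] is invariant under the group of maps [T g], they fix [xi]. *)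
pose K := 4 * (B ^+ 2 + 1); have K4 : 4 <= K by have := sqr_ge0 B; rewrite /K; lra.
have K0 : 0 <= K by exact: le_trans K4.
(* [K] combines the factor 1/4 of the parallelogram law with the [B ^+ 2] of [lower]; the added 1
   gives [K >= 4], which makes [K] positive and lets [K] be bounded by [K ^+ 2] below. *)
have midD a w w' : W w -> W w' -> D a w -> D a w' ->
    D (a - `|w - w'| ^+ 2 / K) (2^-1 *: (w + w')).
  move=> Ww Ww' Dw Dw' g.
  have -> : T g (2^-1 *: (w + w')) = 2^-1 *: (T g w + T g w').
    rewrite /T -scalemxAl mulmxDl addrACA !scalerDr -!addrA; congr (_ + (_ + _)).
    by rewrite -scalerDl -[LHS]scale1r; congr (_ *: _); field.
  rewrite sqnorm_parallelogram.
  have -> : T g w - T g w' = (w - w') *m L g.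
    by rewrite /T mulmxBl opprD addrACA subrr addr0.
  have Wd : W (w - w') by rewrite /W addmx_sub// eqmx_opp.
  have : `|w - w'| ^+ 2 / K <= 4^-1 * sqnorm ((w - w') *m L g).
    rewrite ler_pdivrMr; last by lra.
    have := lower g _ Wd; have := sqnorm_ge0 ((w - w') *m L g); rewrite /K.
    set q := sqnorm _; set p := `|_| ^+ 2; move=> q0 pq.
    have -> : 4^-1 * q * (4 * (B ^+ 2 + 1)) = B ^+ 2 * q + q by field.
    lra.
  by have := Dw g; have := Dw' g; lra.
clearbody K.
pose S : set R := [set a | exists2 w, W w & D a w].
have S_ge0 a : S a -> 0 <= a by move=> [w _ /(_ 1%g)]; exact: le_trans (sqnorm_ge0 _).
have hS : has_inf S.
  split; last by exists 0 => a /S_ge0.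
  exists (d%:R * C ^+ 2), 0; first exact: sub0mx.
  move=> g; rewrite /T mul0mx add0r (le_trans (sqnorm_le_norm _))//.
  by rewrite ler_wpM2l// lerXn2r ?nnegrE ?sC// (le_trans _ (sC g)).
set mu := inf S.
have mu0 : 0 <= mu by apply: lb_le_inf; [exact: hS.1|move=> a /S_ge0].
have close a w w' : W w -> W w' -> D a w -> D a w' -> `|w - w'| ^+ 2 <= K * (a - mu).
  move=> Ww Ww' Dw Dw'; have : mu <= a - `|w - w'| ^+ 2 / K.
    apply: ge_inf; first exact: hS.2.
    exists (2^-1 *: (w + w')); last exact: midD.
    by rewrite /W scalemx_sub// addmx_sub.
  by rewrite lerBrDl -lerBrDr ler_pdivrMr 1?mulrC//; lra.
(* The tolerance is [4^-k] because [close] bounds squared distances; successive points are then at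
   most [K / 2^k] apart, as [geometric_limit_rV] requires. *)
have minimizing k : exists w, W w /\ D (mu + (2 ^+ k) ^- 2) w.
  have e0 : 0 < (2 ^+ k) ^- 2 :> R by rewrite invr_gt0 exprn_gt0// exprn_gt0.
  have [a [w Ww Dw] aw] := inf_adherent e0 hS; exists w; split => // g.
  exact: le_trans (Dw g) (ltW aw).
have [w wP] := choice minimizing.
have e_pos k : 0 < (2 ^+ k : R)^-1 by rewrite invr_gt0 exprn_gt0.
have step k : `|w k.+1 - w k| <= K / 2 ^+ k.
  have [W1 D1] := wP k.+1; have [W0 D0] := wP k.
  rewrite -ler_sqr ?nnegrE ?(mulr_ge0 K0 (ltW (e_pos k)))//.
  apply: (@le_trans _ _ (K * (mu + (2 ^+ k) ^- 2 - mu))).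
    apply: close => // g; apply: le_trans (D1 g) _; rewrite lerD2l.
    rewrite lef_pV2 ?posrE ?exprn_gt0 ?exprn_gt0// lerXn2r ?nnegrE ?exprn_ge0//.
    by rewrite exprS ler_peMl ?exprn_ge0//; lra.
  rewrite addrAC subrr add0r exprMn -exprVn ler_wpM2r ?sqr_ge0// expr2 ler_peMl//; lra.
have [xi xiP] := geometric_limit_rV K0 step.
(* A span is closed, being the kernel of [cokermx A]. *)
have Wxi : W xi.
  rewrite /W submxE; have [c c0 cP] := mulmx_bound (cokermx A).
  apply/eqP/normr0_eq0/eqP; rewrite eq_le normr_ge0 andbT.
  apply: (@le_geometric _ _ (c * (2 * K))) => k; rewrite add0r -mulrA.
  have [Wk _] := wP k; have Wk0 : w k *m cokermx A = 0 by apply/eqP; rewrite -submxE.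
  rewrite -normrN -[X in `|X|]add0r -Wk0 -mulmxBl (le_trans (cP _))//.
  by rewrite ler_wpM2l.
(* The bound passes to the limit: with parameter [e = 2^-k], Young's inequality gives
   [(1 + e) (mu + e^2)] from [w k] and [(1 + e^-1)] times an error of order [e^2], together at most
   [mu] plus a constant times [e]. *)
have Dxi : D mu xi.
  move=> g; have [c c0 cP] := mulmx_bound (L g).
  apply: (@le_geometric _ _ (mu + 2 + 2 * (d%:R * (c * (2 * K)) ^+ 2))) => k.
  have [_ /(_ g) Dk] := wP k; have e0 := e_pos k.
  have := sqnorm_young (T g xi) (T g (w k)) e0.
  have -> : T g xi - T g (w k) = (xi - w k) *m L g.
    by rewrite /T mulmxBl opprD addrACA subrr addr0.
  have : sqnorm ((xi - w k) *m L g) <= d%:R * (c * (2 * K)) ^+ 2 * (2 ^+ k) ^- 2.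
    rewrite (le_trans (sqnorm_le_norm _))// -mulrA ler_wpM2l// -exprVn -exprMn.
    rewrite lerXn2r ?nnegrE// ?(le_trans (normr_ge0 _) (cP _))//.
      exact: mulr_ge0 (mulr_ge0 c0 (mulr_ge0 (ler0n _ 2) K0)) (ltW e0).
    rewrite (le_trans (cP _))// -!mulrA ler_wpM2l// distrC.
    by have := xiP k; rewrite -mulrA.
  set F := d%:R * _; have F0 : 0 <= F by rewrite mulr_ge0// sqr_ge0.
  move: Dk e0; rewrite -exprVn; set e := (2 ^+ k)^-1 => Dk e0 Q Y; apply: le_trans Y _.
  have e1 : e <= 1 by rewrite invf_le1 ?exprn_gt0// exprn_ege1//; lra.
  have ee : e ^+ 2 <= e by rewrite expr2 ger_pMr.
  have Y1 : (1 + e) * sqnorm (T g (w k)) <= (1 + e) * (mu + e ^+ 2).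
    by rewrite ler_wpM2l// addr_ge0// ltW.
  have Y2 : (1 + e^-1) * sqnorm ((xi - w k) *m L g) <= (1 + e^-1) * (F * e ^+ 2).
    by rewrite ler_wpM2l// addr_ge0// invr_ge0 ltW.
  have Z2 : (1 + e^-1) * (F * e ^+ 2) = F * e ^+ 2 + F * e by field; rewrite gt_eqF.
  have F1 : F * e ^+ 2 <= F * e by rewrite ler_wpM2l.
  have e3 : e * e ^+ 2 <= e by rewrite ger_pMr// (le_trans ee).
  rewrite Z2 in Y2; apply: le_trans (lerD Y1 Y2) _; rewrite mulrDl mul1r mulrDr.
  by rewrite [(mu + 2 + _) * _]mulrDl [(mu + 2) * _]mulrDl; lra.
(* [T h0] permutes the conditions that make up [D mu], so [T h0 xi] satisfies them too; [close] with
   [a = mu] leaves no distance between it and [xi]. *)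
have close0 h0 : `|T h0 xi - xi| ^+ 2 <= K * (mu - mu).
  by apply: close => //; [exact: TW|move=> g; rewrite TM].
exists xi => g; apply/eqP; rewrite -subr_eq0 -normr_eq0 -sqrf_eq0 eq_le sqr_ge0 andbT.
by have := close0 g; rewrite subrr mulr0.
Qed.

End BoundedCocycle.

(** * Existence of the multi-moment map *)

Section LocallyConstant.
Context {R : realType} {m n : nat} (G : lieGroupType R m) (M : manifoldType R n).
Variable act : G -> M -> M.
Hypothesis hact : smooth_action act.

Lemma smooth_fun_diff (f : M -> R) x : smooth_fun f ->
  is_diff (chart_at x x) (f \o cinv (chart_at x) : _ -> R^o) (dfun f x).
Proof. by move=> /(_ x 1%N)[H _]; apply: is_diffP; exact/H/ccod_cmap/chart_atP. Qed.

Lemma smooth_fun_continuous (f : M -> R) : smooth_fun f -> continuous (f : M -> R^o).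
Proof.
move=> fs x; have [df _] := smooth_fun_diff x fs.
have cx := chart_atP x.
have C : {for x, continuous ((f \o cinv (chart_at x) : _ -> R^o) \o chart_at x)}.
  apply: continuous_comp; first exact: cmap_cvg.
  exact: differentiable_continuous.
pose h := (f \o cinv (chart_at x) : _ -> R^o) \o chart_at x.
have {}C : h @ x --> h x by exact: C.
have E : h x = f x by rewrite /h /= cmapKP.
rewrite E in C; apply: cvg_trans C; apply: near_eq_cvg.
apply: filterS (open_nbhs_nbhs (conj (cdom_open (chart_at x)) cx)) => y cy /=.
by rewrite /h /= cmapKP.
Qed.

(** One coordinate ball serves all indices [i] at once; this uniformity matters because [tau x] is a
    whole family indexed by [g]. *)
Lemma diff0_locally_constant (I : Type) (f : I -> M -> R) :
  (forall i x, is_diff (chart_at x x) (f i \o cinv (chart_at x) : _ -> R^o) (fun=> 0)) ->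
  forall x, \forall y \near x, forall i, f i y = f i x.
Proof.
move=> H x; set c := chart_at x; have cx : cdom c x := chart_atP x.
have : nbhs (c x) (ccod c) by exact/near_ccod/ccod_cmap.
move=> /nbhs_ballP[e /= e0 ball_c].
have D i z : ccod c z -> is_diff z (f i \o cinv c : _ -> R^o) (fun=> 0).
  move=> cz; set y := cinv c z.
  have cy : cdom c y by exact: cdom_cinv.
  have T : is_diff z (chart_at y \o cinv c) ('d (chart_at y \o cinv c) z).
    apply: is_diffP; rewrite -[z](cinvKP cz); apply: transition_diff => //.
    exact: chart_atP.
  exact: (is_diff_through (cinv_cvg cz) (chart_atP y) T (H i y)).
have B : \forall y \near x, cdom c y /\ ball (c x) e (c y).
  apply: filterI; first exact: open_nbhs_nbhs (conj (cdom_open c) cx).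
  apply: (cmap_cvg cx); exact: nbhsx_ballx.
apply: filterS B => y [cy By] i.
have K z : ball (c x) e z -> differentiable (f i \o cinv c : _ -> R^o) z /\
    'd (f i \o cinv c : _ -> R^o) z =1 fun=> 0.
  move=> /ball_c /D-/(_ i) Hz; split; first exact: is_diff_ex Hz.
  by move=> v; exact: (is_diff_val v Hz).
by have := diff0_const K By; rewrite /= !cmapKP.
Qed.

Lemma orbit_continuous x : continuous (act^~ x).
Proof. by move=> g; have [] := smooth2_mdiffl (act_smooth hact) g x. Qed.

(** The set of [h] with [f (h x) = f x] contains 1 and is open and closed. [S] is a bare type so
    that [f] may take values in functions on [G], as [tau] does. *)
Lemma locally_constant_orbit (S : Type) (f : M -> S) : connected [set: G] ->
  (forall x, \forall y \near x, f y = f x) -> forall g x, f (act g x) = f x.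
Proof.
move=> Gc fl g x; pose B : set G := [set h | f (act h x) = f x].
have Bn h : \forall k \near h, f (act k x) = f (act h x).
  by move: (fl (act h x)) => /(@orbit_continuous x h).
suff : B = setT by move=> /(congr1 (fun A => A g)) /= E; rewrite -[f _ = _]/(B g) E.
apply: Gc.
- by exists 1%g; rewrite /B /= (act_one hact).
- exists B; last by rewrite setTI.
  by rewrite openE => h Bh; apply: filterS (Bn h) => k E; rewrite /B /= E.
- exists B; last by rewrite setTI.
  rewrite -[B]setCK; apply: open_closedC; rewrite openE => h Bh.
  by apply: filterS (Bn h) => k E Bk; apply: Bh; rewrite /B /= -E.
Qed.

Lemma compact_continuous_bounded (T : topologicalType) (f : T -> R^o) :
  compact [set: T] -> continuous f -> exists C : R, forall x, `|f x| <= C.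
Proof.
move=> Tc fc; have : compact (f @` setT).
  by apply: continuous_compact => //; exact: continuous_subspaceT.
move=> /compact_bounded[C [_ HC]]; exists (C + 1) => x.
by apply: (HC (C + 1)); [rewrite ltrDl|exists x].
Qed.

End LocallyConstant.

Lemma raw_linear_sum (R : pzRingType) (V W : lmodType R) (f : V -> W) (I : Type)
    (r : seq I) (P : pred I) (c : I -> R) (v : I -> V) : linear f ->
  f (\sum_(i <- r | P i) c i *: v i) = \sum_(i <- r | P i) c i *: f (v i).
Proof.
move=> Hf; elim/big_rec2: _ => [|i x y _ <-]; last exact: Hf.
by have := Hf (-1) 0 0; rewrite scaler0 addr0 scaleN1r addNr.
Qed.

(** * Primitives, their defect and its correction *)

Section Assembly.
Context {R : realType} {m n s : nat} (G : lieGroupType R m) (M : manifoldType R n).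
Variables (alpha : diff_form M s.+2) (act : G -> M -> M).
Hypothesis alpha_closed : closed_form alpha.
Hypothesis hG : group_of_symmetries alpha act.
Hypothesis hb1 : betti1 M 0.
Hypothesis hbounded : forall (f : M -> R) (x : M), smooth_fun f ->
  exists C : R, forall g, `|f (act g x)| <= C.

Let hact : smooth_action act := symm_action hG.
Let ap : forall g, preserves_form (act g) alpha := symm_preserves hG.
Local Notation E := (subvs_of (lie_kernel G s.+1)).
Local Notation d := (\dim {:E}).
Let b : d.-tuple E := vbasis {:E}.
Let crd (p : E) (j : 'I_d) : R := coord b j p.

Let crdE (p : E) : p = \sum_j crd p j *: b`_j.
Proof. by apply: coord_vbasis; exact: memvf. Qed.

Let crd_sum (I : finType) (a : I -> R) (p : I -> E) j :
  crd (\sum_i a i *: p i) j = \sum_i a i * crd (p i) j.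
Proof. by rewrite /crd linear_sum; apply: eq_bigr => i _; rewrite linearZ. Qed.

Let crd_b (i j : 'I_d) : crd b`_i j = (i == j)%:R.
Proof. by rewrite /crd coord_free//; exact: basis_free (vbasisP _). Qed.

(** [fundamental_push] carries the field of [X] to that of [Ad g X], and [alpha] is invariant. *)
Lemma multi_contract_push g (p : Lambda R s.+1 m) x v :
  multi_contract alpha act (Lambda_map (Ad g) p) (act g x) (mdiff (act g) x v) =
  multi_contract alpha act p x v.
Proof.
have am : multilinear (alpha (act g x)) by move=> *; exact: form_multilinear.
have aa : is_alternating (alpha (act g x)) by move=> w i j; exact: form_alternating.
rewrite /multi_contract pairing_Lambda_map.
- apply: eq_bigr => f _; congr (_ * _); rewrite -[RHS](ap g).
  congr (alpha _ _); apply/funext => i; rewrite /append !nth_cat !size_image card_ord.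
  case: ltnP => is1.
    by rewrite -[i : nat]/(Ordinal is1 : nat) !nth_ord_image (fundamental_push hact).
  by have -> : (i - s.+1)%N = 0%N by have := ltn_ord i; lia.
- exact: (multilinear_comp (fundamental_linear hact _)
    (multilinear_append (leqnSn s.+1) [:: mdiff (act g) x v] am)).
- exact: (@alternating_comp _ _ _ (fun X => fundamental act X _) _ _
    (alternating_append (leqnSn s.+1) [:: mdiff (act g) x v] aa)).
Qed.

Let potential (j : 'I_d) : exists f : M -> R, smooth_fun f /\
  forall x v, dfun f x v = multi_contract alpha act (vsval b`_j) x v.
Proof.
(* Since [b_1 = 0], the sum over a basis of the cohomology is empty and the closed form is itself a
   differential. *)
have [w [_ /(_ (multi_contract_form alpha hact (vsval b`_j)))]] := hb1.
case=> [x v|a [[f [fs fd]] _]].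
  apply: multi_contract_closed_at => //; apply/eqP.
  by rewrite -mem_lie_kernel; exact: subvsP.
exists f; split => // x v.
by have := fd x (fun=> v); rewrite big_ord0 subr0.
Qed.

Let f : 'I_d -> M -> R := projT1 (choice potential).
Let f_smooth j : smooth_fun (f j).
Proof. by have [] := projT2 (choice potential) j. Qed.
Let f_diff j x v : dfun (f j) x v = multi_contract alpha act (vsval b`_j) x v.
Proof. by have [] := projT2 (choice potential) j. Qed.

Let F x : 'rV[R]_d := \row_j f j x.
(** The dual action of [g] in coordinates. Row vectors are multiplied on the right, so products of
    group elements appear in reverse order. *)
Let L (g : G) : 'M[R]_d := \matrix_(j, i) crd (Ad_kernel g^-1%g b`_i) j.
Let pr (p : E) (xi : 'rV[R]_d) : R := \sum_j xi 0 j * crd p j.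

Let pr_L p g xi : pr p (xi *m L g) = pr (Ad_kernel g^-1%g p) xi.
Proof.
rewrite /pr; under eq_bigr => i _ do rewrite mxE mulr_suml.
rewrite exchange_big; apply: eq_bigr => j _ /=.
have -> : Ad_kernel g^-1%g p = \sum_i crd p i *: Ad_kernel g^-1%g b`_i.
  by rewrite {1}(crdE p) (raw_linear_sum _ _ _ _ (Ad_kernel_linear _)).
rewrite crd_sum mulr_sumr; apply: eq_bigr => i _; rewrite mxE.
by rewrite -mulrA [crd p i * _]mulrC.
Qed.

Let pr_b (i : 'I_d) xi : pr b`_i xi = xi 0 i.
Proof.
rewrite /pr (bigD1 i)//= crd_b eqxx mulr1 big1 ?addr0// => j ij.
by rewrite crd_b eq_sym (negbTE ij) mulr0.
Qed.

Let pr_inj u v : (forall p, pr p u = pr p v) -> u = v.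
Proof. by move=> H; apply/rowP => i; have := H b`_i; rewrite (pr_b i u) (pr_b i v). Qed.

Let LM g h : L (g * h)%g = L h *m L g.
Proof.
have E1 (A B : 'M[R]_d) : (forall xi : 'rV[R]_d, xi *m A = xi *m B) -> A = B.
  by move=> H; apply/row_matrixP => i; rewrite !rowE H.
apply: E1 => xi; apply: pr_inj => p.
apply: etrans (pr_L p (g * h)%g xi) _; rewrite invgM Ad_kernelM mulmxA.
exact: esym (etrans (pr_L p g (xi *m L h)) (pr_L _ h xi)).
Qed.

Let L1 : L 1%g = 1%:M.
Proof.
apply/matrixP => j i; rewrite !mxE invg1 Ad_kernel1.
by rewrite crd_b eq_sym.
Qed.

Let dpr p x v : \sum_j crd p j *: (dfun (f j) x v : R^o) = multi_contract alpha act (vsval p) x v.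
Proof.
rewrite [in RHS](crdE p) (raw_linear_sum _ _ _ _ (@linearP _ _ _ _ vsval)).
rewrite (raw_linear_sum _ _ _ _ (multi_contract_linearl alpha act x v)).
by apply: eq_bigr => j _; rewrite f_diff.
Qed.

Let tau (x : M) (g : G) : 'rV[R]_d := F (act g x) - F x *m L g.

Let tau_diff (gi : G * 'I_d) x :
  is_diff (chart_at x x) ((fun y => tau y gi.1 0 gi.2) \o cinv (chart_at x) : _ -> R^o) (fun=> 0).
Proof.
case: gi => g i /=; set c := chart_at x.
have H1 := is_diff_mdiff_comp (smooth2_mdiffr (act_smooth hact) g x)
  (smooth_fun_diff (act g x) (f_smooth i)).
have H2 : is_diff (c x) (fun y => \sum_j L g j i *: (f j (cinv c y) : R^o))
    (fun v => \sum_j L g j i *: (dfun (f j) x v : R^o)).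
  by apply: is_diff_sum => j _; exact: (@is_diffZ _ _ _ _ _ _ _ (smooth_fun_diff x (f_smooth j))).
have H : is_diff (c x) ((fun y => tau y g 0 i) \o cinv c : _ -> R^o)
    (fun v => dfun (f i) (act g x) (mdiff (act g) x v) - \sum_j L g j i *: (dfun (f j) x v : R^o)).
  apply: (near_is_diff _ (is_diff_sub H1 H2)); 
    apply: filterS (near_ccod (ccod_cmap (chart_atP x))) => y _.
  rewrite /= /tau !mxE; congr (_ - _); apply: eq_bigr => j _.
  have -> : F (cinv c y) 0 j = f j (cinv c y) by rewrite mxE.
  exact: mulrC.
apply: (is_diff_eq H); apply/funext => v.
under eq_bigr => j _ do rewrite mxE.
(* The sum is the contraction with [Ad_(g^-1) b_i] at [x]; pushed forward by [g] it is the
   contraction with [b_i] at [g x], and the two terms cancel. *)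
rewrite dpr f_diff -(multi_contract_push g (vsval (Ad_kernel g^-1%g _))).
rewrite -vsval_Ad_kernel -Ad_kernelM mulgV Ad_kernel1.
exact: subrr.
Qed.

Let tau_locally_constant x : \forall y \near x, tau y = tau x.
Proof.
apply: filterS (diff0_locally_constant tau_diff x) => y H.
by apply/funext => g; apply/rowP => i; exact: (H (g, i)).
Qed.

Let tau_orbit g x : tau (act g x) = tau x.
Proof. exact: (locally_constant_orbit hact (symm_connected hG) tau_locally_constant). Qed.

(* As a function of the cocycle only, the fixed point is locally constant in [x]. *)
Let fixed (t : G -> 'rV[R]_d) : 'rV[R]_d :=
  xget 0 [set xi | forall g, xi *m L g + t g = xi].

Let fixedP x g : fixed (tau x) *m L g + tau x g = fixed (tau x).
Proof.
suff : exists xi, [set xi | forall g, xi *m L g + tau x g = xi] xi by move=> /(xgetPex 0)/(_ g).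
(* Moving the origin to [F x] turns the affine maps into [w |-> w *m L k + s' k]. In [tau x k] the
   possibly unbounded [L k] occurs, whereas [s'] is bounded by [hbounded]; the fixed point is
   shifted back at the end. *)
pose s' h := F (act h x) - F x.
have [C sC] : exists C : R, forall h, `|s' h| <= C.
  have [B HB] := choice (fun j => hbounded x (f_smooth j)).
  have B0 j : 0 <= B j by exact: le_trans (HB j 1%g).
  exists (\sum_j B j + `|F x|) => h; rewrite (le_trans (ler_normB _ _))// lerD2r.
  apply: rV_norm_le => [|j]; first exact: sumr_ge0.
  by rewrite mxE (le_trans (HB j h))// (bigD1 j)//= lerDl sumr_ge0.
(* The cocycle identity amounts to [tau (h x) k = tau x k], the constancy of [tau] on the orbit. *)
have Ls k h : s' h *m L k = s' (k * h)%g - s' k.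
  have /(congr1 (fun t => t k)) := tau_orbit h x; rewrite /tau => T.
  rewrite /s' mulmxBl (act_mul hact) opprB addrA addrNK.
  move/eqP: T; rewrite subr_eq => /eqP ->.
  by rewrite addrAC [F (act k x) - _]addrC addrK addrC.
have [xi H] := bounded_cocycle LM L1 Ls sC; exists (xi + F x) => k.
rewrite mulmxDl /tau addrACA subrr addr0 -[xi in RHS](H k).
by rewrite /s' -addrA addrNK.
Qed.

Let nu (x : M) : lie_kernel_dual G s.+1 :=
  \sum_j (F x - fixed (tau x)) 0 j *: linfun (coord b j).

Let nuE x p : nu x p = pr p (F x - fixed (tau x)).
Proof.
rewrite /nu sum_lfunE; apply: eq_bigr => j _; by rewrite scale_lfunE lfunE.
Qed.

Let nu_sum p x : nu x p = \sum_j crd p j *: (f j x - fixed (tau x) 0 j : R^o).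
Proof.
by rewrite nuE; apply: eq_bigr => j _; rewrite !mxE mulrC.
Qed.

Lemma multi_moment_map_exists : exists nu, multi_moment_map (r := s.+2) alpha act nu.
Proof.
exists nu; split.
- move=> p x k; set c := chart_at x; apply: Ck_local => y cy.
  (* Near each point the correction [fixed (tau _)] is constant, so smoothness is that of the
     [f j]. *)
  have : \forall z \near y, ccod c z /\ tau (cinv c z) = tau (cinv c y).
    apply: filterI; first exact: near_ccod.
    exact: (cinv_cvg cy (tau_locally_constant (cinv c y))).
  move=> /nbhs_ballP[e /= e0 Be]; exists (ball y e); first exact: ballxx.
  have Uo : open (ball y e) by exact: ball_open.
  apply: (@Ck_ext _ _ R^o k _ (fun z => \sum_j crd p j *:
    ((f j (cinv c z) : R^o) + - fixed (tau (cinv c y)) 0 j)) _ Uo).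
    by move=> z /Be[_ E]; rewrite /= nu_sum E.
  apply: (@Ck_sum _ _ R^o k _ _ _ _ (fun j z => crd p j *:
    ((f j (cinv c z) : R^o) + - fixed (tau (cinv c y)) 0 j)) Uo).
  move=> j _; apply: (@Ck_scale _ _ R^o k _ (fun=> crd p j : R^o) _ Uo).
    exact: Ck_cst.
  apply: (@Ck_add _ _ R^o k _ _ _ Uo); last exact: Ck_cst.
  by apply: (@CkW _ _ R^o k (ccod c)); [move=> z /Be[]|exact: f_smooth].
(* By [tau_orbit] one fixed point [xi] serves both [x] and [g x], and
   [F (g x) - xi = (F x - xi) *m L g] because [xi = xi *m L g + tau x g]. *)
- move=> g x p; rewrite !nuE; apply: etrans (pr_L p g _); congr pr.
  rewrite tau_orbit mulmxBl -{1}(fixedP x g) /tau.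
  have aux (A X Y : 'rV[R]_d) : A - (X + (A - Y)) = Y - X.
    by rewrite opprD opprB addrCA [A + _]addrC subrK addrC.
  exact: aux.
- move=> p x v; rewrite contract_multivector -dpr.
  set c := chart_at x; have cx : ccod c (c x) by exact/ccod_cmap/chart_atP.
  have H : is_diff (c x) (fun z => \sum_j crd p j *:
      ((f j (cinv c z) : R^o) - fixed (tau x) 0 j))
      (fun v => \sum_j crd p j *: (dfun (f j) x v - 0 : R^o)).
    apply: is_diff_sum => j _; apply: is_diffZ.
    exact: (is_diff_sub (smooth_fun_diff x (f_smooth j)) (is_diff_const _ _)).
  have H' : is_diff (c x) ((fun y => nu y p : R) \o cinv c : _ -> R^o)
      (fun v => \sum_j crd p j *: (dfun (f j) x v - 0 : R^o)).
    apply: (near_is_diff _ H).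
    have : \forall z \near c x, tau (cinv c z) = tau x.
      have : \forall z \near c x, tau (cinv c z) = tau (cinv c (c x)).
        exact: (cinv_cvg cx (tau_locally_constant (cinv c (c x)))).
      by rewrite (cmapKP (chart_atP x)).
    by apply: filterS => z E; rewrite /= nu_sum E.
  apply: etrans (is_diff_val v H') _.
  by apply: eq_bigr => j _; rewrite subr0.
Qed.

End Assembly.

Theorem theorem3p10 (R : realType) (m n r : nat) (hr : (2 <= r)%N)
    (M : manifoldType R n) (alpha : diff_form M r)
    (alpha_closed : closed_form alpha)
    (G : lieGroupType R m) (act : G -> M -> M)
    (hG : group_of_symmetries alpha act)
    (hb1 : betti1 M 0)
    (hcase : compact [set: G] \/
             [/\ compact [set: M], orientable M
               & exists2 vol : diff_form M n, volume_form vol &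
                   forall g : G, preserves_form (act g) vol]) :
  exists nu : M -> lie_kernel_dual G r.-1, multi_moment_map alpha act nu.
Proof.
case: r hr alpha alpha_closed hG => [|[|s]] // _ alpha alpha_closed hG.
apply: (multi_moment_map_exists alpha_closed hG hb1) => f x fs.
have fc := smooth_fun_continuous fs.
(* In the first case [f] is bounded along the orbit as a continuous function on [G], in the second
   it is bounded on all of [M]. *)
case: hcase => [Gc|[Mc _ _]].
  apply: (@compact_continuous_bounded R G (fun g => f (act g x)) Gc) => g.
  apply: continuous_comp; last exact: fc.
  exact: (orbit_continuous (symm_action hG)).
have [C HC] := compact_continuous_bounded Mc fc.
by exists C => g; exact: HC.
Qed.
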